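(* Let $\Lambda\subset\mathbb{R}\times\mathbb{R}$ be a discrete set such that the Gaussian Gabor system $\mathcal{G}_\Lambda=\{\tau_{x,y}\gamma\}_{(x,y)\in\Lambda}$ is complete and minimal in $L^2(\mathbb{R})$, and let $\{h_{x,y}\}_{(x,y)\in\Lambda}$ be its biorthogonal system. Then for any partition $\Lambda=\Lambda_1\cup\Lambda_2$, $\Lambda_1\cap\Lambda_2=\emptyset$, the orthogonal complement in $L^2(\mathbb{R})$ of the mixed system $$\mathcal{G}_{\Lambda_1,\Lambda_2}=\{\tau_{x,y}\gamma\}_{(x,y)\in\Lambda_2}\cup\{h_{x,y}\}_{(x,y)\in\Lambda_1}$$ is at most one-dimensional.
   Context: Let $\gamma(s)=e^{-\pi s^2}$, $s\in\mathbb{R}$, and for $(x,y)\in\mathbb{R}\times\mathbb{R}$ put $\tau_{x,y}\gamma(s)=e^{2\pi i ys}\gamma(s-x)$. A system of vectors is complete if its closed linear span is the whole space, and minimal if no element of it belongs to the closed linear span of the others. If $\mathcal{G}_\Lambda$ is complete and minimal, its biorthogonal system is the unique family $\{h_{x,y}\}_{(x,y)\in\Lambda}\subset L^2(\mathbb{R})$ with $(\tau_{x,y}\gamma,h_{x',y'})=\delta_{x,x'}\delta_{y,y'}$ for all $(x,y),(x',y')\in\Lambda$. *)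

(* Defs.v *)
From mathcomp Require Import all_boot all_order all_algebra.
From mathcomp Require Import complex.
From mathcomp Require Import all_classical all_reals all_analysis.
Import Order.TTheory GRing.Theory Num.Theory.
Import numFieldNormedType.Exports.
Import ComplexField.

Set Implicit Arguments.
Unset Strict Implicit.
Unset Printing Implicit Defensive.

Local Open Scope classical_set_scope.
Local Open Scope complex_scope.
Local Open Scope ring_scope.

(* Elements of L^2(R) are handled through representatives f : R -> R[i];
   equality in L^2(R) is equality almost everywhere. Measurability is with
   respect to the Borel sigma-algebra, which gives the same L^2(R) since a
   Lebesgue measurable function is almost everywhere equal to a Borel one. *)

Section complex_L2.
Context {R : realType}.
Implicit Types (f g : R -> R[i]) (A : set (R -> R[i])).

Local Notation mu := (lebesgue_measure : {measure set (measurableTypeR R) -> \bar R}).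

Definition L2norm f : \bar R :=
  'N[mu]_2%:E[EFin \o @Normc.normc R \o f].

Definition L2 : set (R -> R[i]) :=
  [set f | [/\ measurable_fun [set: measurableTypeR R] (fun s => complex.Re (f s)),
               measurable_fun [set: measurableTypeR R] (fun s => complex.Im (f s)) &
               (L2norm f < +oo)%E]].

Definition Cintegral f : R[i] :=
  Rintegral mu setT (fun s => complex.Re (f s))
  +i* Rintegral mu setT (fun s => complex.Im (f s)).

Definition inner f g : R[i] := Cintegral (fun s => f s * (g s)^*%C).

Definition linear_span A : set (R -> R[i]) :=
  [set g | exists (n : nat) (c : 'I_n -> R[i]) (v : 'I_n -> R -> R[i]),
     (forall i, A (v i)) /\ g = (fun s => \sum_(i < n) c i * v i s)].

Definition closed_linear_span A : set (R -> R[i]) :=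
  [set f | L2 f /\ forall e : R, 0 < e ->
     exists2 g, linear_span A g & (L2norm (fun s => f s - g s)%R < e%:E)%E].

Definition complete_system (I : Type) (Lam : set I) (u : I -> R -> R[i]) : Prop :=
  L2 `<=` closed_linear_span (u @` Lam).

Definition minimal_system (I : Type) (Lam : set I) (u : I -> R -> R[i]) : Prop :=
  forall l, Lam l -> ~ closed_linear_span (u @` (Lam `\ l)) (u l).

Definition biorthogonal (I : eqType) (Lam : set I) (u h : I -> R -> R[i]) : Prop :=
  (forall l, Lam l -> L2 (h l)) /\
  forall l l', Lam l -> Lam l' -> inner (u l) (h l') = (l == l')%:R.

Definition orthogonal_complement A : set (R -> R[i]) :=
  [set f | L2 f /\ forall g, A g -> inner f g = 0].

(* Meaningful for A a linear subspace of L^2(R), such as an orthogonal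
   complement; e = 0 covers dimension zero. *)
Definition at_most_one_dimensional A : Prop :=
  exists2 e, A e & forall f, A f ->
    exists c : R[i], {ae mu, forall s, f s = c * e s}.

Definition gaussian (s : R) : R := expR (- (pi * s ^+ 2)).

(* e^{i t} *)
Definition cis (t : R) : R[i] := cos t +i* sin t.

Definition tau (l : R * R) (s : R) : R[i] :=
  cis (2 * pi * l.2 * s) * (gaussian (s - l.1))%:C.

End complex_L2.

(* Main.v *)
(* The Bargmann transform [Bf] maps L^2(R), isometrically up to a constant, into
   the Fock space [inH]. Holomorphy is replaced by the reproducing formula for the
   kernel [kr], of which two consequences are used: multiplication by [zeta - a]
   maps [inH] into the slightly larger space [inE], and a function of [inE]
   vanishing at [a] is [zeta - a] times a function of [inH]. Completeness of the
   Gabor system means that Lambda is a uniqueness set for [inH].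

   Let h_l be the biorthogonal system and G = (zeta - zeta l0) Bf h_l0 for some l0
   in Lambda. Then G vanishes exactly on Lambda and G / (zeta - zeta l) is a
   multiple of Bf h_l for every l in Lambda. Let Phi and F be transforms of
   elements of the orthogonal complement of the mixed system. The function
     w |-> int (Phi z G w - Phi w G z) / (zeta z - zeta w) conj (F z) dz
   lies in [inE] and vanishes on Lambda, because Phi vanishes on Lambda_2 and F is
   orthogonal to G / (zeta - zeta l) for l in Lambda_1; hence it equals c G for
   some constant c. If c <> 0, bootstrapping the potential of G conj F gives
   |G| <= C |Phi| near infinity, so G belongs to [inH] and vanishes on a
   uniqueness set, which is absurd. Thus c = 0.

   Eliminating G, for Phi1, Phi2, F in this space the kernel
     D(z, w) = (Phi1 z Phi2 w - Phi1 w Phi2 z) / (zeta z - zeta w)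
   is orthogonal to F in z for almost every w. Since D is symmetric, integrating
   (zeta z - zeta w) D(z, w) against conj (Phi1 z) conj (Phi2 w) gives
     |Phi1|^2 |Phi2|^2 = |<Phi1, Phi2>|^2,
   so orthogonal elements cannot both be nonzero. *)
Require Import Defs.
From HB Require Import structures.
From mathcomp Require Import all_boot all_order all_algebra.
From mathcomp Require Import complex.
From mathcomp Require Import all_classical all_reals all_analysis.
From mathcomp Require Import measurable_realfun.
From mathcomp Require Import ring lra.
Import Order.TTheory GRing.Theory Num.Theory.
Import numFieldNormedType.Exports.

Set Implicit Arguments.
Unset Strict Implicit.
Unset Printing Implicit Defensive.

Local Open Scope classical_set_scope.
Local Open Scope ring_scope.
Local Open Scope complex_scope.

(** All the analysis rests on explicit Gaussian integrals: the reproducing property of [kr], its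
    first moment in [zeta], and the integral of a divided difference of exponentials. Where a
    contour shift or a derivative under the integral sign would be natural, the defect of the
    identity is shown to change by at most a constant times [t ^+ 2] under a step [t], hence to be
    constant on a segment.

    G need not be square integrable; dividing by the linearly growing [wt] makes it so, and this is
    [inE]. Such a function that vanishes on Lambda and at one further point is zero, because
    removing the extra zero lands in [inH]. This gives the constant c.

    If c <> 0, the identity c G = G pot(Phi) - Phi pot(G) is read near infinity. There the potential
    of Phi conj F tends to 0, so |c| |G| / 2 <= |Phi| |pot(G)|, and the obstacle is to bound pot(G),
    which a priori grows linearly and is itself an integral of G.

    Eliminating G divides by G, which is possible only off Lambda; Lambda is null because its points
    are isolated. *)

Notation normc := Normc.normc.
Arguments Normc.normc : simpl never.

(** * The modulus of a complex number *)

Section normc_lemmas.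
Context {R : rcfType}.
Implicit Types z w : R[i].

Lemma normcE z : normc z = Num.sqrt (complex.Re z ^+ 2 + complex.Im z ^+ 2).
Proof. by case: z. Qed.

Lemma normc_ge0 z : 0 <= normc z.
Proof. by rewrite normcE sqrtr_ge0. Qed.

Lemma sqr_normc z : normc z ^+ 2 = complex.Re z ^+ 2 + complex.Im z ^+ 2.
Proof. by rewrite normcE sqr_sqrtr// addr_ge0// sqr_ge0. Qed.

Lemma normc_conj z : normc (conjc z) = normc z.
Proof. by case: z => a b; rewrite !normcE/= sqrrN. Qed.

Lemma normcN z : normc (- z) = normc z.
Proof. by case: z => a b; rewrite !normcE/= !sqrrN. Qed.

Lemma normc_eq0 z : (normc z == 0) = (z == 0).
Proof.
apply/eqP/eqP => [/Normc.eq0_normc//|->]; exact: Normc.normc0.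
Qed.

Lemma normc_gt0 z : (0 < normc z) = (z != 0).
Proof. by rewrite lt_neqAle normc_ge0 andbT eq_sym normc_eq0. Qed.

Lemma normcC (x : R) : normc x%:C = `|x|.
Proof. by rewrite normcE/= expr0n/= addr0 sqrtr_sqr. Qed.

Lemma normcX z n : normc (z ^+ n) = normc z ^+ n.
Proof.
elim: n => [|n ih]; first by rewrite !expr0 Normc.normc1.
by rewrite !exprS Normc.normcM ih.
Qed.

Lemma ler_normcD z w : normc (z + w) <= normc z + normc w.
Proof. exact: le_normcD. Qed.

Lemma ler_normcB z w : normc (z - w) <= normc z + normc w.
Proof. by rewrite (le_trans (ler_normcD _ _))// normcN. Qed.

Lemma normcBC z w : normc (z - w) = normc (w - z).
Proof. by rewrite -normcN opprB. Qed.

Lemma ler_sub_normc z w : normc z - normc w <= normc (z - w).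
Proof. by rewrite lerBlDr; apply: le_trans (ler_normcD _ _); rewrite subrK. Qed.

Lemma ler_Re_normc z : `|complex.Re z| <= normc z.
Proof.
by rewrite -sqrtr_sqr normcE ler_wsqrtr// lerDl sqr_ge0.
Qed.

Lemma ler_Im_normc z : `|complex.Im z| <= normc z.
Proof.
by rewrite -sqrtr_sqr normcE ler_wsqrtr// lerDr sqr_ge0.
Qed.

Lemma ler_normc_ReIm z : normc z <= `|complex.Re z| + `|complex.Im z|.
Proof.
rewrite normcE -[leRHS]ger0_norm ?addr_ge0//.
rewrite -[leRHS]sqrtr_sqr ler_wsqrtr//.
by rewrite sqrrD !real_normK ?num_real// lerD2r lerDl mulrn_wge0// mulr_ge0.
Qed.

Lemma mulc_conj z : z * conjc z = (normc z ^+ 2)%:C.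
Proof.
case: z => a b; rewrite sqr_normc/=; apply/eqP; rewrite eq_complex/=.
by apply/andP; split; apply/eqP; ring.
Qed.

Lemma ReD z w : complex.Re (z + w) = complex.Re z + complex.Re w.
Proof. by case: z; case: w. Qed.
Lemma ImD z w : complex.Im (z + w) = complex.Im z + complex.Im w.
Proof. by case: z; case: w. Qed.
Lemma ReN z : complex.Re (- z) = - complex.Re z. Proof. by case: z. Qed.
Lemma ImN z : complex.Im (- z) = - complex.Im z. Proof. by case: z. Qed.
Lemma ReM z w : complex.Re (z * w) =
  complex.Re z * complex.Re w - complex.Im z * complex.Im w.
Proof. by case: z; case: w. Qed.
Lemma ImM z w : complex.Im (z * w) =
  complex.Re z * complex.Im w + complex.Im z * complex.Re w.
Proof. by case: z; case: w. Qed.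

Lemma conjcM z w : conjc (z * w) = conjc z * conjc w.
Proof. exact: (rmorphM (@conjc R)). Qed.
Lemma conjcD z w : conjc (z + w) = conjc z + conjc w.
Proof. exact: (rmorphD (@conjc R)). Qed.
Lemma conjcB z w : conjc (z - w) = conjc z - conjc w.
Proof. exact: (rmorphB (@conjc R)). Qed.

Lemma complexP z w :
  complex.Re z = complex.Re w -> complex.Im z = complex.Im w -> z = w.
Proof. by case: z; case: w => a b c d /= -> ->. Qed.

(* division by zero is harmless: both sides vanish *)
Lemma normc_div z w : normc (z / w) = normc z / normc w.
Proof. by rewrite Normc.normcM Normc.normcV. Qed.

End normc_lemmas.

(** * The complex exponential and its Taylor remainder *)

Section cexp.
Context {R : realType}.
Implicit Types z w : R[i].

Definition cexp z : R[i] := (expR (complex.Re z))%:C * cis (complex.Im z).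

Lemma cisD (s t : R) : cis (s + t) = cis s * cis t.
Proof. by rewrite /cis cosD sinD; apply: complexP => /=; ring. Qed.

Lemma cis0 : cis 0 = 1 :> R[i].
Proof. by rewrite /cis cos0 sin0. Qed.

Lemma normc_cis (t : R) : normc (cis t) = 1.
Proof. by rewrite normcE/= cos2Dsin2 sqrtr1. Qed.

Lemma cexpD z w : cexp (z + w) = cexp z * cexp w.
Proof. by rewrite /cexp ReD ImD cisD expRD rmorphM/= mulrACA. Qed.

Lemma cexp0 : cexp 0 = 1.
Proof. by rewrite /cexp/= expR0 cis0 mulr1. Qed.

Lemma normc_cexp z : normc (cexp z) = expR (complex.Re z).
Proof. by rewrite Normc.normcM normc_cis mulr1 normcC ger0_norm// expR_ge0. Qed.

Lemma cexp_neq0 z : cexp z != 0.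
Proof. by rewrite -normc_gt0 normc_cexp expR_gt0. Qed.

Lemma cexpN z : cexp (- z) = (cexp z)^-1.
Proof.
apply: (mulfI (cexp_neq0 z)); rewrite -cexpD subrr cexp0 divff//.
exact: cexp_neq0.
Qed.

Lemma cexp_real (x : R) : cexp x%:C = (expR x)%:C.
Proof. by rewrite /cexp/= cis0 mulr1. Qed.

Lemma conj_cis (t : R) : conjc (cis t) = cis (- t).
Proof. by rewrite /cis cosN sinN. Qed.

Lemma conj_cexp z : conjc (cexp z) = cexp (conjc z).
Proof.
by rewrite /cexp /cis; case: z => a b; apply: complexP => /=; rewrite cosN sinN; ring.
Qed.

Lemma cis_cexp (t : R) : cis t = cexp (t *i).
Proof. by rewrite /cexp/= expR0 mul1r. Qed.

Lemma sin_le_norm (t : R) : `|sin t| <= `|t|.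
Proof.
wlog t0 : t / 0 <= t.
  move=> h; have [/h//|t0] := leP 0 t.
  by rewrite -normrN -sinN -(normrN t); apply: h; rewrite oppr_ge0 ltW.
move: t0; rewrite le_eqVlt => /predU1P[<-|t0]; first by rewrite sin0.
have [c _] := @MVT R sin cos 0 t t0 (fun x _ => is_derive_sin x)
  (continuous_subspaceT (@continuous_sin R)).
rewrite sin0 !subr0 => ->; rewrite normrM ler_piMl//.
by rewrite ler_norml cos_geN1 cos_le1.
Qed.

Lemma oneBcos_le (t : R) : `|cos t - 1| <= t ^+ 2.
Proof.
have -> : cos t - 1 = - (sin (t / 2) ^+ 2 *+ 2).
  rewrite {1}(_ : t = t / 2 + t / 2); last by field.
  by rewrite cosD -!expr2 cos2sin2; ring.
rewrite normrN normrMn normrX.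
have h := sin_le_norm (t / 2).
have : `|sin (t / 2)| ^+ 2 <= `|t / 2| ^+ 2 by rewrite lerXn2r// nnegrE.
rewrite [X in _ <= X -> _]real_normK ?num_real// => h2.
rewrite mulr2n; have := sqr_ge0 t; rewrite exprMn in h2; lra.
Qed.

Lemma oneBcos_le1 (t : R) : `|cos t - 1| <= `|t| *+ 2.
Proof.
have -> : cos t - 1 = - (sin (t / 2) ^+ 2 *+ 2).
  rewrite {1}(_ : t = t / 2 + t / 2); last by field.
  by rewrite cosD -!expr2 cos2sin2; ring.
rewrite normrN normrMn normrX.
have h := sin_le_norm (t / 2).
have h1 : `|sin (t / 2)| <= 1 by rewrite ler_norml sin_geN1 sin_le1.
rewrite lerMn2r/= expr2 (le_trans (ler_pM _ _ h h1))// mulr1 normrM.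
by rewrite ler_piMr// ger0_norm ?invr_ge0// invf_le1// ler1n.
Qed.

(** The mean value theorem for [sin x - x], whose derivative [oneBcos_le1] bounds linearly. A global
    quadratic bound, rather than a sharper local one, is what [cexpB1B_le] calls for. *)
Lemma sinB_le (t : R) : `|sin t - t| <= t ^+ 2 *+ 2.
Proof.
wlog t0 : t / 0 <= t.
  move=> h; have [/h//|t0] := leP 0 t.
  have := h (- t); rewrite oppr_ge0 => /(_ (ltW t0)).
  by rewrite sinN -opprD normrN sqrrN.
move: t0; rewrite le_eqVlt => /predU1P[<-|t0].
  by rewrite sin0 subr0 normr0 mulrn_wge0// sqr_ge0.
have d (x : R) : is_derive x 1 (fun x => sin x - x) (cos x - 1).
  by apply: is_deriveB.
have cont : {within `[0, t], continuous (fun x => sin x - x)}.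
  by apply: derivable_within_continuous => x _; exact: ex_derive.
have [c /itvP cI] := @MVT R (fun x => sin x - x) (fun x => cos x - 1) 0 t t0
  (fun x _ => d x) cont.
rewrite sin0 !subr0 => ->; rewrite normrM.
have c0 : 0 <= c by rewrite cI.
have ct : c <= t by rewrite cI.
rewrite (ger0_norm (ltW t0)) expr2 -mulrnAl ler_wpM2r// ?(ltW t0)//.
rewrite (le_trans (oneBcos_le1 _))// lerMn2r/= ger0_norm//.
Qed.

Lemma expRB1_le (a : R) : `|expR a - 1| <= `|a| * expR `|a|.
Proof.
have h1 := expR_ge1Dx a; have h2 := expR_ge1Dx (- a).
have h3 : expR a - 1 <= a * expR a.
  have := ler_wpM2r (expR_ge0 a) h2; rewrite -expRD addNr expR0; nra.
have [a0|a0] := leP 0 a.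
  by rewrite !ger0_norm//; lra.
rewrite (ltr0_norm a0) ler0_norm; last first.
  by have := expR_lt1 a; rewrite a0; lra.
have : 1 <= expR (- a) by rewrite -expR0 ler_expR; lra.
nra.
Qed.

Lemma expRB1B_le (a : R) : `|expR a - 1 - a| <= a ^+ 2 * expR `|a|.
Proof.
have h1 := expR_ge1Dx a; have h2 := expR_ge1Dx (- a).
have h3 : expR a - 1 <= a * expR a.
  have := ler_wpM2r (expR_ge0 a) h2; rewrite -expRD addNr expR0; nra.
rewrite ger0_norm; last by lra.
have [a0|a0] := leP 0 a.
  by rewrite !ger0_norm// expr2; nra.
rewrite (ltr0_norm a0).
have : 1 <= expR (- a) by rewrite -expR0 ler_expR; lra.
have := expR_gt0 a; rewrite expr2.
have : expR a < 1 by rewrite expR_lt1.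
nra.
Qed.

(** Only the second order in [z] and the validity for all [z] matter: the exponential factor is
    later absorbed by a Gaussian. The constant 4 is not sharp. *)
Lemma cexpB1B_le z :
  normc (cexp z - 1 - z) <= 4 * normc z ^+ 2 * expR (normc z).
Proof.
have ha := ler_Re_normc z; have hb := ler_Im_normc z.
have hab := sqr_normc z; have n0 := normc_ge0 z.
have e1 : expR `|complex.Re z| <= expR (normc z) by rewrite ler_expR.
have e2 : 1 <= expR (normc z) by rewrite -expR0 ler_expR.
rewrite (le_trans (ler_normc_ReIm _))//.
move: ha hb hab n0 e1 e2; move: (normc z) => n; case: z => a b /=.
set e := expR n; move=> ha hb hab n0 e1 e2.
(* Each summand of these two splittings is of second order in [(a, b)], so the four real bounds can
   be applied one by one. *)
have -> : expR a * cos b - 0 * sin b - 1 - a =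
  (expR a - 1 - a) + expR a * (cos b - 1) by ring.
have -> : expR a * sin b + 0 * cos b - 0 - b =
  (expR a - 1) * sin b + (sin b - b) by ring.
have k1 := expRB1B_le a; have k2 := expRB1_le a.
have k3 := oneBcos_le b; have k4 := sin_le_norm b; have k5 := sinB_le b.
have ea : expR a <= e by rewrite (le_trans _ e1)// ler_expR ler_norm.
apply: (le_trans (lerD (ler_normD _ _) (ler_normD _ _))).
rewrite !normrM (ger0_norm (expR_ge0 a)).
have m1 : `|expR a - 1 - a| <= a ^+ 2 * e.
  by rewrite (le_trans k1)// ler_wpM2l// sqr_ge0.
have m2 : expR a * `|cos b - 1| <= e * b ^+ 2 by rewrite ler_pM// expR_ge0.
have m3 : `|expR a - 1| * `|sin b| <= (`|a| * e) * `|b|.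
  by rewrite ler_pM// (le_trans k2)// ler_wpM2l.
have m4 : `|sin b - b| <= e * (b ^+ 2 *+ 2).
  by rewrite (le_trans k5)// ler_peMl// mulrn_wge0// sqr_ge0.
have m5 : `|a| * `|b| *+ 2 <= n ^+ 2.
  rewrite hab -(real_normK (num_real a)) -(real_normK (num_real b)).
  have := sqr_ge0 (`|a| - `|b|); rewrite sqrrB; lra.
have ha2 : a ^+ 2 <= n ^+ 2 by rewrite hab; have := sqr_ge0 b; lra.
have hb2 : b ^+ 2 <= n ^+ 2 by rewrite hab; have := sqr_ge0 a; lra.
have e0 : 0 <= e by lra.
have q1 := ler_wpM2l e0 m5; have q2 := ler_wpM2l e0 hb2.
have q3 : e * n ^+ 2 = e * a ^+ 2 + e * b ^+ 2 by rewrite hab; ring.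
rewrite (_ : `|a| * e * `|b| = e * (`|a| * `|b|)) in m3; last by ring.
rewrite !mulrnAr in q1 m4.
rewrite (_ : 4 * n ^+ 2 * e = 4 * (e * n ^+ 2)); last by ring.
have : a ^+ 2 * e = e * a ^+ 2 by ring.
have := mulr_ge0 e0 (sqr_ge0 n).
lra.
Qed.

End cexp.
Arguments cexp : simpl never.

(** * Complex-valued integrals *)

Section cmeas.
Context {R : realType}.

Definition cmeas d (T : measurableType d) (f : T -> R[i]) :=
  measurable_fun [set: T] (fun x => complex.Re (f x)) /\
  measurable_fun [set: T] (fun x => complex.Im (f x)).

Context d (T : measurableType d).
Implicit Types f g : T -> R[i].

Lemma cmeas_cst (c : R[i]) : cmeas (fun _ : T => c).
Proof. by split; exact: measurable_cst. Qed.

Lemma cmeasD f g : cmeas f -> cmeas g -> cmeas (fun x => f x + g x).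
Proof.
move=> [f1 f2] [g1 g2]; split.
- by under eq_fun do rewrite ReD; exact: measurable_funD.
- by under eq_fun do rewrite ImD; exact: measurable_funD.
Qed.

Lemma cmeasN f : cmeas f -> cmeas (fun x => - f x).
Proof.
move=> [f1 f2]; split.
- by under eq_fun do rewrite ReN; exact: measurable_funN.
- by under eq_fun do rewrite ImN; exact: measurable_funN.
Qed.

Lemma cmeasB f g : cmeas f -> cmeas g -> cmeas (fun x => f x - g x).
Proof. by move=> mf mg; apply: cmeasD => //; exact: cmeasN. Qed.

Lemma cmeasM f g : cmeas f -> cmeas g -> cmeas (fun x => f x * g x).
Proof.
move=> [f1 f2] [g1 g2]; split.
- by under eq_fun do rewrite ReM; apply: measurable_funB; exact: measurable_funM.
- by under eq_fun do rewrite ImM; apply: measurable_funD; exact: measurable_funM.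
Qed.

Lemma cmeas_conj f : cmeas f -> cmeas (fun x => conjc (f x)).
Proof.
move=> [f1 f2]; split.
- by rewrite (_ : (fun x => _) = (fun x => complex.Re (f x)))//; apply/funext => x; case: (f x).
- rewrite (_ : (fun x => _) = (fun x => - complex.Im (f x))); first exact: measurable_funN.
  by apply/funext => x; case: (f x).
Qed.

Lemma cmeas_real (h : T -> R) : measurable_fun setT h -> cmeas (fun x => (h x)%:C).
Proof. by move=> mh; split => //=; exact: measurable_cst. Qed.

Lemma cmeas_ReIm (h k : T -> R) : measurable_fun setT h -> measurable_fun setT k ->
  cmeas (fun x => h x +i* k x).
Proof. by []. Qed.

Lemma measurable_sqr_normc f : cmeas f -> measurable_fun setT (fun x => normc (f x) ^+ 2).
Proof.
move=> [f1 f2]; under eq_fun do rewrite sqr_normc.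
by apply: measurable_funD; exact: measurable_funX.
Qed.

Lemma measurable_normc f : cmeas f -> measurable_fun setT (fun x => normc (f x)).
Proof.
move=> mf; rewrite (_ : (fun x => _) = (fun x => (normc (f x) ^+ 2) `^ (2^-1))).
  apply: (@measurableT_comp _ _ _ _ _ _ (fun y => y `^ (2^-1))) => //.
  exact: measurable_sqr_normc.
by apply/funext => x; rewrite powR12_sqrt ?sqr_ge0// sqrtr_sqr ger0_norm// normc_ge0.
Qed.

Lemma measurable_funV (h : T -> R) : measurable_fun setT h ->
  (forall x, 0 <= h x) -> measurable_fun setT (fun x => (h x)^-1).
Proof.
move=> mh h0; rewrite (_ : (fun x => _) = (fun x => h x `^ (-1))).
  exact: (@measurableT_comp _ _ _ _ _ _ (fun y => y `^ (-1))).
apply/funext => x; rewrite powR_inv1//.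
Qed.

Lemma cmeasV f : cmeas f -> cmeas (fun x => (f x)^-1).
Proof.
move=> mf.
(* The identity holds at the zeros of [f] as well, both sides being 0 there. *)
have -> : (fun x => (f x)^-1) =
    (fun x => conjc (f x) * ((normc (f x) ^+ 2)^-1)%:C).
  apply/funext => x; have [->|fx0] := eqVneq (f x) 0.
    have -> : conjc (0 : R[i]) = 0 by apply: complexP => //=; rewrite oppr0.
    by rewrite invr0 mul0r.
  apply: (mulfI fx0); rewrite divff// mulrA mulc_conj -rmorphM/= divff//.
  by rewrite sqrf_eq0 normc_eq0.
apply: cmeasM; first exact: cmeas_conj.
apply: cmeas_real; apply: measurable_funV; first exact: measurable_sqr_normc.
by move=> x; exact: sqr_ge0.
Qed.

Lemma cmeas_div f g : cmeas f -> cmeas g -> cmeas (fun x => f x / g x).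
Proof. by move=> mf mg; apply: cmeasM => //; exact: cmeasV. Qed.

Lemma cmeas_cexp f : cmeas f -> cmeas (fun x => cexp (f x)).
Proof.
move=> [f1 f2]; apply: cmeasM.
  apply: cmeas_real; exact: measurableT_comp.
apply: cmeas_ReIm.
  apply: measurableT_comp => //; apply: continuous_measurable_fun; exact: continuous_cos.
apply: measurableT_comp => //; apply: continuous_measurable_fun; exact: continuous_sin.
Qed.

Lemma cmeas_comp d' (T' : measurableType d') (h : T' -> T) f :
  cmeas f -> measurable_fun setT h -> cmeas (fun x => f (h x)).
Proof.
move=> [f1 f2] mh; split.
- exact: (measurableT_comp f1 mh).
- exact: (measurableT_comp f2 mh).
Qed.

End cmeas.

Section cint.
Context {R : realType} d (T : measurableType d).
Variable mu : {measure set T -> \bar R}.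
Implicit Types (f g : T -> R[i]) (h k : T -> R).

(** The formula of [Cintegral] for an arbitrary measure. On the line it is convertible to it, so
    that [inner] can be replaced by [ip] without a lemma. *)
Definition cint f : R[i] :=
  Rintegral mu setT (fun s => complex.Re (f s))
  +i* Rintegral mu setT (fun s => complex.Im (f s)).

Definition cintegrable f := cmeas f /\ (\int[mu]_x (normc (f x))%:E < +oo)%E.

Lemma le_nint h k : measurable_fun setT h -> measurable_fun setT k ->
  (forall x, 0 <= h x) -> (forall x, h x <= k x) ->
  (\int[mu]_x (h x)%:E <= \int[mu]_x (k x)%:E)%E.
Proof.
move=> mh mk h0 hk; apply: ge0_le_integral => //=.
- by move=> x _; rewrite lee_fin.
- exact/measurable_EFinP.
- exact/measurable_EFinP.
- by move=> x _; rewrite lee_fin.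
Qed.

Lemma nint_ge0 h : (forall x, 0 <= h x) -> (0 <= \int[mu]_x (h x)%:E)%E.
Proof. by move=> h0; apply: integral_ge0 => x _; rewrite lee_fin. Qed.

Lemma nintD h k : measurable_fun setT h -> measurable_fun setT k ->
  (forall x, 0 <= h x) -> (forall x, 0 <= k x) ->
  (\int[mu]_x (h x + k x)%:E = \int[mu]_x (h x)%:E + \int[mu]_x (k x)%:E)%E.
Proof.
move=> mh mk h0 k0; under eq_integral do rewrite EFinD.
rewrite ge0_integralD//=.
- by move=> x _; rewrite lee_fin.
- exact/measurable_EFinP.
- by move=> x _; rewrite lee_fin.
- exact/measurable_EFinP.
Qed.

Lemma nintZ (c : R) h : measurable_fun setT h -> (forall x, 0 <= h x) -> 0 <= c ->
  (\int[mu]_x (c * h x)%:E = c%:E * \int[mu]_x (h x)%:E)%E.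
Proof.
move=> mh h0 c0; under eq_integral do rewrite EFinM.
rewrite ge0_integralZl//=.
- exact/measurable_EFinP.
- by move=> x _; rewrite lee_fin.
Qed.

Lemma nintZ_fin (c : R) h : measurable_fun setT h -> (forall x, 0 <= h x) -> 0 <= c ->
  (\int[mu]_x (h x)%:E < +oo -> \int[mu]_x (c * h x)%:E < +oo)%E.
Proof. by move=> mh h0 c0 hoo; rewrite nintZ//; exact: lte_mul_pinfty. Qed.

(** The common shape of the estimates below: a pointwise bound by two terms, coming from a weighted
    mean inequality or from a splitting into a near and a far region. *)
Lemma le_nint_lin (a b : R) (f : T -> R) h k :
  measurable_fun setT f -> measurable_fun setT h -> measurable_fun setT k ->
  (forall x, 0 <= f x) -> (forall x, 0 <= h x) -> (forall x, 0 <= k x) ->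
  0 <= a -> 0 <= b -> (forall x, f x <= a * h x + b * k x) ->
  (\int[mu]_x (f x)%:E <= a%:E * \int[mu]_x (h x)%:E + b%:E * \int[mu]_x (k x)%:E)%E.
Proof.
move=> mf mh mk f0 h0 k0 a0 b0 fhk.
have mah : measurable_fun setT (fun x => a * h x) by exact: measurable_funM.
have mbk : measurable_fun setT (fun x => b * k x) by exact: measurable_funM.
apply: (@le_trans _ _ (\int[mu]_x (a * h x + b * k x)%:E)%E).
  by apply: le_nint => //; exact: measurable_funD.
by rewrite nintD ?nintZ// => x; exact: mulr_ge0.
Qed.

Lemma le_nint_lin_fin (a b : R) (f : T -> R) h k :
  measurable_fun setT f -> measurable_fun setT h -> measurable_fun setT k ->
  (forall x, 0 <= f x) -> (forall x, 0 <= h x) -> (forall x, 0 <= k x) ->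
  0 <= a -> 0 <= b -> (forall x, f x <= a * h x + b * k x) ->
  (\int[mu]_x (h x)%:E < +oo -> \int[mu]_x (k x)%:E < +oo -> \int[mu]_x (f x)%:E < +oo)%E.
Proof.
move=> mf mh mk f0 h0 k0 a0 b0 fhk hoo koo.
apply: le_lt_trans (le_nint_lin mf mh mk f0 h0 k0 a0 b0 fhk) _.
by apply: lte_add_pinfty; exact: lte_mul_pinfty.
Qed.

Lemma integrableZl_EFin (c : R) h : mu.-integrable setT (EFin \o h) ->
  mu.-integrable setT (fun x => (c * h x)%:E).
Proof. by move=> hi; have := integrableZl measurableT c hi. Qed.

Lemma nint_fin h : (forall x, 0 <= h x) -> (\int[mu]_x (h x)%:E < +oo)%E ->
  exists2 I : R, 0 <= I & (\int[mu]_x (h x)%:E = I%:E)%E.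
Proof.
move=> h0 hoo; exists (fine (\int[mu]_x (h x)%:E)%E).
  by rewrite fine_ge0// nint_ge0.
by rewrite fineK// ge0_fin_numE// nint_ge0.
Qed.

Lemma integrable_Re f : cintegrable f ->
  mu.-integrable setT (fun x => (complex.Re (f x))%:E).
Proof.
move=> [[mf1 mf2] foo]; apply/integrableP; split; first exact/measurable_EFinP.
apply: le_lt_trans foo; under eq_integral do rewrite abse_EFin.
apply: le_nint => //.
- exact: measurableT_comp.
- exact: measurable_normc.
- by move=> x; exact: ler_Re_normc.
Qed.

Lemma integrable_Im f : cintegrable f ->
  mu.-integrable setT (fun x => (complex.Im (f x))%:E).
Proof.
move=> [[mf1 mf2] foo]; apply/integrableP; split; first exact/measurable_EFinP.
apply: le_lt_trans foo; under eq_integral do rewrite abse_EFin.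
apply: le_nint => //.
- exact: measurableT_comp.
- exact: measurable_normc.
- by move=> x; exact: ler_Im_normc.
Qed.

Lemma cintegrable_le f h : cmeas f -> measurable_fun setT h ->
  (forall x, normc (f x) <= h x) -> (\int[mu]_x (h x)%:E < +oo)%E -> cintegrable f.
Proof.
move=> mf mh fh hoo; split=> //; apply: le_lt_trans hoo; apply: le_nint => //.
- exact: measurable_normc.
- by move=> x; exact: normc_ge0.
Qed.

Lemma eq_cint f g : f =1 g -> cint f = cint g.
Proof. by move=> /funext ->. Qed.

Lemma cintD f g : cintegrable f -> cintegrable g ->
  cint (fun x => f x + g x) = cint f + cint g.
Proof.
move=> fi gi; rewrite /cint; apply: complexP => /=.
- under eq_Rintegral do rewrite ReD.
  by rewrite RintegralD//=; exact: integrable_Re.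
- under eq_Rintegral do rewrite ImD.
  by rewrite RintegralD//=; exact: integrable_Im.
Qed.

Lemma cintegrableD f g : cintegrable f -> cintegrable g ->
  cintegrable (fun x => f x + g x).
Proof.
move=> [mf fi] [mg gi]; apply: (@cintegrable_le _ (fun x => normc (f x) + normc (g x))).
- exact: cmeasD.
- by apply: measurable_funD; exact: measurable_normc.
- by move=> x; exact: ler_normcD.
- rewrite nintD; [exact: lte_add_pinfty|exact: measurable_normc|exact: measurable_normc| |];
    by move=> x; exact: normc_ge0.
Qed.

Lemma cintegrableZ (c : R[i]) f : cintegrable f -> cintegrable (fun x => c * f x).
Proof.
move=> [mf fi]; apply: (@cintegrable_le _ (fun x => normc c * normc (f x))).
- apply: cmeasM => //; exact: cmeas_cst.
- by apply: measurable_funM => //; exact: measurable_normc.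
- by move=> x; rewrite Normc.normcM.
- by apply: nintZ_fin => //; [exact: measurable_normc|
    move=> x; exact: normc_ge0|exact: normc_ge0].
Qed.

Lemma cintegrableN f : cintegrable f -> cintegrable (fun x => - f x).
Proof.
move=> fi; under eq_fun do rewrite -mulN1r; exact: cintegrableZ.
Qed.

Lemma cintegrableB f g : cintegrable f -> cintegrable g ->
  cintegrable (fun x => f x - g x).
Proof. by move=> fi gi; apply: cintegrableD => //; exact: cintegrableN. Qed.

Lemma cintZ (c : R[i]) f : cintegrable f -> cint (fun x => c * f x) = c * cint f.
Proof.
move=> fi; case: c => a b; rewrite /cint; apply: complexP => /=.
- under eq_Rintegral do rewrite ReM/=.
  rewrite RintegralB//= ?RintegralZl//=.
  + exact: integrable_Im.
  + exact: integrable_Re.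
  + apply: (integrableZl_EFin a); exact: integrable_Re.
  + apply: (integrableZl_EFin b); exact: integrable_Im.
- under eq_Rintegral do rewrite ImM/=.
  rewrite RintegralD//= ?RintegralZl//=.
  + exact: integrable_Re.
  + exact: integrable_Im.
  + apply: (integrableZl_EFin a); exact: integrable_Im.
  + apply: (integrableZl_EFin b); exact: integrable_Re.
Qed.

Lemma cintZr (c : R[i]) f : cintegrable f -> cint (fun x => f x * c) = cint f * c.
Proof. by move=> fi; under eq_fun do rewrite mulrC; rewrite cintZ// mulrC. Qed.

Lemma cintN f : cintegrable f -> cint (fun x => - f x) = - cint f.
Proof. by move=> fi; under eq_fun do rewrite -mulN1r; rewrite cintZ// mulN1r. Qed.

Lemma cintB f g : cintegrable f -> cintegrable g ->
  cint (fun x => f x - g x) = cint f - cint g.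
Proof.
by move=> fi gi; rewrite cintD ?cintN//; exact: cintegrableN.
Qed.

Lemma cint0 : cint (fun=> 0) = 0.
Proof. by rewrite /cint; apply: complexP => /=; rewrite Rintegral_cst// mul0r. Qed.

Lemma cint_conj f : cintegrable f -> cint (fun x => conjc (f x)) = conjc (cint f).
Proof.
move=> fi; rewrite /cint; apply: complexP => /=.
  by apply: eq_Rintegral => x _; case: (f x).
rewrite -mulN1r -RintegralZl//; last exact: integrable_Im.
by apply: eq_Rintegral => x _; rewrite mulN1r; case: (f x).
Qed.

(* Rotating [f] makes its integral nonnegative, so that the real part suffices. *)
Lemma normc_cint_le f : cintegrable f ->
  ((normc (cint f))%:E <= \int[mu]_x (normc (f x))%:E)%E.
Proof.
move=> fi; have [->|I0] := eqVneq (cint f) 0.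
  by rewrite Normc.normc0 nint_ge0// => x; exact: normc_ge0.
pose u := conjc (cint f) / (normc (cint f))%:C.
have nu : normc u = 1.
  by rewrite /u normc_div normc_conj normcC ger0_norm ?normc_ge0// divff// normc_eq0.
have uI : cint (fun x => u * f x) = (normc (cint f))%:C.
  rewrite cintZ// /u mulrAC [X in X / _]mulrC mulc_conj expr2 rmorphM mulfK//.
  by rewrite -normc_gt0 normcC normr_gt0 normc_eq0.
have ui := cintegrableZ u fi.
have -> : normc (cint f) = Rintegral mu setT (fun x => complex.Re (u * f x)).
  by move/(congr1 (@complex.Re R)) : uI.
rewrite /Rintegral fineK; last exact/integrable_fin_num/integrable_Re.
apply: le_trans (lee_abs _) _; apply: le_trans (le_abse_integral _ _ _) _ => //.
  exact: measurable_int (integrable_Re ui).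
apply: (@le_nint (fun x => `|complex.Re (u * f x)|)).
- apply: measurableT_comp => //; exact: (ui.1).1.
- exact: measurable_normc fi.1.
- by [].
- by move=> x; rewrite (le_trans (ler_Re_normc _))// Normc.normcM nu mul1r.
Qed.

End cint.
Arguments cint : simpl never.

Section cint_ae.
Context {R : realType} d (T : measurableType d).
Variable mu : {measure set T -> \bar R}.
Implicit Types f g : T -> R[i].

Lemma ae_eq_cint f g : cmeas f -> cmeas g -> {ae mu, forall x, f x = g x} ->
  cint mu f = cint mu g.
Proof.
move=> [f1 f2] [g1 g2] fg; apply: complexP => /=; congr fine.
- apply: ae_eq_integral => //; try exact/measurable_EFinP.
  by apply: filterS fg => x + _ => ->.
- apply: ae_eq_integral => //; try exact/measurable_EFinP.
  by apply: filterS fg => x + _ => ->.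
Qed.

Lemma nint_eq0 (h : T -> R) : measurable_fun setT h -> (forall x, 0 <= h x) ->
  (\int[mu]_x (h x)%:E = 0)%E -> {ae mu, forall x, h x = 0}.
Proof.
move=> mh h0 I0.
have : (\int[mu]_x `|(h x)%:E| = 0)%E.
  by rewrite -[RHS]I0; apply: eq_integral => x _; rewrite gee0_abs// lee_fin.
have me : measurable_fun setT (EFin \o h) by exact/measurable_EFinP.
move=> /(ae_eq_integral_abs mu measurableT me).1.
by apply: filterS => x /(_ I)[].
Qed.

End cint_ae.

(** * Fubini for complex-valued functions *)

Section fubini.
Context {R : realType} d1 d2 (T1 : measurableType d1) (T2 : measurableType d2).
Variable m1 : {sigma_finite_measure set T1 -> \bar R}.
Variable m2 : {sigma_finite_measure set T2 -> \bar R}.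

Lemma measurable_nint (h : T1 * T2 -> R) : measurable_fun setT h -> (forall x, 0 <= h x) ->
  measurable_fun setT (fun x => \int[m2]_y (h (x, y))%:E)%E.
Proof.
move=> mh h0; apply: (@measurable_fun_fubini_tonelli_F _ _ _ _ _ m2 (EFin \o h)).
- exact/measurable_EFinP.
- by move=> x /=; rewrite lee_fin.
Qed.

(** Sections of [h] may fail to be integrable: the extended integral is measurable in any case, and
    [fine] preserves this while sending infinite values to 0. *)
Lemma measurable_Rint (h : T1 * T2 -> R) : measurable_fun setT h ->
  measurable_fun setT (fun x => Rintegral m2 setT (fun y => h (x, y))).
Proof.
move=> mh; apply: (measurableT_comp (fine_measurable measurableT)).
rewrite (_ : (fun x => _) = (fun x => \int[m2]_y ((EFin \o h)^\+ (x, y)) -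
   \int[m2]_y ((EFin \o h)^\- (x, y)))%E); last first.
  apply/funext => x; rewrite integralE; congr (_ - _)%E;
  by apply: eq_integral => y _; rewrite ?funeposE ?funenegE.
have me : measurable_fun setT (EFin \o h) by exact/measurable_EFinP.
apply: emeasurable_funB; apply: measurable_fun_fubini_tonelli_F => //.
- exact: measurable_funepos.
- exact: measurable_funeneg.
Qed.

Lemma cmeas_cint (F : T1 * T2 -> R[i]) : cmeas F ->
  cmeas (fun x => cint m2 (fun y => F (x, y))).
Proof.
move=> [F1 F2]; split.
- exact: (measurable_Rint F1).
- exact: (measurable_Rint F2).
Qed.

Lemma integrable_prod (h : T1 * T2 -> R) (k : T1 * T2 -> R) :
  measurable_fun setT h -> measurable_fun setT k -> (forall z, `|h z| <= k z) ->
  (\int[m1]_x \int[m2]_y (k (x, y))%:E < +oo)%E ->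
  (m1 \x m2)%E.-integrable setT (EFin \o h).
Proof.
move=> mh mk hk koo; apply/integrable12ltyP; first exact/measurable_EFinP.
apply: le_lt_trans koo; apply: ge0_le_integral => //=.
- by move=> x _; exact: integral_ge0.
- by apply: (@measurable_nint (fun z => `|h z|)) => //; exact: measurableT_comp.
- by apply: (@measurable_nint k) => // x; exact: le_trans (hk x).
- move=> x _; apply: (@le_nint _ _ _ m2 (fun y => `|h (x, y)|) (fun y => k (x, y))) => //.
  + apply: measurableT_comp => //; exact: (measurableT_comp mh (pair1_measurable x)).
  + exact: (measurableT_comp mk (pair1_measurable x)).
Qed.

End fubini.

Section fubini_swap.
Context {R : realType} d1 d2 (T1 : measurableType d1) (T2 : measurableType d2).
Variable m1 : {sigma_finite_measure set T1 -> \bar R}.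
Variable m2 : {sigma_finite_measure set T2 -> \bar R}.

(** An inner [Rintegral] agrees with the extended integral where the section is integrable, which is
    almost everywhere. Both sides are therefore compared almost everywhere with the extended
    iterated integrals, to which Fubini applies. *)
Lemma Rintegral_swap (h : T1 * T2 -> R) : (m1 \x m2)%E.-integrable setT (EFin \o h) ->
  Rintegral m1 setT (fun x => Rintegral m2 setT (fun y => h (x, y))) =
  Rintegral m2 setT (fun y => Rintegral m1 setT (fun x => h (x, y))).
Proof.
move=> hi; congr fine.
have mh := measurable_int _ hi.
transitivity (\int[m1]_x \int[m2]_y (EFin \o h) (x, y))%E.
  apply: ae_eq_integral => //.
  - apply/measurable_EFinP; apply: measurable_Rint; exact/measurable_EFinP.
  - exact: (measurable_fubini_F hi).
  - apply: filterS (ae_integrable1 hi) => x ix _ /=.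
    by rewrite /Rintegral fineK//; exact: integrable_fin_num.
rewrite Fubini//; apply: ae_eq_integral => //.
  - exact: (measurable_fubini_G hi).
  - apply/measurable_EFinP.
    apply: (@measurable_Rint _ _ _ T2 T1 m1 (fun z => h (z.2, z.1))).
    have {}mh : measurable_fun setT h by exact/measurable_EFinP.
    by apply: (measurableT_comp mh); exact: measurable_fun_pair.
  - apply: filterS (ae_integrable2 hi) => x ix _ /=.
    by rewrite /Rintegral fineK//; exact: integrable_fin_num.
Qed.

Lemma cint_swap (F : T1 * T2 -> R[i]) : cmeas F ->
  (\int[m1]_x \int[m2]_y (normc (F (x, y)))%:E < +oo)%E ->
  cint m1 (fun x => cint m2 (fun y => F (x, y))) =
  cint m2 (fun y => cint m1 (fun x => F (x, y))).
Proof.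
move=> mF Foo; have mn := measurable_normc mF; case: (mF) => F1 F2.
rewrite /cint; apply: complexP => /=.
- apply: (@Rintegral_swap (fun z => complex.Re (F z))).
  by apply: (integrable_prod F1 mn) => // z; exact: ler_Re_normc.
- apply: (@Rintegral_swap (fun z => complex.Im (F z))).
  by apply: (integrable_prod F2 mn) => // z; exact: ler_Im_normc.
Qed.

Lemma cint_prod (F : T1 * T2 -> R[i]) : cintegrable (m1 \x m2)%E F ->
  cint (m1 \x m2)%E F = cint m1 (fun x => cint m2 (fun y => F (x, y))).
Proof.
have H (h : T1 * T2 -> R) : (m1 \x m2)%E.-integrable setT (EFin \o h) ->
    Rintegral (m1 \x m2)%E setT h =
    Rintegral m1 setT (fun x => Rintegral m2 setT (fun y => h (x, y))).
  move=> hi; congr fine; have mh := measurable_int _ hi.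
  rewrite -(integral12_prod_meas1 hi); apply: ae_eq_integral => //.
  - exact: (measurable_fubini_F hi).
  - apply/measurable_EFinP; apply: measurable_Rint; exact/measurable_EFinP.
  - apply: filterS (ae_integrable1 hi) => x ix _ /=.
    by rewrite /Rintegral fineK//; exact: integrable_fin_num.
move=> Fi; rewrite /cint; apply: complexP => /=.
- exact: H (integrable_Re Fi).
- exact: H (integrable_Im Fi).
Qed.

Lemma nint_prod (h : T1 * T2 -> R) : measurable_fun setT h -> (forall x, 0 <= h x) ->
  (\int[(m1 \x m2)]_z (h z)%:E = \int[m1]_x \int[m2]_y (h (x, y))%:E)%E.
Proof.
move=> mh h0; rewrite (fubini_tonelli1 (EFin \o h))//.
exact/measurable_EFinP.
Qed.

Lemma nint_tensor (h : T1 -> R) (k : T2 -> R) :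
  measurable_fun setT h -> measurable_fun setT k ->
  (forall x, 0 <= h x) -> (forall y, 0 <= k y) ->
  (\int[(m1 \x m2)]_z (h z.1 * k z.2)%:E =
   \int[m1]_x (h x)%:E * \int[m2]_y (k y)%:E)%E.
Proof.
move=> mh mk h0 k0; rewrite nint_prod; last 2 first.
- by apply: measurable_funM; [exact: (measurableT_comp mh)|exact: (measurableT_comp mk)].
- by move=> z; rewrite mulr_ge0.
under eq_integral do rewrite /= nintZ//.
rewrite ge0_integralZr//.
- exact/measurable_EFinP.
- by move=> x _; rewrite lee_fin.
- exact: nint_ge0.
Qed.

Lemma cintegrable_tensor (f : T1 -> R[i]) (g : T2 -> R[i]) :
  cintegrable m1 f -> cintegrable m2 g ->
  cintegrable (m1 \x m2)%E (fun z => f z.1 * g z.2).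
Proof.
move=> [mf fi] [mg gi].
have mf' : cmeas (fun z : T1 * T2 => f z.1) by exact: (cmeas_comp mf).
have mg' : cmeas (fun z : T1 * T2 => g z.2) by exact: (cmeas_comp mg).
split; first exact: cmeasM.
under eq_integral do rewrite Normc.normcM.
rewrite (nint_tensor (measurable_normc mf) (measurable_normc mg)
  (fun x => normc_ge0 _) (fun x => normc_ge0 _)).
have [a _ ->] := nint_fin (fun x => normc_ge0 (f x)) fi.
have [b _ ->] := nint_fin (fun x => normc_ge0 (g x)) gi.
by rewrite -EFinM ltry.
Qed.

Lemma cint_tensor (f : T1 -> R[i]) (g : T2 -> R[i]) :
  cintegrable m1 f -> cintegrable m2 g ->
  cint (m1 \x m2)%E (fun z => f z.1 * g z.2) = cint m1 f * cint m2 g.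
Proof.
move=> fi gi; rewrite cint_prod; last exact: cintegrable_tensor.
by under eq_fun do rewrite /= cintZ//; rewrite cintZr.
Qed.

End fubini_swap.

(** * Square-integrable functions and the Cauchy-Schwarz inequality *)

Section square_integrable.
Context {R : realType} d (T : measurableType d).
Variable mu : {measure set T -> \bar R}.
Implicit Types f g h : T -> R[i].

Definition sqnE f : \bar R := (\int[mu]_x (normc (f x) ^+ 2)%:E)%E.
Definition sqn f : R := fine (sqnE f).
Definition csq f := cmeas f /\ (sqnE f < +oo)%E.
Definition ip f g : R[i] := cint mu (fun x => f x * conjc (g x)).

Lemma sqnE_fin f : csq f -> sqnE f = (sqn f)%:E.
Proof.
move=> [mf foo]; rewrite /sqn fineK// fin_numElt foo andbT.
by rewrite (lt_le_trans ltNy0)//; apply: nint_ge0 => x; exact: sqr_ge0.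
Qed.

Lemma sqn_ge0 f : 0 <= sqn f.
Proof. by apply: fine_ge0; apply: nint_ge0 => x; exact: sqr_ge0. Qed.

Lemma sqnE_le2 f g : cmeas f -> cmeas g ->
  (sqnE (fun x => f x + g x)%R <= 2%:E * sqnE f + 2%:E * sqnE g)%E.
Proof.
move=> mf mg; have mf2 := measurable_sqr_normc mf; have mg2 := measurable_sqr_normc mg.
apply: le_nint_lin => //.
- by apply: measurable_sqr_normc; exact: cmeasD.
- by move=> x; exact: sqr_ge0.
- by move=> x; exact: sqr_ge0.
- by move=> x; exact: sqr_ge0.
- move=> x; have h := ler_normcD (f x) (g x).
  have := sqr_ge0 (normc (f x) - normc (g x)).
  have : normc (f x + g x) ^+ 2 <= (normc (f x) + normc (g x)) ^+ 2.
    by rewrite lerXn2r ?nnegrE ?addr_ge0 ?normc_ge0.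
  rewrite sqrrB sqrrD; lra.
Qed.

Lemma csqD f g : csq f -> csq g -> csq (fun x => f x + g x).
Proof.
move=> cf cg; split; first by apply: cmeasD; [case: cf|case: cg].
apply: (le_lt_trans (sqnE_le2 cf.1 cg.1)).
by rewrite !sqnE_fin// -!EFinM -EFinD ltry.
Qed.

Lemma sqn_le2 f g : csq f -> csq g ->
  sqn (fun x => f x + g x) <= 2 * sqn f + 2 * sqn g.
Proof.
move=> cf cg; rewrite -lee_fin -sqnE_fin; last exact: csqD.
by apply: (le_trans (sqnE_le2 cf.1 cg.1)); rewrite !sqnE_fin// -!EFinM -EFinD.
Qed.

Lemma sqnE_Z (c : R[i]) f : cmeas f ->
  sqnE (fun x => c * f x) = ((normc c ^+ 2)%:E * sqnE f)%E.
Proof.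
move=> mf; rewrite /sqnE; under eq_integral do rewrite Normc.normcM exprMn.
rewrite nintZ ?sqr_ge0//; first exact: measurable_sqr_normc.
by move=> x; exact: sqr_ge0.
Qed.

Lemma csqZ (c : R[i]) f : csq f -> csq (fun x => c * f x).
Proof.
move=> cf; split; first by apply: cmeasM; [exact: cmeas_cst|case: cf].
by rewrite sqnE_Z ?sqnE_fin//; [rewrite -EFinM ltry|case: cf].
Qed.

Lemma sqnZ (c : R[i]) f : csq f -> sqn (fun x => c * f x) = normc c ^+ 2 * sqn f.
Proof. by move=> cf; rewrite {1}/sqn sqnE_Z ?sqnE_fin//; case: cf. Qed.

Lemma csqB f g : csq f -> csq g -> csq (fun x => f x - g x).
Proof.
move=> cf cg; have := csqD cf (csqZ (-1) cg).
by under eq_fun do rewrite mulN1r.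
Qed.

(** The difference of the two sides is a square. The free parameter [t] is optimised after
    integration, in [ler_sqr_of_weighted]. *)
Lemma normc_mul_conj_le (t : R) (z w : R[i]) : 0 < t ->
  normc (z * conjc w) <= t / 2 * normc z ^+ 2 + (2 * t)^-1 * normc w ^+ 2.
Proof.
move=> t0; rewrite Normc.normcM normc_conj -subr_ge0.
rewrite (_ : _ - _ = (2 * t)^-1 * (t * normc z - normc w) ^+ 2).
  by rewrite mulr_ge0 ?sqr_ge0// invr_ge0 mulr_ge0// ltW.
by field; rewrite gt_eqF.
Qed.

Lemma nint_mul_le (t : R) f g : 0 < t -> csq f -> csq g ->
  (\int[mu]_x (normc (f x * conjc (g x)))%:E <= (t / 2 * sqn f + (2 * t)^-1 * sqn g)%:E)%E.
Proof.
move=> t0 cf cg; have mf2 := measurable_sqr_normc cf.1; have mg2 := measurable_sqr_normc cg.1.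
rewrite EFinD !EFinM -!sqnE_fin//; apply: le_nint_lin => //.
- by apply: measurable_normc; apply: cmeasM; [case: cf|apply: cmeas_conj; case: cg].
- by move=> x; exact: normc_ge0.
- by move=> x; exact: sqr_ge0.
- by move=> x; exact: sqr_ge0.
- by rewrite divr_ge0// ltW.
- by rewrite invr_ge0 mulr_ge0// ltW.
- by move=> x; exact: normc_mul_conj_le.
Qed.

Lemma cintegrable_mul f g : csq f -> csq g -> cintegrable mu (fun x => f x * conjc (g x)).
Proof.
move=> cf cg; split.
  by apply: cmeasM; [case: cf|apply: cmeas_conj; case: cg].
exact: (le_lt_trans (nint_mul_le ltr01 cf cg) (ltry _)).
Qed.

Lemma ler_sqr_of_weighted (x a b : R) : 0 <= x -> 0 <= a -> 0 <= b ->
  (forall t, 0 < t -> x <= t / 2 * a + (2 * t)^-1 * b) -> x ^+ 2 <= a * b.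
Proof.
move=> x0 a0 b0 h.
have [x_eq0|xn0] := eqVneq x 0; first by rewrite x_eq0 expr0n/= mulr_ge0.
have xp : 0 < x by rewrite lt_def xn0.
have hb : 0 < b.
  rewrite lt_def b0 andbT; apply/eqP => b_0.
  (* With [b = 0] this choice would give [x <= x / 2 * (a / (a + 1))], which is less than [x]. *)
  have := h (x / (a + 1)).
  rewrite divr_gt0 ?ltr_wpDl// b_0 mulr0 addr0 => /(_ isT).
  have -> : x / (a + 1) / 2 * a = x * (a / (a + 1)) / 2.
    by field; rewrite gt_eqF// ltr_wpDl.
  have : a / (a + 1) <= 1 by rewrite ler_pdivrMr ?ltr_wpDl// mul1r lerDl.
  nra.
(* This [t] gives [x <= (a * b / x + x) / 2]; unlike the minimising value, it involves no square
   root. *)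
have := h (b / x) (divr_gt0 hb xp).
have -> : b / x / 2 * a + (2 * (b / x))^-1 * b = (a * b / x + x) / 2.
  by field; rewrite xn0 gt_eqF.
move=> h2; have : x <= a * b / x by lra.
by rewrite ler_pdivlMr// -expr2.
Qed.

Lemma cauchy_schwarz f g : csq f -> csq g -> normc (ip f g) ^+ 2 <= sqn f * sqn g.
Proof.
move=> cf cg; apply: ler_sqr_of_weighted; rewrite ?normc_ge0 ?sqn_ge0// => t t0.
rewrite -lee_fin; apply: (le_trans (normc_cint_le (cintegrable_mul cf cg))).
exact: nint_mul_le.
Qed.

Lemma ip_ff f : csq f -> ip f f = (sqn f)%:C.
Proof.
move=> cf; rewrite /ip; under eq_fun do rewrite mulc_conj.
apply: complexP => /=.
  by rewrite /sqn /sqnE /Rintegral.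
by rewrite /Rintegral integral0.
Qed.

Lemma ipDl f g h : csq f -> csq g -> csq h -> ip (fun x => f x + g x) h = ip f h + ip g h.
Proof.
move=> cf cg ch; rewrite /ip -cintD; [|exact: cintegrable_mul|exact: cintegrable_mul].
by apply: eq_cint => x; rewrite mulrDl.
Qed.

Lemma ipZl (c : R[i]) f g : csq f -> csq g -> ip (fun x => c * f x) g = c * ip f g.
Proof.
move=> cf cg; rewrite /ip -cintZ; last exact: cintegrable_mul.
by apply: eq_cint => x; rewrite mulrA.
Qed.

Lemma conj_ip f g : csq f -> csq g -> conjc (ip f g) = ip g f.
Proof.
move=> cf cg; rewrite /ip -cint_conj; last exact: cintegrable_mul.
by apply: eq_cint => x; rewrite conjcM conjcK mulrC.
Qed.

Lemma ipDr f g h : csq f -> csq g -> csq h -> ip f (fun x => g x + h x) = ip f g + ip f h.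
Proof.
move=> cf cg ch; rewrite -conj_ip//; last exact: csqD.
by rewrite ipDl// conjcD !conj_ip.
Qed.

Lemma ipZr (c : R[i]) f g : csq f -> csq g -> ip f (fun x => c * g x) = conjc c * ip f g.
Proof.
move=> cf cg; rewrite -conj_ip//; last exact: csqZ.
by rewrite ipZl// conjcM conj_ip.
Qed.

Lemma ipBl f g h : csq f -> csq g -> csq h -> ip (fun x => f x - g x) h = ip f h - ip g h.
Proof.
move=> cf cg ch; rewrite /ip -cintB; [|exact: cintegrable_mul|exact: cintegrable_mul].
by apply: eq_cint => x; rewrite mulrBl.
Qed.

Lemma ipBr f g h : csq f -> csq g -> csq h -> ip f (fun x => g x - h x) = ip f g - ip f h.
Proof.
move=> cf cg ch; rewrite -conj_ip//; last exact: csqB.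
by rewrite ipBl// conjcB !conj_ip.
Qed.

Lemma csq0 : csq (fun=> 0).
Proof.
split; first exact: cmeas_cst.
by rewrite /sqnE; under eq_integral do rewrite (Normc.normc0 R) expr0n/=; rewrite integral0 ltry.
Qed.

Lemma sqn_eq0 f : csq f -> sqn f = 0 -> {ae mu, forall x, f x = 0}.
Proof.
move=> cf f0.
have : {ae mu, forall x, normc (f x) ^+ 2 = 0}.
  apply: nint_eq0; first by apply: measurable_sqr_normc; case: cf.
    by move=> x; exact: sqr_ge0.
  by rewrite -/(sqnE f) sqnE_fin// f0.
by apply: filterS => x /eqP; rewrite expf_eq0/= normc_eq0 => /eqP.
Qed.

Lemma nint_fatou (u : (T -> R)^nat) (v : T -> R) (M : R) :
  (forall n, measurable_fun setT (u n)) -> (forall n x, 0 <= u n x) ->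
  (forall x, u ^~ x @ \oo --> v x) ->
  (forall n, (\int[mu]_x (u n x)%:E <= M%:E)%E) -> (\int[mu]_x (v x)%:E <= M%:E)%E.
Proof.
move=> mu_ u0 uv uM.
have := @fatou _ _ _ mu setT measurableT (fun n x => (u n x)%:E).
move=> /(_ _ _)/le_trans h.
have -> : (\int[mu]_x (v x)%:E = \int[mu]_x limn_einf (fun n => (u n x)%:E))%E.
  apply: eq_integral => x _.
  have c : (fun n => (u n x)%:E) @ \oo --> (v x)%:E.
    by apply: cvg_EFin => //; [exact: nearW|exact: uv].
  by rewrite (cvg_limn_einf_sup c).
apply: h.
- by move=> n; apply/measurable_EFinP; exact: mu_.
- by move=> n x _; rewrite lee_fin.
rewrite limn_einf_lim; apply: lime_le; first exact: is_cvg_einfs.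
by apply: nearW => n; apply: le_trans (uM n); apply: ereal_inf_lbound; exists n => /=.
Qed.

End square_integrable.

(** * Gaussian integrals *)

Section translation.
Context {R : realType}.
Local Notation mu := (lebesgue_measure : {measure set (measurableTypeR R) -> \bar R}).

Definition shiftr (t : R) : measurableTypeR R -> measurableTypeR R := fun s => s - t.

Lemma measurable_shiftr t : measurable_fun setT (shiftr t).
Proof. exact: measurable_funB. Qed.

Lemma lebesgue_measure_shift (t : R) (A : set R) : measurable A ->
  pushforward mu (shiftr t) A = mu A.
Proof.
move=> mA; have mS := measurable_shiftr t.
(* Lebesgue measure is determined by its values on half-open intervals, whose lengths a translation
   preserves. *)
apply/esym/lebesgue_measure_unique => //= _ [[a b]] _ <-.
rewrite /pushforward.
have -> : shiftr t @^-1` `]a, b] = `](a + t), (b + t)]%classic.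
  by apply/seteqP; split => x /=; rewrite /shiftr !in_itv/= ltrBrDr lerBlDr.
rewrite !lebesgue_measure_itv/= !lte_fin ltrD2r; case: ifP => // _.
by rewrite -!EFinB; congr EFin; ring.
Qed.

Lemma integral_shift (t : R) (f : R -> \bar R) : measurable_fun [set: measurableTypeR R] f ->
  (\int[mu]_s f ((s : R) - t)%R = \int[mu]_s f s)%E.
Proof.
move=> mf; rewrite [LHS]integralE [RHS]integralE.
have mS := measurable_shiftr t.
have h (g : R -> \bar R) : measurable_fun [set: measurableTypeR R] g -> (forall s, 0 <= g s)%E ->
    (\int[mu]_s g ((s : R) - t)%R = \int[mu]_s g s)%E.
  move=> mg g0.
  transitivity (\int[pushforward mu (shiftr t)]_s g s)%E.
    by rewrite ge0_integral_pushforward.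
  by apply: eq_measure_integral => //= A mA _; exact: lebesgue_measure_shift.
congr (_ - _)%E.
- rewrite -(h _ (measurable_funepos mf) (fun s => funepos_ge0 f s)).
  by apply: eq_integral => s _; rewrite !funeposE.
- rewrite -(h _ (measurable_funeneg mf) (fun s => funeneg_ge0 f s)).
  by apply: eq_integral => s _; rewrite !funenegE.
Qed.

Lemma cint_shift (t : R) (f : R -> R[i]) : @cmeas R _ (measurableTypeR R) f ->
  cint mu (fun s => f ((s : R) - t)) = cint mu f.
Proof.
move=> [f1 f2]; apply: complexP => /=; congr fine.
- by apply: (@integral_shift t (fun s => (complex.Re (f s))%:E)); exact/measurable_EFinP.
- by apply: (@integral_shift t (fun s => (complex.Im (f s))%:E)); exact/measurable_EFinP.
Qed.

End translation.

Section gauss.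
Context {R : realType}.
Local Notation mu := (lebesgue_measure : {measure set (measurableTypeR R) -> \bar R}).

Lemma integral_expR_sqr (c x : R) : 0 < c ->
  (\int[mu]_s (expR (- (c * (s - x) ^+ 2)))%:E = (Num.sqrt (pi / c))%:E)%E.
Proof.
(* The standard deviation for which the normal density with mean [x] is proportional to the given
   Gaussian. *)
move=> c0; set sg := Num.sqrt ((2 * c)^-1).
have sg2 : sg ^+ 2 = (2 * c)^-1.
  by rewrite sqr_sqrtr// invr_ge0 mulr_ge0// ltW.
have sg0 : sg != 0.
  by rewrite -sqrf_eq0 sg2 invr_eq0 mulf_neq0// gt_eqF.
have e1 : sg ^+ 2 *+ 2 = c^-1 by rewrite sg2; field; rewrite gt_eqF.
have := integral_normal_pdf x sg; rewrite normal_pdfE//.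
under eq_integral do rewrite EFinM.
rewrite ge0_integralZl//=; last 3 first.
- by apply/measurable_EFinP; exact: measurable_normal_fun.
- by move=> s _; rewrite lee_fin expR_ge0.
- by rewrite lee_fin normal_peak_ge0.
move=> h.
have pk : normal_peak sg = (Num.sqrt (pi / c))^-1.
  by rewrite /normal_peak -mulrnAl e1 mulrC.
have sq0 : Num.sqrt (pi / c) != 0.
  by rewrite gt_eqF// sqrtr_gt0 divr_gt0// pi_gt0.
have nE s : expR (- (c * (s - x) ^+ 2)) = normal_fun x sg s.
  by rewrite /normal_fun e1 invrK mulNr mulrC.
under eq_integral do rewrite nE.
rewrite pk in h.
by rewrite -[RHS]mule1 -h muleA -EFinM divff// mul1e.
Qed.

Lemma measurable_expR_quad (a b c : R) :
  measurable_fun [set: measurableTypeR R] (fun s => expR (a + b * `|s| - c * s ^+ 2)).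
Proof.
apply: measurableT_comp => //; apply: measurable_funB.
- by apply: measurable_funD => //; apply: measurable_funM => //; exact: measurableT_comp.
- by apply: measurable_funM => //; exact: measurable_funX.
Qed.

(** Completing the square lets half of the quadratic decay absorb the linear term; the other half is
    a Gaussian. *)
Lemma expR_quad_fin (a b c : R) : 0 < c ->
  (\int[mu]_s (expR (a + b * `|s| - c * s ^+ 2))%:E < +oo)%E.
Proof.
move=> c0.
apply: (@le_lt_trans _ _ (\int[mu]_s (expR (a + b ^+ 2 / (2 * c)) *
    expR (- (c / 2 * (s - 0) ^+ 2)))%:E)%E).
  apply: le_nint => //=.
  - exact: measurable_expR_quad.
  - apply: measurable_funM => //; apply: measurableT_comp => //.
    by apply: measurable_funN; apply: measurable_funM => //; apply: measurable_funX; exact: measurable_funB.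
  - move=> s; rewrite subr0 -expRD ler_expR -subr_ge0.
    have -> : a + b ^+ 2 / (2 * c) - c / 2 * s ^+ 2 - (a + b * `|s| - c * s ^+ 2) =
        (b - c * `|s|) ^+ 2 / (2 * c).
      rewrite sqrrB exprMn real_normK ?num_real//; field; rewrite gt_eqF//.
    by rewrite divr_ge0 ?sqr_ge0// mulr_ge0// ltW.
rewrite nintZ ?expR_ge0//; last first.
  apply: measurableT_comp => //.
  by apply: measurable_funN; apply: measurable_funM => //; apply: measurable_funX; exact: measurable_funB.
by rewrite integral_expR_sqr ?divr_gt0// -EFinM ltry.
Qed.

(* Telescope over [n] steps and let [n] tend to infinity. *)
Lemma quadratic_increments_const (u : R -> R[i]) (C e : R) : 0 <= C -> 0 < e ->
  (forall x t, 0 <= x <= 1 -> 0 <= t <= 1 -> t < e -> x + t <= 1 ->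
     normc (u (x + t) - u x) <= C * t ^+ 2) -> u 1 = u 0.
Proof.
move=> C0 e0 h.
have step n k : n.+1%:R^-1 < e -> (k <= n.+1)%N ->
    normc (u (k%:R / n.+1%:R) - u 0) <= k%:R * (C * (n.+1%:R)^-1 ^+ 2).
  move=> ne; elim: k => [_|k ih kn]; first by rewrite !mul0r subrr Normc.normc0.
  have -> : u (k.+1%:R / n.+1%:R) - u 0 =
      (u (k.+1%:R / n.+1%:R) - u (k%:R / n.+1%:R)) + (u (k%:R / n.+1%:R) - u 0) by ring.
  rewrite (le_trans (ler_normcD _ _))// -natr1 [k%:R + 1]addrC !mulrDl !mul1r lerD//; last first.
    by apply: ih; exact: ltnW.
  rewrite [X in u X]addrC; apply: (h (k%:R / n.+1%:R) n.+1%:R^-1) => //.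
  - by rewrite divr_ge0//= ler_pdivrMr// mul1r ler_nat ltnW.
  - by rewrite invr_ge0 ler0n invf_le1//= ?ltr0n// ler1n.
  - by rewrite -[X in _ + X]mul1r -mulrDl natr1 ler_pdivrMr// mul1r ler_nat.
apply/eqP; rewrite -subr_eq0 -normc_eq0 eq_le normc_ge0 andbT.
rewrite leNgt; apply/negP => d0.
set d := normc (u 1 - u 0) in d0.
(* With a mesh [n.+1%:R^-1] below both numbers, the telescoped bound [C / n.+1%:R] is smaller than
   [d]. *)
have m0 : 0 < Num.min e (d / (C + 1)).
  by rewrite lt_min e0 divr_gt0// ltr_wpDl.
have [n] := ltr_add_invr m0; rewrite add0r lt_min => /andP[ne nd].
have := step n n.+1 ne (leqnn _); rewrite divff// -/d.
have -> : n.+1%:R * (C * n.+1%:R^-1 ^+ 2) = C * n.+1%:R^-1 by field.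
move=> hd.
move: nd; rewrite ltr_pdivlMr ?ltr_wpDl// mulrDr mulr1 [_ * C]mulrC.
have : 0 < n.+1%:R^-1 :> R by rewrite invr_gt0.
by move: hd; rewrite /d; set x := n.+1%:R^-1; lra.
Qed.

Variable c : R.
Hypothesis c0 : 0 < c.

(** A Gaussian on the line with complex centre. That its integral does not depend on the centre is
    usually proved by shifting the contour. *)
Definition gk (b : R[i]) (s : R) : R[i] := cexp (- (c%:C * (s%:C - b) ^+ 2)).

Lemma Re_gk_exp (b : R[i]) (s : R) :
  complex.Re (- (c%:C * (s%:C - b) ^+ 2)) =
  - (c * ((s - complex.Re b) ^+ 2 - complex.Im b ^+ 2)).
Proof. by case: b => x y; rewrite expr2/=; ring. Qed.

Lemma cmeas_gk b : @cmeas R _ (measurableTypeR R) (gk b).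
Proof.
apply: cmeas_cexp; apply: cmeasN; apply: cmeasM; first exact: cmeas_cst.
under eq_fun do rewrite expr2.
have h : @cmeas R _ (measurableTypeR R) (fun s : measurableTypeR R => s%:C - b).
  by apply: cmeasB; [exact: cmeas_real|exact: cmeas_cst].
exact: cmeasM.
Qed.

Lemma normc_gk_le b (B s : R) : normc b <= B ->
  normc (gk b s) <= expR (c * B ^+ 2 + 2 * c * B * `|s| - c * s ^+ 2).
Proof.
move=> bB; rewrite normc_cexp Re_gk_exp ler_expR.
have p0 := c0; have hb := sqr_normc b.
have B0 : 0 <= B by rewrite (le_trans _ bB)// normc_ge0.
have b2 : normc b ^+ 2 <= B ^+ 2 by rewrite lerXn2r ?nnegrE ?normc_ge0.
have h1 : complex.Re b * s <= B * `|s|.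
  rewrite (le_trans (ler_norm _))// normrM ler_wpM2r// (le_trans _ bB)//.
  exact: ler_Re_normc.
have h2 : complex.Im b ^+ 2 <= B ^+ 2.
  by have := sqr_ge0 (complex.Re b); lra.
have h3 := sqr_ge0 (complex.Re b).
have : 0 <= c * (B ^+ 2 - complex.Im b ^+ 2 + 2 * (B * `|s| - complex.Re b * s) + complex.Re b ^+ 2).
  by apply: mulr_ge0; [exact: ltW|lra].
rewrite sqrrB -mulr_natl; lra.
Qed.

Lemma gk_integrable b : cintegrable mu (gk b).
Proof.
apply: (cintegrable_le (cmeas_gk b) (measurable_expR_quad _ _ _)
  (fun s => @normc_gk_le b _ s (lexx _))).
exact: expR_quad_fin.
Qed.

Arguments gk : simpl never.

Definition gint b := cint mu (gk b).
Definition dgint b := cint mu (fun s => (s%:C - b) * gk b s).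

Lemma sqr_le_expR (x : R) : 0 <= x -> x ^+ 2 <= expR (2 * x).
Proof.
move=> x0; rewrite mulr_natl mulr2n expRD -expr2 lerXn2r ?nnegrE ?expR_ge0//.
by have := expR_ge1Dx x; lra.
Qed.

(** Moving the centre from [b] to [b + h] changes the exponent by at most [normc h * q B s], when
    [normc b <= B] and [normc h <= 1]. *)
Let q (B s : R) : R := 2 * c * (`|s| + B) + c.

(** Once [gk b s] is factored out, [cexp z - 1 - z] and [c%:C * h ^+ 2] remain, with [z] the change
    of the exponent. In [expR (3 * q B s)], two of the three factors dominate [q B s ^+ 2] and the
    third dominates [expR (normc z)]. The constant 8 is twice 4, once for each of the two terms. *)
Lemma gk_remainder (B : R) b h s : normc b <= B -> normc h <= 1 ->
  normc (gk (b + h) s - gk b s - 2 * c%:C * h * ((s%:C - b) * gk b s)) <=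
  normc h ^+ 2 * (8 * expR (3 * (2 * c * B + c) + c * B ^+ 2 +
     (6 * c + 2 * c * B) * `|s| - c * s ^+ 2)).
Proof.
move=> bB h1; have p0 := c0; have p4 : 1 + c <= expR c := expR_ge1Dx c.
have B0 : 0 <= B by rewrite (le_trans _ bB)// normc_ge0.
pose z := 2 * c%:C * h * (s%:C - b) - c%:C * h ^+ 2.
have -> : gk (b + h) s - gk b s - 2 * c%:C * h * ((s%:C - b) * gk b s) =
    gk b s * ((cexp z - 1 - z) - c%:C * h ^+ 2).
  have -> : gk (b + h) s = gk b s * cexp z.
    by rewrite /gk -cexpD; congr cexp; rewrite /z; ring.
  by rewrite /z; ring.
have nsb : normc (s%:C - b) <= `|s| + B.
  by rewrite (le_trans (ler_normcB _ _))// normcC lerD2l.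
have n2 : normc (2 : R[i]) = 2.
  by rewrite (_ : 2 = 2%:C) ?normcC ?ger0_norm// rmorph_nat.
have hq : 0 <= q B s by rewrite /q; have := normr_ge0 s; nra.
have nh := normc_ge0 h.
have zq : normc z <= normc h * q B s.
  rewrite /z (le_trans (ler_normcB _ _))// !Normc.normcM n2 normcC (ger0_norm (ltW p0)).
  rewrite (_ : normc h * q B s = normc h * (2 * c * (`|s| + B)) + normc h * c);
    last by rewrite /q; ring.
  rewrite lerD//.
    rewrite (_ : normc h * (2 * c * (`|s| + B)) = 2 * c * normc h * (`|s| + B)); last by ring.
    by rewrite ler_wpM2l// mulr_ge0// mulr_ge0// ltW.
  by rewrite [leRHS]mulrC ler_wpM2l ?(ltW p0)// ler_piMr.
have hq1 : normc h * q B s <= q B s by rewrite ler_piMl.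
have e1 : normc ((cexp z - 1 - z) - c%:C * h ^+ 2) <= normc h ^+ 2 * (8 * expR (3 * q B s)).
  rewrite (le_trans (ler_normcB _ _))//.
  rewrite Normc.normcM normcX normcC (ger0_norm (ltW p0)).
  have ee : 1 <= expR (3 * q B s) by rewrite -expR0 ler_expR mulr_ge0.
  have -> : normc h ^+ 2 * (8 * expR (3 * q B s)) =
    normc h ^+ 2 * (4 * expR (3 * q B s)) + 4 * expR (3 * q B s) * normc h ^+ 2 by ring.
  apply: lerD; last first.
    rewrite ler_wpM2r ?exprn_ge0//.
    have : expR c <= expR (3 * q B s).
      by rewrite ler_expR /q; have := normr_ge0 s; nra.
    lra.
  rewrite (le_trans (cexpB1B_le z))//.
  have z2 : normc z ^+ 2 <= normc h ^+ 2 * expR (2 * q B s).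
    have : normc z ^+ 2 <= (normc h * q B s) ^+ 2.
      by rewrite lerXn2r ?nnegrE ?normc_ge0 ?mulr_ge0.
    move=> /le_trans; apply; rewrite exprMn ler_wpM2l ?exprn_ge0//.
    exact: sqr_le_expR.
  have ez : expR (normc z) <= expR (q B s) by rewrite ler_expR (le_trans zq).
  rewrite (_ : 3 * q B s = 2 * q B s + q B s); last by ring.
  have n0 : 0 <= normc z ^+ 2 by rewrite exprn_ge0// normc_ge0.
  have := ler_pM n0 (expR_ge0 _) z2 ez; rewrite -[leRHS]mulrA -expRD; lra.
rewrite Normc.normcM.
apply: (le_trans (ler_pM (normc_ge0 _) (normc_ge0 _) (normc_gk_le s bB) e1)).
rewrite mulrCA ler_wpM2l ?exprn_ge0// mulrCA ler_wpM2l//.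
rewrite -expRD ler_expR /q; lra.
Qed.

Lemma cmeas_dgk b : @cmeas R _ (measurableTypeR R) (fun s => (s%:C - b) * gk b s).
Proof.
apply: cmeasM; last exact: cmeas_gk.
by apply: cmeasB; [exact: cmeas_real|exact: cmeas_cst].
Qed.

Lemma dgk_integrable b : cintegrable mu (fun s => (s%:C - b) * gk b s).
Proof.
have p0 := c0; set B := normc b.
have B0 : 0 <= B by exact: normc_ge0.
apply: (cintegrable_le (cmeas_dgk b)
   (measurable_expR_quad (B + c * B ^+ 2) (1 + 2 * c * B) c)); last first.
  exact: expR_quad_fin.
move=> s; rewrite Normc.normcM.
rewrite (_ : B + c * B ^+ 2 + (1 + 2 * c * B) * `|s| - c * s ^+ 2 =
  (`|s| + B) + (c * B ^+ 2 + 2 * c * B * `|s| - c * s ^+ 2)); last by ring.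
rewrite expRD ler_pM ?normc_ge0 ?normc_gk_le//.
rewrite (le_trans (ler_normcB _ _))// normcC.
by have := expR_ge1Dx (`|s| + B); rewrite -/B; lra.
Qed.

Lemma gint_remainder (B : R) : exists2 C : R, 0 <= C & forall b h,
  normc b <= B -> normc h <= 1 ->
  normc (gint (b + h) - gint b - 2 * c%:C * h * dgint b) <= C * normc h ^+ 2.
Proof.
have p0 := c0.
have [|C C0 CE] := nint_fin (mu := mu) _
  (expR_quad_fin (3 * (2 * c * B + c) + c * B ^+ 2) (6 * c + 2 * c * B) p0).
  by move=> s; exact: expR_ge0.
exists (8 * C); first by rewrite mulr_ge0.
move=> b h bB h1; rewrite /gint /dgint.
rewrite -cintZ; last exact: dgk_integrable.
rewrite -cintB; try exact: gk_integrable.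
rewrite -cintB; last 2 first.
- by apply: cintegrableB; exact: gk_integrable.
- by apply: cintegrableZ; exact: dgk_integrable.
rewrite -lee_fin; apply: le_trans (normc_cint_le _) _.
  apply: cintegrableB; first by apply: cintegrableB; exact: gk_integrable.
  by apply: cintegrableZ; exact: dgk_integrable.
apply: (@le_trans _ _ (\int[mu]_s (normc h ^+ 2 * (8 * expR (3 * (2 * c * B + c) + c * B ^+ 2 +
     (6 * c + 2 * c * B) * `|s| - c * s ^+ 2)))%:E)%E).
  apply: le_nint => //.
  - apply: measurable_normc; apply: cmeasB.
      by apply: cmeasB; exact: cmeas_gk.
    by apply: cmeasM; [exact: cmeas_cst|exact: cmeas_dgk].
  - apply: measurable_funM => //; apply: measurable_funM => //; exact: measurable_expR_quad.
  - by move=> s; exact: normc_ge0.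
  - by move=> s; exact: gk_remainder.
rewrite nintZ ?exprn_ge0 ?normc_ge0//; last first.
  by apply: measurable_funM => //; exact: measurable_expR_quad.
rewrite nintZ//; last exact: measurable_expR_quad.
by rewrite CE -!EFinM lee_fin mulrC.
Qed.

Lemma gint_shift b (t : R) : gint (b + t%:C) = gint b.
Proof.
rewrite /gint -(cint_shift t (cmeas_gk b)); apply: eq_cint => s.
by rewrite /gk rmorphB/=; congr cexp; ring.
Qed.

Lemma le_mulr_sqr_eq0 (a C : R) : 0 <= C ->
  (forall t, 0 < t -> t <= 1 -> t * a <= C * t ^+ 2) -> a <= 0.
Proof.
move=> C0 h; rewrite leNgt; apply/negP => a0.
pose t := Num.min 1 (a / (2 * (C + 1))).
have t0 : 0 < t by rewrite lt_min ltr01 divr_gt0// mulr_gt0// ltr_wpDl.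
have t1 : t <= 1 by rewrite ge_min lexx.
have t2 : t <= a / (2 * (C + 1)) by rewrite ge_min lexx orbT.
have := h t t0 t1; rewrite expr2 mulrCA ler_pM2l// => h2.
have : C * t <= C * (a / (2 * (C + 1))) by rewrite ler_wpM2l.
have -> : C * (a / (2 * (C + 1))) = (C / (C + 1)) * (a / 2).
  by field; rewrite gt_eqF// ltr_wpDl.
have : C / (C + 1) <= 1 by rewrite ler_pdivrMr ?ltr_wpDl// mul1r lerDl.
nra.
Qed.

(** A real translation of the centre leaves [gint] unchanged. In the expansion of [gint_remainder]
    along a real step [t], the linear term [2 * c * t * dgint b] is thus itself of order [t ^+ 2],
    and [t] is arbitrarily small. *)
Lemma dgint_eq0 b : dgint b = 0.
Proof.
have p0 := c0.
have [C C0 h] := gint_remainder (normc b).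
apply/eqP; rewrite -normc_eq0 eq_le normc_ge0 andbT -(pmulr_rle0 _ (mulr_gt0 (ltr0n R 2) p0)).
apply: (@le_mulr_sqr_eq0 _ C C0) => t t0 t1.
have := h b t%:C (lexx _); rewrite normcC (gtr0_norm t0) => /(_ t1).
rewrite gint_shift subrr sub0r normcN !Normc.normcM !normcC (gtr0_norm t0) (gtr0_norm p0).
rewrite (_ : normc (2 : R[i]) = 2); last first.
  by rewrite (_ : 2 = 2%:C) ?normcC ?ger0_norm// rmorph_nat.
by apply: le_trans; rewrite le_eqVlt; apply/orP; left; apply/eqP; ring.
Qed.

(** Along the segment from 0 to [b] the first-order term of [gint_remainder] vanishes by
    [dgint_eq0]; the increments are then quadratic and [gint] is constant. At centre 0 the integral
    is real. *)
Lemma gint_const b : gint b = (Num.sqrt (pi / c))%:C.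
Proof.
have -> : gint b = gint 0.
  pose u (x : R) := gint (x%:C * b).
  suff : u 1 = u 0 by rewrite /u mul1r mul0r.
  have [C C0 h] := gint_remainder (normc b).
  apply: (@quadratic_increments_const u (C * normc b ^+ 2) ((normc b + 1)^-1)).
  - by rewrite mulr_ge0// exprn_ge0// normc_ge0.
  - by rewrite invr_gt0 ltr_wpDl// normc_ge0.
  move=> x t /andP[x0 x1] /andP[t0 t1] te _; rewrite /u rmorphD/= mulrDl.
  have := h (x%:C * b) (t%:C * b).
  rewrite dgint_eq0 mulr0 subr0 !Normc.normcM !normcC !ger0_norm// => h'.
  rewrite -mulrA -exprMn [normc b * t]mulrC; apply: h'.
    by rewrite ler_piMl// normc_ge0.
  have b1 : 0 < normc b + 1 by rewrite ltr_wpDl// normc_ge0.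
  move: te; rewrite -[ltRHS]mul1r ltr_pdivlMr// => te.
  by apply: ltW; apply: le_lt_trans te; rewrite ler_wpM2l// lerDl.
have p0 := c0.
have gE s : gk 0 s = (expR (- (c * (s - 0) ^+ 2)))%:C.
  by rewrite -cexp_real /gk; congr cexp; rewrite !subr0 rmorphN rmorphM rmorphXn.
rewrite /gint (eq_cint mu gE) /cint; apply: complexP => /=.
- by rewrite /Rintegral integral_expR_sqr.
- by rewrite Rintegral_cst// mul0r.
Qed.

End gauss.

(** * Lebesgue measure and Gaussian integrals in the plane *)

Section plane_measure.
Context {R : realType}.
Local Notation mu := (lebesgue_measure : {measure set (measurableTypeR R) -> \bar R}).

(** Named and equipped with a sigma-finite structure so that it can itself be a factor of a product,
    as in [leb2 \x leb2]. *)
Definition leb2 := (@lebesgue_measure R \x @lebesgue_measure R)%E.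

HB.instance Definition _ := Measure.on leb2.

Lemma sigma_finite_leb2 : sigma_finite setT leb2.
Proof.
have /sigma_finiteP[F [TF ndF Foo]] := sigma_finiteT (@lebesgue_measure R).
exists (fun n => F n `*` F n).
  rewrite -setXTT TF predeqE => -[x y]; split.
    move=> [/= [n _ Fnx] [k _ Gky]]; exists (maxn n k) => //; split.
    - by move: x Fnx; exact/subsetPset/ndF/leq_maxl.
    - by move: y Gky; exact/subsetPset/ndF/leq_maxr.
  by move=> [n _ []/= ? ?]; split; exists n.
move=> k; have [mFk Fkoo] := Foo k.
split; first exact: measurableX.
by rewrite /leb2 product_measure1E// lte_mul_pinfty// ge0_fin_numE.
Qed.

HB.instance Definition _ :=
  Measure_isSigmaFinite.Build _ _ _ leb2 sigma_finite_leb2.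

End plane_measure.

Section gauss2.
Context {R : realType}.
Local Notation mu := (lebesgue_measure : {measure set (measurableTypeR R) -> \bar R}).
Local Notation P := (measurableTypeR R * measurableTypeR R)%type.

(** The minus sign comes from the inner product with [tau]: conjugation turns the exponent into
    [- pi s^2 + 2 pi s (x - i y) - pi x^2], whose dependence on the point is, up to phase and
    weight, holomorphic in [x - i y]. *)
Definition zeta (q : R * R) : R[i] := q.1 -i* q.2.

Lemma cint_tensor2 (f g : R -> R[i]) : cintegrable mu f -> cintegrable mu g ->
  cint leb2 (fun q : P => f q.1 * g q.2) = cint mu f * cint mu g.
Proof. exact: cint_tensor. Qed.

Lemma cintegrable_tensor2 (f g : R -> R[i]) : cintegrable mu f -> cintegrable mu g ->
  cintegrable leb2 (fun q : P => f q.1 * g q.2).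
Proof. exact: cintegrable_tensor. Qed.

Lemma cmeas_zeta : cmeas (zeta : P -> R[i]).
Proof. by apply: cmeas_ReIm; [exact: measurable_fst|apply: measurable_funN; exact: measurable_snd]. Qed.

Lemma normc_zeta_le (q : R * R) : normc (zeta q) <= `|q.1| + `|q.2|.
Proof. by rewrite (le_trans (ler_normc_ReIm _))//= normrN. Qed.

Lemma zetaK (q : R * R) : q = (complex.Re (zeta q), - complex.Im (zeta q)).
Proof. by rewrite /= opprK; case: q. Qed.

Lemma zeta_inj : injective zeta.
Proof. by move=> p q pq; rewrite (zetaK p) pq -zetaK. Qed.

Definition expq (a b c : R) (q : R * R) : R :=
  expR (a + b * normc (zeta q) - c * normc (zeta q) ^+ 2).

Lemma measurable_expq a b c : measurable_fun setT (expq a b c : P -> R).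
Proof.
have mz := measurable_normc cmeas_zeta.
apply: measurableT_comp => //; apply: measurable_funB.
- by apply: measurable_funD => //; exact: measurable_funM.
- by apply: measurable_funM => //; exact: measurable_funX.
Qed.

Lemma expq_ge0 a b c q : 0 <= expq a b c q. Proof. exact: expR_ge0. Qed.

Lemma expq_fin a b c : 0 <= b -> 0 < c -> (\int[leb2]_q (expq a b c q)%:E < +oo)%E.
Proof.
move=> b0 c0.
pose h (s : R) := expR (a + b * `|s| - c * s ^+ 2).
pose k (s : R) := expR (0 + b * `|s| - c * s ^+ 2).
have mh : measurable_fun [set: measurableTypeR R] h by exact: measurable_expR_quad.
have mk : measurable_fun [set: measurableTypeR R] k by exact: measurable_expR_quad.
apply: (@le_lt_trans _ _ (\int[leb2]_q (h q.1 * k q.2)%:E)%E).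
  apply: le_nint => //.
  - exact: measurable_expq.
  - by apply: measurable_funM; [exact: (measurableT_comp mh)|exact: (measurableT_comp mk)].
  - by move=> q; exact: expq_ge0.
  - move=> q; rewrite /expq /h /k -expRD ler_expR sqr_normc/= sqrrN.
    have := ler_wpM2l b0 (normc_zeta_le q); lra.
have -> : (\int[leb2]_q (h q.1 * k q.2)%:E =
    \int[mu]_s (h s)%:E * \int[mu]_s (k s)%:E)%E.
  by apply: nint_tensor => // s; exact: expR_ge0.
have [|I _ ->] := nint_fin _ (expR_quad_fin a b c0).
  by move=> s; exact: expR_ge0.
have [|J _ ->] := nint_fin _ (expR_quad_fin 0 b c0).
  by move=> s; exact: expR_ge0.
by rewrite -EFinM ltry.
Qed.

(** A product of exponentials in [zeta] and in its conjugate, against the Gaussian weight of the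
    Fock space. A product of two kernels [kr] has this form, by [kr_gauss2]. *)
Definition gauss2 (A C : R[i]) (q : R * R) : R[i] :=
  cexp (pi%:C * (A * conjc (zeta q) + C * zeta q - zeta q * conjc (zeta q))).

(** The square is completed in each real coordinate. The resulting centres are complex, hence the
    need for [gint_const]. *)
Lemma gauss2E A C q : gauss2 A C q = cexp (pi%:C * (A * C)) *
  (gk pi ((A + C) / 2) q.1 * gk pi ('i * (A - C) / 2) q.2).
Proof.
rewrite /gauss2 /gk -!cexpD; congr cexp.
have -> : zeta q = q.1%:C - 'i * q.2%:C by apply: complexP => /=; ring.
have -> : conjc (q.1%:C - 'i * q.2%:C) = q.1%:C + 'i * q.2%:C.
  by apply: complexP => /=; ring.
have i2 : ('i : R[i]) ^+ 2 = -1 by exact: sqr_i.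
set x := q.1%:C; set y := q.2%:C; set p := pi%:C.
have -> : - (p * (y - 'i * (A - C) / 2) ^+ 2) =
  - p * (y ^+ 2 - 'i * y * (A - C) + 'i ^+ 2 * (A - C) ^+ 2 / 4) by field.
have -> : p * (A * (x + 'i * y) + C * (x - 'i * y) - (x - 'i * y) * (x + 'i * y)) =
  p * (A * x + C * x + 'i * y * (A - C) - x ^+ 2 + 'i ^+ 2 * y ^+ 2) by ring.
by rewrite i2; field.
Qed.

Lemma cmeas_gauss2 A C : cmeas (gauss2 A C : P -> R[i]).
Proof.
have mz := cmeas_zeta; have mc := cmeas_conj mz.
apply: cmeas_cexp; apply: cmeasM; first exact: cmeas_cst.
apply: cmeasB; last exact: cmeasM.
by apply: cmeasD; apply: cmeasM => //; exact: cmeas_cst.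
Qed.

Lemma normc_gauss2_le A C q :
  normc (gauss2 A C q) <= expq 0 (pi * (normc A + normc C)) pi q.
Proof.
have p0 := pi_gt0 R.
rewrite normc_cexp ler_expR mulc_conj add0r.
have -> : complex.Re (pi%:C * (A * conjc (zeta q) + C * zeta q - (normc (zeta q) ^+ 2)%:C)) =
   pi * (complex.Re (A * conjc (zeta q) + C * zeta q)) - pi * normc (zeta q) ^+ 2.
  by rewrite !ReM/= !ReD ReN/=; ring.
rewrite lerB// -mulrA ler_wpM2l ?(ltW p0)//.
rewrite (le_trans (ler_norm _))// (le_trans (ler_Re_normc _))//.
by rewrite (le_trans (ler_normcD _ _))// !Normc.normcM normc_conj mulrDl.
Qed.

Lemma gauss2_integrable A C : cintegrable leb2 (gauss2 A C).
Proof.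
have p0 := pi_gt0 R.
apply: (cintegrable_le (cmeas_gauss2 A C) (measurable_expq _ _ _) (normc_gauss2_le A C)).
by apply: expq_fin => //; apply: mulr_ge0; [exact: ltW|rewrite addr_ge0// normc_ge0].
Qed.

Lemma cint_gauss2 A C : cint leb2 (gauss2 A C) = cexp (pi%:C * (A * C)).
Proof.
have -> : (gauss2 A C : P -> R[i]) = (fun q : P => cexp (pi%:C * (A * C)) *
  (gk pi ((A + C) / 2) q.1 * gk pi ('i * (A - C) / 2) q.2)).
  by apply/funext => q; exact: gauss2E.
rewrite cintZ; last first.
  by apply: cintegrable_tensor2; exact: (gk_integrable (pi_gt0 R)).
rewrite cint_tensor2; try exact: (gk_integrable (pi_gt0 R)).
by rewrite -!/(gint _ _) !(gint_const (pi_gt0 R)) divff ?gt_eqF ?pi_gt0// sqrtr1 [1%:C]/= !mulr1.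
Qed.

(** Relative to the two complex centres, [zeta q] is [A] plus centred coordinates, whose first
    moments vanish by [dgint_eq0]. *)
Lemma cint_zeta_gauss2 A C :
  cint leb2 (fun q : P => zeta q * gauss2 A C q) = A * cexp (pi%:C * (A * C)).
Proof.
set b := (A + C) / 2; set d := 'i * (A - C) / 2; set e := cexp (pi%:C * (A * C)).
pose g1 (s : R) := (s%:C - b) * gk pi b s; pose g2 (s : R) := (s%:C - d) * gk pi d s.
have i1 : cintegrable mu g1 by exact: (dgk_integrable (pi_gt0 R)).
have i2 : cintegrable mu g2 by exact: (dgk_integrable (pi_gt0 R)).
have ib : cintegrable mu (gk pi b) by exact: (gk_integrable (pi_gt0 R)).
have id : cintegrable mu (gk pi d) by exact: (gk_integrable (pi_gt0 R)).
have -> : (fun q : P => zeta q * gauss2 A C q) =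
  (fun q : P => (e * (g1 q.1 * gk pi d q.2) - 'i * e * (gk pi b q.1 * g2 q.2)) +
    (A * e) * (gk pi b q.1 * gk pi d q.2)).
  apply/funext => q; rewrite gauss2E -/b -/d -/e /g1 /g2.
  have -> : zeta q = (q.1%:C - b) - 'i * (q.2%:C - d) + A.
    have -> : zeta q = q.1%:C - 'i * q.2%:C by apply: complexP => /=; ring.
    have : ('i : R[i]) * 'i = -1 by rewrite -expr2 sqr_i.
    rewrite /b /d; set x := q.1%:C; set y := q.2%:C => ii.
    have -> : 'i * (y - 'i * (A - C) / 2) = 'i * y - ('i * 'i) * (A - C) / 2 by field.
    by rewrite ii; field.
  by ring.
rewrite cintD; last 2 first.
- by apply: cintegrableB; apply: cintegrableZ; exact: cintegrable_tensor2.
- by apply: cintegrableZ; exact: cintegrable_tensor2.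
rewrite cintB; try by apply: cintegrableZ; exact: cintegrable_tensor2.
rewrite !cintZ; try exact: cintegrable_tensor2.
rewrite !cint_tensor2// -!/(gint _ _) !(gint_const (pi_gt0 R)) divff ?gt_eqF ?pi_gt0// sqrtr1 [1%:C]/= -!/(dgint _ _) !(dgint_eq0 (pi_gt0 R)).
by ring.
Qed.

End gauss2.

(** * The reproducing formula for a divided difference of exponentials *)

Section division_kernel.
Context {R : realType}.
Local Notation mu := (lebesgue_measure : {measure set (measurableTypeR R) -> \bar R}).
Local Notation P := (measurableTypeR R * measurableTypeR R)%type.

Lemma leb2_set1 (p : P) : leb2 [set p] = 0.
Proof.
have -> : [set p] = [set p.1] `*` [set p.2].
  by apply/seteqP; split => [q /= ->//|[x y] [/= -> ->]]; case: p.
have m1 (x : R) : measurable ([set x] : set (measurableTypeR R)) by exact: measurable_set1.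
have -> : leb2 ([set p.1] `*` [set p.2]) = (mu [set p.1] * mu [set p.2])%E.
  by apply: product_measure1E; exact: m1.
have -> : mu [set p.1] = 0 by exact: lebesgue_measure_set1.
by rewrite mul0e.
Qed.

(** Allows the conventional value 0 of a quotient at its pole to be ignored under the integral. *)
Lemma ae_zeta_neq (a : R[i]) : {ae leb2, forall q : P, zeta q != a}.
Proof.
pose p : P := (complex.Re a, - complex.Im a).
exists [set p]; split; [|exact: leb2_set1|].
- have -> : [set p] = [set p.1] `*` [set p.2].
    by apply/seteqP; split => [q /= ->//|[x y] [/= -> ->]].
  by apply: measurableX; exact: measurable_set1.
- move=> q /= /negP; rewrite negbK => /eqP qa.
  by apply: zeta_inj; rewrite qa; apply: complexP => /=; rewrite ?opprK.
Qed.

Lemma cexpB1_le (z : R[i]) : normc (cexp z - 1) <= 5 * normc z * expR (2 * normc z).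
Proof.
have n0 := normc_ge0 z; have h := cexpB1B_le z; have e1 := expR_ge1Dx (normc z).
have -> : cexp z - 1 = (cexp z - 1 - z) + z by ring.
rewrite (le_trans (ler_normcD _ _))//.
rewrite (_ : 2 * normc z = normc z + normc z); last by ring.
rewrite expRD; move: h n0 e1; set x := normc z; set E := expR x; set y := normc _ => h n0 e1.
have k1 : 4 * x ^+ 2 * E <= 4 * (x * E) * E.
  by rewrite expr2; apply: ler_wpM2r; nra.
have k2 : 1 <= E * E by nra.
have k3 : x <= x * (E * E) by rewrite ler_peMr.
lra.
Qed.

Lemma normr_le_expR (x : R) : x <= expR x.
Proof. by have := expR_ge1Dx x; lra. Qed.

Variables (A a c : R[i]).
Hypothesis Aa : A != a.

Let z0 (q : P) : R[i] := pi%:C * c * (zeta q - a).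
Let w0 : R[i] := pi%:C * c * (A - a).
(** An integrable majorant of [gauss2 A 0] times [expR (3 * normc (z0 q))]; the estimates below
    produce at most three factors [expR (normc (z0 q))]. *)
Let W : P -> R := expq (3 * (pi * normc c * normc a)) (pi * normc A + 3 * (pi * normc c)) pi.

Let p0 : 0 < (pi : R). Proof. exact: pi_gt0. Qed.

Let normc_z0 q : normc (z0 q) = pi * normc c * normc (zeta q - a).
Proof. by rewrite !Normc.normcM normcC ger0_norm// ltW. Qed.

Let cmeas_z0 : cmeas z0.
Proof.
apply: cmeasM; first exact: cmeas_cst.
by apply: cmeasB; [exact: cmeas_zeta|exact: cmeas_cst].
Qed.

Let mW : measurable_fun setT W. Proof. exact: measurable_expq. Qed.

Let W_fin : (\int[leb2]_q (W q)%:E < +oo)%E.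
Proof.
apply: expq_fin => //; apply: addr_ge0; first by rewrite mulr_ge0 ?normc_ge0 ?(ltW p0).
by rewrite mulr_ge0// mulr_ge0 ?normc_ge0 ?(ltW p0).
Qed.

Let gW q : normc (gauss2 A 0 q) * expR (3 * normc (z0 q)) <= W q.
Proof.
apply: (le_trans (ler_wpM2r (expR_ge0 _) (normc_gauss2_le A 0 q))).
rewrite -expRD ler_expR normc_z0 (Normc.normc0 R) addr0.
have := ler_wpM2l (mulr_ge0 (ltW p0) (normc_ge0 c)) (ler_normcB (zeta q) a).
lra.
Qed.

Let gW1 q (x : R) : 0 <= x <= 3 -> normc (gauss2 A 0 q) * expR (x * normc (z0 q)) <= W q.
Proof.
move=> /andP[x0 x3]; apply: le_trans (gW q); rewrite ler_wpM2l ?normc_ge0// ler_expR.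
by rewrite ler_wpM2r// normc_ge0.
Qed.

(* The integral of [J x], minus its expected value, has quadratic increments in
   [x]; hence it is constant, and it vanishes at [x = 0]. *)
Let J (x : R) (q : P) : R[i] := gauss2 A 0 q * ((cexp (x%:C * z0 q) - 1) / (zeta q - a)).

Let cmeas_den : cmeas (fun q : P => zeta q - a).
Proof. by apply: cmeasB; [exact: cmeas_zeta|exact: cmeas_cst]. Qed.

Let cmeas_xz0 (x : R) : cmeas (fun q => x%:C * z0 q).
Proof. by apply: cmeasM => //; exact: cmeas_cst. Qed.

Let cmeas_J x : cmeas (J x).
Proof.
apply: cmeasM; first exact: cmeas_gauss2.
apply: cmeas_div => //; apply: cmeasB; last exact: cmeas_cst.
by apply: cmeas_cexp.
Qed.

Let normc_xz0 (x : R) q : 0 <= x -> normc (x%:C * z0 q) = x * normc (z0 q).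
Proof. by move=> x0; rewrite Normc.normcM normcC ger0_norm. Qed.

Let J_integrable x : 0 <= x <= 1 -> cintegrable leb2 (J x).
Proof.
move=> /andP[x0 x1].
apply: (@cintegrable_le _ _ _ _ _ (fun q => 5 * (pi * normc c) * W q)) => //.
- by apply: measurable_funM.
- move=> q; rewrite /J Normc.normcM normc_div.
  have [->|qa] := eqVneq (zeta q) a.
    rewrite subrr (Normc.normc0 R) invr0 !mulr0; apply: mulr_ge0; last exact: expq_ge0.
    by rewrite mulr_ge0// mulr_ge0 ?normc_ge0// ltW.
  have n0 : 0 < normc (zeta q - a) by rewrite normc_gt0 subr_eq0.
  rewrite mulrA ler_pdivrMr//.
  apply: (le_trans (ler_wpM2l (normc_ge0 _) (cexpB1_le _))).
  rewrite normc_xz0//.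
  have h1 := gW1 q (x := 2 * x) _.
  have {}h1 := h1 ltac:(lra).
  rewrite -mulrA in h1.
  have h2 : 5 * (x * normc (z0 q)) <= 5 * (pi * normc c) * normc (zeta q - a).
    have -> : 5 * (pi * normc c) * normc (zeta q - a) = 5 * normc (z0 q).
      by rewrite normc_z0; ring.
    by rewrite ler_wpM2l// ler_piMl// normc_ge0.
  have -> : normc (gauss2 A 0 q) * (5 * (x * normc (z0 q)) * expR (2 * (x * normc (z0 q)))) =
    (5 * (x * normc (z0 q))) * (normc (gauss2 A 0 q) * expR (2 * (x * normc (z0 q)))) by ring.
  rewrite [leRHS]mulrAC; apply: ler_pM => //.
  + by rewrite mulr_ge0// mulr_ge0// normc_ge0.
  + by rewrite mulr_ge0 ?normc_ge0// expR_ge0.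
- by apply: nintZ_fin => //; [move=> q; exact: expq_ge0|rewrite mulr_ge0// mulr_ge0 ?normc_ge0// ltW].
Qed.

Let I (x : R) (q : P) : R[i] := gauss2 A 0 q * cexp (x%:C * z0 q).

Let IE x q : I x q = cexp (- (x%:C * pi%:C * c * a)) * gauss2 A (x%:C * c) q.
Proof. by rewrite /I /gauss2 -!cexpD; congr cexp; rewrite /z0; ring. Qed.

Let I_integrable x : cintegrable leb2 (I x).
Proof.
have -> : I x = (fun q => cexp (- (x%:C * pi%:C * c * a)) * gauss2 A (x%:C * c) q).
  by apply/funext => q; exact: IE.
by apply: cintegrableZ; exact: gauss2_integrable.
Qed.

Let cint_I x : cint leb2 (I x) = cexp (x%:C * w0).
Proof.
have -> : I x = (fun q => cexp (- (x%:C * pi%:C * c * a)) * gauss2 A (x%:C * c) q).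
  by apply/funext => q; exact: IE.
rewrite cintZ; last exact: gauss2_integrable.
by rewrite cint_gauss2 -cexpD; congr cexp; rewrite /w0; ring.
Qed.

(** What remains of [J (x + t) - J x] after the term linear in [t]. In that term [zeta q - a]
    cancels and a multiple of [I x] is left, whose integral is explicit. *)
Let rem (x t : R) (q : P) : R[i] := gauss2 A 0 q *
  (cexp (x%:C * z0 q) * (cexp (t%:C * z0 q) - 1 - t%:C * z0 q) / (zeta q - a)).

Let rem_le x t q : 0 <= x <= 1 -> 0 <= t <= 1 ->
  normc (rem x t q) <= t ^+ 2 * (4 * (pi * normc c) * W q).
Proof.
move=> /andP[x0 x1] /andP[t0 t1]; rewrite /rem Normc.normcM normc_div.
have [->|qa] := eqVneq (zeta q) a.
  rewrite subrr (Normc.normc0 R) invr0 !mulr0.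
  rewrite mulr_ge0 ?sqr_ge0// mulr_ge0 ?expq_ge0//.
  by rewrite mulr_ge0// mulr_ge0 ?normc_ge0// ltW.
have n0 : 0 < normc (zeta q - a) by rewrite normc_gt0 subr_eq0.
rewrite mulrA ler_pdivrMr// [normc (cexp _ * _)]Normc.normcM.
have k1 : normc (cexp (x%:C * z0 q)) <= expR (normc (z0 q)).
  rewrite normc_cexp ler_expR (le_trans (ler_norm _))// (le_trans (ler_Re_normc _))//.
  by rewrite normc_xz0// ler_piMl// normc_ge0.
have k2 := cexpB1B_le (t%:C * z0 q); rewrite normc_xz0// in k2.
have k3 : expR (t * normc (z0 q)) <= expR (normc (z0 q)).
  by rewrite ler_expR ler_piMl// normc_ge0.
have nz := normc_ge0 (z0 q).
have k4 : normc (cexp (t%:C * z0 q) - 1 - t%:C * z0 q) <=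
   4 * t ^+ 2 * normc (z0 q) * (expR (normc (z0 q)) * expR (normc (z0 q))).
  apply: (le_trans k2); rewrite exprMn expr2.
  have -> : 4 * (t * t * normc (z0 q) ^+ 2) * expR (t * normc (z0 q)) =
    4 * t ^+ 2 * normc (z0 q) * (normc (z0 q) * expR (t * normc (z0 q))) by ring.
  apply: ler_wpM2l; first by rewrite mulr_ge0// mulr_ge0// sqr_ge0.
  by rewrite ler_pM ?expR_ge0// normr_le_expR.
have k5 := ler_pM (normc_ge0 _) (normc_ge0 _) k1 k4.
apply: (le_trans (ler_wpM2l (normc_ge0 _) k5)).
have := gW q; rewrite (_ : 3 * normc (z0 q) = normc (z0 q) + (normc (z0 q) + normc (z0 q)));
  last by ring.
rewrite !expRD {1 2 3}normc_z0 => h.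
have -> : normc (gauss2 A 0 q) * (expR (normc (z0 q)) * (4 * t ^+ 2 * normc (z0 q) *
   (expR (normc (z0 q)) * expR (normc (z0 q))))) =
   (4 * t ^+ 2 * normc (z0 q)) * (normc (gauss2 A 0 q) * (expR (normc (z0 q)) *
    (expR (normc (z0 q)) * expR (normc (z0 q))))) by ring.
have -> : t ^+ 2 * (4 * (pi * normc c) * W q) * normc (zeta q - a) =
  (4 * t ^+ 2 * normc (z0 q)) * W q by rewrite normc_z0; ring.
apply: ler_wpM2l; first by rewrite mulr_ge0// mulr_ge0// sqr_ge0.
by move: h; rewrite -normc_z0.
Qed.

Let cmeas_rem x t : cmeas (rem x t).
Proof.
apply: cmeasM; first exact: cmeas_gauss2.
apply: cmeas_div; last exact: cmeas_den.
apply: cmeasM; first exact/cmeas_cexp/cmeas_xz0.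
apply: cmeasB; last exact: cmeas_xz0.
by apply: cmeasB; [exact/cmeas_cexp/cmeas_xz0|exact: cmeas_cst].
Qed.

Let rem_fin : (\int[leb2]_q (4 * (pi * normc c) * W q)%:E < +oo)%E.
Proof.
by apply: nintZ_fin => //; [move=> q; exact: expq_ge0|rewrite mulr_ge0// mulr_ge0 ?normc_ge0// ltW].
Qed.

Let cW0 q : 0 <= 4 * (pi * normc c) * W q.
Proof.
by rewrite mulr_ge0 ?expq_ge0// mulr_ge0// mulr_ge0 ?normc_ge0// ltW.
Qed.

Let mcW : measurable_fun setT (fun q => 4 * (pi * normc c) * W q).
Proof. exact: measurable_funM. Qed.

Let rem_integrable x t : 0 <= x <= 1 -> 0 <= t <= 1 -> cintegrable leb2 (rem x t).
Proof.
move=> x01 t01.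
apply: (cintegrable_le (cmeas_rem x t) _ (fun q => rem_le q x01 t01)).
  exact: measurable_funM.
by apply: nintZ_fin => //; rewrite sqr_ge0.
Qed.

Let u (x : R) : R[i] := cint leb2 (J x) - (cexp (x%:C * w0) - 1) / (A - a).

Let u_incr : exists2 C : R, 0 <= C & forall x t, 0 <= x <= 1 -> 0 <= t <= 1 -> x + t <= 1 ->
  normc (u (x + t) - u x) <= C * t ^+ 2.
Proof.
have [C1 C10 C1E] := nint_fin cW0 rem_fin.
pose C2 := expR (normc w0) * (4 * normc w0 ^+ 2 * expR (normc w0)) / normc (A - a).
exists (C1 + C2).
  rewrite addr_ge0// divr_ge0 ?normc_ge0// mulr_ge0 ?expR_ge0//.
  by rewrite mulr_ge0 ?expR_ge0// mulr_ge0// sqr_ge0.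
move=> x t x01 t01 xt1.
have xt01 : 0 <= x + t <= 1 by lra.
have E1 : cint leb2 (J (x + t)) = cint leb2 (fun q => J x q + (t%:C * (pi%:C * c) * I x q + rem x t q)).
  apply: ae_eq_cint; first exact: cmeas_J.
  - apply: cmeasD; first exact: cmeas_J.
    apply: cmeasD; last exact: cmeas_rem.
    apply: cmeasM; first exact: cmeas_cst.
    exact: (I_integrable x).1.
  (* The pole must be excluded: there the quotients are 0, whereas the term in [I x] need not be. *)
  - apply: filterS (ae_zeta_neq a) => q qa.
    have qa0 : zeta q - a != 0 by rewrite subr_eq0.
    rewrite /J /I /rem.
    have -> : (x + t)%:C * z0 q = x%:C * z0 q + t%:C * z0 q by rewrite rmorphD mulrDl.
    rewrite cexpD.
    have -> : t%:C * z0 q = t%:C * (pi%:C * c) * (zeta q - a) by rewrite /z0; ring.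
    by field.
have E2 : u (x + t) - u x = cint leb2 (rem x t) -
   cexp (x%:C * w0) * (cexp (t%:C * w0) - 1 - t%:C * w0) / (A - a).
  rewrite /u E1 cintD; last 2 first.
  - exact: J_integrable.
  - by apply: cintegrableD; [exact: cintegrableZ|exact: rem_integrable].
  rewrite cintD; [|exact: cintegrableZ|exact: rem_integrable].
  rewrite cintZ; last exact: I_integrable.
  rewrite cint_I.
  have -> : (x + t)%:C * w0 = x%:C * w0 + t%:C * w0 by rewrite rmorphD mulrDl.
  rewrite cexpD.
  have -> : t%:C * w0 = t%:C * (pi%:C * c) * (A - a) by rewrite /w0; ring.
  by field; rewrite subr_eq0.
rewrite E2; apply: (le_trans (ler_normcB _ _)); rewrite mulrDl; apply: lerD.
- rewrite -lee_fin; apply: le_trans (normc_cint_le (rem_integrable x01 t01)) _.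
  apply: (@le_trans _ _ (\int[leb2]_q (t ^+ 2 * (4 * (pi * normc c) * W q))%:E)%E).
    apply: le_nint.
    + by case: (rem_integrable x01 t01) => mr _; exact: measurable_normc.
    + by apply: measurable_funM; [exact: measurable_cst|exact: mcW].
    + by move=> q; exact: normc_ge0.
    + by move=> q; exact: rem_le.
  by rewrite nintZ ?sqr_ge0// C1E -EFinM lee_fin mulrC.
- rewrite normc_div /C2 [leRHS]mulrAC ler_wpM2r ?invr_ge0 ?normc_ge0//.
  rewrite [normc (cexp _ * _)]Normc.normcM.
  move: x01 t01 => /andP[x0 x1] /andP[t0 t1].
  have nw := normc_ge0 w0.
  have k1 : normc (cexp (x%:C * w0)) <= expR (normc w0).
    rewrite normc_cexp ler_expR (le_trans (ler_norm _))// (le_trans (ler_Re_normc _))//.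
    by rewrite Normc.normcM normcC ger0_norm// ler_piMl.
  have k2 : normc (cexp (t%:C * w0) - 1 - t%:C * w0) <=
      4 * normc w0 ^+ 2 * expR (normc w0) * t ^+ 2.
    apply: (le_trans (cexpB1B_le _)).
    rewrite [normc (t%:C * w0)]Normc.normcM normcC (ger0_norm t0) exprMn.
    rewrite [t ^+ 2 * _]mulrC mulrA [leLHS]mulrAC ler_wpM2r ?sqr_ge0//.
    rewrite ler_wpM2l ?ler_expR ?ler_piMl//.
    by rewrite mulr_ge0// sqr_ge0.
  have := ler_pM (normc_ge0 _) (normc_ge0 _) k1 k2.
  by rewrite -[X in _ -> _ <= X]mulrA.
Qed.

Let JE q : cexp (pi%:C * (c * a)) * J 1 q = gauss2 A 0 q *
  ((cexp (pi%:C * (c * zeta q)) - cexp (pi%:C * (c * a))) / (zeta q - a)).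
Proof.
rewrite /J mul1r.
have -> : cexp (pi%:C * (c * zeta q)) = cexp (pi%:C * (c * a)) * cexp (z0 q).
  by rewrite -cexpD; congr cexp; rewrite /z0; ring.
by ring.
Qed.

Lemma cintegrable_division_kernel : cintegrable leb2 (fun q : P => gauss2 A 0 q *
  ((cexp (pi%:C * (c * zeta q)) - cexp (pi%:C * (c * a))) / (zeta q - a))).
Proof.
rewrite (_ : (fun q => _) = (fun q => cexp (pi%:C * (c * a)) * J 1 q)).
  by apply: cintegrableZ; apply: J_integrable; rewrite ler01 lexx.
by apply/funext => q; rewrite JE.
Qed.

(** As [gauss2 A 0] is the weighted Fock kernel at [A], this is the reproducing formula for the
    entire function [(e^(pi c zeta) - e^(pi c a)) / (zeta - a)]. Division by a zero in [inE] will be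
    reduced to it. *)
Lemma cint_division_kernel :
  cint leb2 (fun q : P => gauss2 A 0 q *
    ((cexp (pi%:C * (c * zeta q)) - cexp (pi%:C * (c * a))) / (zeta q - a))) =
  (cexp (pi%:C * (c * A)) - cexp (pi%:C * (c * a))) / (A - a).
Proof.
have u1 : u 1 = u 0.
  have [C C0 h] := u_incr.
  apply: (@quadratic_increments_const _ u C 1) => // x t x01 t01 _ xt1; exact: h.
have e0 : cexp (0%:C * w0) = 1 by rewrite mul0r cexp0.
have J0 : J 0 = (fun=> 0).
  by apply/funext => q; rewrite /J mul0r cexp0 subrr mul0r mulr0.
have {u1} : cint leb2 (J 1) = (cexp w0 - 1) / (A - a).
  move: u1; rewrite /u e0 J0 cint0 subrr mul0r subr0 mul1r => /eqP.
  by rewrite subr_eq0 => /eqP.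
move=> h.
transitivity (cexp (pi%:C * (c * a)) * cint leb2 (J 1)).
  rewrite -cintZ; last by apply: J_integrable; lra.
  by apply: eq_cint => q; rewrite JE.
rewrite h.
have -> : cexp (pi%:C * (c * A)) = cexp (pi%:C * (c * a)) * cexp w0.
  by rewrite -cexpD; congr cexp; rewrite /w0; ring.
by ring.
Qed.

End division_kernel.

(** * The Cauchy kernel in the plane *)

Section singular_kernel.
Context {R : realType}.
Local Notation mu := (lebesgue_measure : {measure set (measurableTypeR R) -> \bar R}).
Local Notation P := (measurableTypeR R * measurableTypeR R)%type.
Implicit Types (w z : P).

(* [(zeta z - zeta w)^-1 = 0] when [z = w]. *)
Definition ck w z : R := (normc (zeta z - zeta w))^-1.

Lemma ck_ge0 w z : 0 <= ck w z. Proof. by rewrite invr_ge0 normc_ge0. Qed.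

Lemma ckC w z : ck w z = ck z w. Proof. by rewrite /ck normcBC. Qed.

Lemma cmeas_zetaB2 : cmeas (fun wz : P * P => zeta wz.2 - zeta wz.1).
Proof.
by apply: cmeasB; [exact: (cmeas_comp cmeas_zeta measurable_snd)|
  exact: (cmeas_comp cmeas_zeta measurable_fst)].
Qed.

Lemma measurable_ck2 : measurable_fun setT (fun wz : P * P => ck wz.1 wz.2).
Proof.
apply: measurable_funV; first exact: (measurable_normc cmeas_zetaB2).
by move=> ?; exact: normc_ge0.
Qed.

Lemma measurable_ck w : measurable_fun setT (ck w).
Proof. exact: (measurableT_comp measurable_ck2 (pair1_measurable w)). Qed.

(** Squares rather than discs: their measure is a product of two lengths, while a point outside is
    still at distance at least [r] from [w]. *)
Definition box (w : P) (r : R) : set P :=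
  `]w.1 - r, w.1 + r[%classic `*` `]w.2 - r, w.2 + r[%classic.

Lemma measurable_box w r : measurable (box w r).
Proof. by apply: measurableX; exact: measurable_itv. Qed.

Lemma leb2_box w r : 0 <= r -> leb2 (box w r) = (4 * r ^+ 2)%:E.
Proof.
move=> r0.
pose I1 : set (measurableTypeR R) := `](w.1 : R) - r, (w.1 : R) + r[%classic.
pose I2 : set (measurableTypeR R) := `](w.2 : R) - r, (w.2 : R) + r[%classic.
have -> : leb2 (box w r) = (mu I1 * mu I2)%E.
  by apply: product_measure1E; exact: measurable_itv.
have lI (a : R) : mu `]a - r, a + r[%classic = (2 * r)%:E.
  have := @lebesgue_measure_itv R `]a - r, a + r[; rewrite /= lte_fin.
  move=> /(fun h => etrans h) h; apply: (h (2 * r)%:E) => {h}.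
  have [->|r1] := eqVneq r 0; first by rewrite subr0 addr0 ltxx mulr0.
  have rp : 0 < r by rewrite lt_neqAle eq_sym r1.
  by rewrite ifT; [rewrite -EFinB; congr EFin; ring|lra].
have -> : mu I1 = (2 * r)%:E by exact: lI.
have -> : mu I2 = (2 * r)%:E by exact: lI.
by rewrite -EFinM; congr EFin; ring.
Qed.

Lemma mem_box w z r : (z \in box w r) = (`|(z.1 : R) - w.1| < r) && (`|(z.2 : R) - w.2| < r).
Proof.
rewrite /box; apply/idP/idP => [/set_mem[/= + +]|/andP[h1 h2]].
  by rewrite /= !in_itv/= !ltr_distl => -> ->.
by apply/mem_set; split => /=; rewrite in_itv/= -ltr_distl.
Qed.

Lemma notin_box_le w z r : 0 < r -> z \notin box w r -> ck w z <= r^-1.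
Proof.
move=> r0; rewrite mem_box negb_and -!leNgt => h.
rewrite /ck lef_pV2 ?posrE//.
  have hz : complex.Re (zeta z - zeta w) = (z.1 : R) - w.1 by [].
  have hi : complex.Im (zeta z - zeta w) = - ((z.2 : R) - w.2) by rewrite /=; ring.
  move: h => /orP[h|h]; apply: (le_trans h).
    by rewrite -hz ler_Re_normc.
  by rewrite -normrN -hi ler_Im_normc.
have : 0 < `|(z.1 : R) - w.1| \/ 0 < `|(z.2 : R) - w.2|.
  by move: h => /orP[h|h]; [left|right]; exact: lt_le_trans h.
move=> hh; rewrite normc_gt0 subr_eq0; apply/eqP => /zeta_inj zw.
by case: hh; rewrite zw subrr normr0 ltxx.
Qed.

(** Dyadic shells: if [z] lies in the box of radius [d / 2 ^+ k] but not in the next one, then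
    [ck w z <= 2 ^+ k.+1 / d], and the term of index [k] alone dominates. *)
Lemma ck_box_series w z (d : R) : 0 < d ->
  ((ck w z * \1_(box w d) z)%:E <=
   \sum_(k <oo) (2 ^+ k.+1 / d * \1_(box w (d / 2 ^+ k)) z)%:E)%E.
Proof.
move=> d0.
have t0 k : 0 <= 2 ^+ k.+1 / d * \1_(box w (d / 2 ^+ k)) z :> R.
  by rewrite mulr_ge0// ?divr_ge0// ?exprn_ge0// ltW.
have [zw|zw] := eqVneq (zeta z) (zeta w).
  rewrite /ck zw subrr (Normc.normc0 R) invr0 mul0r.
  by apply: nneseries_ge0 => k _ _; rewrite lee_fin.
rewrite indicE; case: (boolP (z \in box w d)) => zd; last first.
  by rewrite mulr0; apply: nneseries_ge0 => k _ _; rewrite lee_fin.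
rewrite mulr1.
have [k zk zk1] : exists2 k, z \in box w (d / 2 ^+ k) & z \notin box w (d / 2 ^+ k.+1).
  have ex : exists k, z \notin box w (d / 2 ^+ k).
    pose r := Num.max `|(z.1 : R) - w.1| `|(z.2 : R) - w.2|.
    have r0 : 0 < r.
      rewrite lt_max !normr_gt0; apply/negPn/negP; rewrite negb_or !negbK => /andP[/eqP h1 /eqP h2].
      move: zw; rewrite (_ : z = w) ?eqxx//.
      by case: (z) (w) h1 h2 => z1 z2 [w1 w2]/= /subr0_eq -> /subr0_eq ->.
    have rd : 0 < r / d by rewrite divr_gt0.
    have [k hk] := ltr_add_invr rd; rewrite add0r in hk.
    exists k; rewrite mem_box negb_and -!leNgt -le_max -/r.
    rewrite ler_pdivrMr ?exprn_gt0//.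
    move: hk; rewrite ltr_pdivlMr// mulrC ltr_pdivrMr// => /ltW /le_trans; apply.
    rewrite ler_pM2l// -natrX ler_nat.
    exact: ltn_expl.
  (* The first box that misses [z] is not the one of index 0, as [z] lies in [box w d]; its
     predecessor is the wanted one. *)
  have := ex_minnP ex => -[[|k] hk hmin].
    by move: hk; rewrite expr0 divr1 zd.
  exists k => //; apply/negPn/negP => /hmin; by rewrite ltnn.
apply: (@le_trans _ _ (2 ^+ k.+1 / d * \1_(box w (d / 2 ^+ k)) z)%:E).
  rewrite indicE zk mulr1 lee_fin.
  have := notin_box_le _ zk1; rewrite invf_div; apply.
  by rewrite divr_gt0// exprn_gt0.
rewrite (@nneseriesD1 _ _ k)//; last by move=> i _; rewrite lee_fin.
rewrite leeDl//; apply: nneseries_ge0 => i _ _; rewrite lee_fin//.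
Qed.

(** The term of index [k] integrates to [2 ^+ k.+1 / d * 4 * (d / 2 ^+ k) ^+ 2 = 16 * d / 2 ^+
    k.+1], and these add up to [16 * d]. *)
Lemma ck_box_le w (d : R) : 0 < d ->
  (\int[leb2]_z (ck w z * \1_(box w d) z)%:E <= (16 * d)%:E)%E.
Proof.
move=> d0.
have t0 k z : 0 <= 2 ^+ k.+1 / d * \1_(box w (d / 2 ^+ k)) z :> R.
  by rewrite mulr_ge0// ?divr_ge0// ?exprn_ge0// ltW.
have mt k : measurable_fun setT (fun z : P => 2 ^+ k.+1 / d * \1_(box w (d / 2 ^+ k)) z).
  by apply: measurable_funM => //; apply: measurable_indic; exact: measurable_box.
apply: (@le_trans _ _ (\int[leb2]_z (\sum_(k <oo) (2 ^+ k.+1 / d * \1_(box w (d / 2 ^+ k)) z)%:E))%E).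
  apply: ge0_le_integral => //.
  - by move=> z _; rewrite lee_fin mulr_ge0 ?ck_ge0.
  - apply/measurable_EFinP; apply: measurable_funM; first exact: measurable_ck.
    by apply: measurable_indic; exact: measurable_box.
  - apply: ge0_emeasurable_sum => k; first by move=> z _ _; rewrite lee_fin.
    by move=> _; exact/measurable_EFinP.
  - by move=> z _; exact: ck_box_series.
rewrite integral_nneseries//; last 2 first.
- by move=> k; exact/measurable_EFinP.
- by move=> k z _; rewrite lee_fin.
have iE k : (\int[leb2]_z (2 ^+ k.+1 / d * \1_(box w (d / 2 ^+ k)) z)%:E =
  ((16 * d) / (2 ^ (k + 1))%:R)%:E)%E.
  rewrite nintZ; last 3 first.
  - by apply: measurable_indic; exact: measurable_box.
  - by move=> z; rewrite indicE.
  - by rewrite divr_ge0 ?exprn_ge0// ltW.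
  rewrite integral_indic//; last exact: measurable_box.
  rewrite setIT [X in (_ * X)%E](_ : _ = (4 * (d / 2 ^+ k) ^+ 2)%:E); last first.
    by apply: leb2_box; rewrite divr_ge0 ?exprn_ge0// ltW.
  rewrite -EFinM addn1 natrX; congr EFin.
  rewrite exprS; field.
  by rewrite expf_neq0//= gt_eqF.
under eq_eseriesr do rewrite iE.
have := @cvg_geometric_eseries_half R (16 * d) 0.
rewrite expr0 divr1 => /cvg_lim <-//.
Qed.

(** Inside the box of radius [d] the density is at most [M], outside it the kernel is at most
    [d^-1]. The bound is uniform in [w], and the radius stays free so that the singular part can be
    made small. *)
Lemma ck_integral_le (rho : P -> R) (M I d : R) w : measurable_fun setT rho ->
  (forall z, 0 <= rho z <= M) -> (\int[leb2]_z (rho z)%:E <= I%:E)%E -> 0 < d ->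
  (\int[leb2]_z (rho z * ck w z)%:E <= (16 * d * M + I / d)%:E)%E.
Proof.
move=> mr rM rI d0.
have M0 : 0 <= M by have /andP[/le_trans h /h] := rM w.
have mb : measurable_fun setT (fun z : P => ck w z * \1_(box w d) z).
  apply: measurable_funM; first exact: measurable_ck.
  by apply: measurable_indic; exact: measurable_box.
have b0 z : 0 <= ck w z * \1_(box w d) z by rewrite mulr_ge0 ?ck_ge0.
have d1 : 0 <= d^-1 by rewrite invr_ge0 ltW.
have r0 z : 0 <= rho z by have /andP[] := rM z.
have mrc : measurable_fun setT (fun z => rho z * ck w z).
  by apply: measurable_funM => //; exact: measurable_ck.
apply: (le_trans (le_nint_lin leb2 mrc mb mr _ b0 r0 M0 d1 _)).
- by move=> z; rewrite mulr_ge0 ?ck_ge0.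
- move=> z; have /andP[_ rz] := rM z; have c0 := ck_ge0 w z.
  rewrite indicE; case: (boolP (z \in box w d)) => zd.
    rewrite mulr1 (@le_trans _ _ (M * ck w z))//; first by rewrite ler_wpM2r.
    by rewrite lerDl mulr_ge0.
  by rewrite !mulr0 add0r mulrC ler_wpM2r// notin_box_le.
rewrite EFinD; apply: leeD.
  rewrite mulrC EFinM lee_wpmul2l ?lee_fin//; exact: ck_box_le.
by rewrite mulrC EFinM lee_wpmul2l ?lee_fin.
Qed.

Definition far (K : R) (z : P) : R := (K < normc (zeta z))%R%:R.

Lemma measurable_far K : measurable_fun setT (far K).
Proof.
have mz : measurable_fun setT (fun z : P => normc (zeta z)) by exact: (measurable_normc cmeas_zeta).
rewrite (_ : far K = \1_[set z : P | K < normc (zeta z)]); last first.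
  by apply/funext => z; rewrite /far indicE; congr (nat_of_bool _)%:R; apply/idP/idP => [h|/set_mem//]; exact/mem_set.
apply: measurable_indic; rewrite -[X in measurable X]setTI.
have -> : [set z : P | K < normc (zeta z)] = (fun z : P => normc (zeta z)) @^-1` `]K, +oo[.
  by apply/seteqP; split => z /=; rewrite in_itv/= andbT.
by apply: mz => //; exact: measurable_itv.
Qed.

Lemma tail_integral (rho : P -> R) (e : R) : measurable_fun setT rho -> (forall z, 0 <= rho z) ->
  (\int[leb2]_z (rho z)%:E < +oo)%E -> 0 < e ->
  exists2 K : R, 0 < K & (\int[leb2]_z (rho z * far K z)%:E <= e%:E)%E.
Proof.
move=> mr r0 roo e0.
pose f_ n z := (rho z * far n.+1%:R z)%:E.
have mf n : measurable_fun setT (f_ n).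
  by apply/measurable_EFinP; apply: measurable_funM => //; exact: measurable_far.
have fcvg : {ae leb2, forall z, setT z -> f_ ^~ z @ \oo --> (cst 0%E z : \bar R)}.
  apply/aeW => z _; apply: cvg_near_cst.
  have [n hn] : exists n : nat, normc (zeta z) < n%:R.
    by exists (Num.Def.trunc (normc (zeta z))).+1; exact: truncnS_gt.
  exists n => // m /= nm; rewrite /f_ /far ltNge (ltW (lt_le_trans hn _)) ?mulr0//.
  by rewrite ler_nat (leq_trans nm).
have ri : leb2.-integrable setT (fun z => (rho z)%:E).
  apply/integrableP; split; first exact/measurable_EFinP.
  by under eq_integral do rewrite abse_EFin ger0_norm//.
have fdom : {ae leb2, forall z n, setT z -> (`|f_ n z| <= (rho z)%:E)%E}.
  apply/aeW => z n _; rewrite /f_ abse_EFin lee_fin ger0_norm /far ?mulr_ge0//.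
  by rewrite ler_piMr//; case: (_ < _).
have [_ _] := dominated_convergence measurableT mf (measurable_cst _) fcvg ri fdom.
rewrite integral0 => /fine_cvgP[_ /cvgrPdist_lt /(_ _ e0)[n _ /(_ n (leqnn _))]].
rewrite /= sub0r normrN => h.
exists n.+1%:R; first by rewrite ltr0n.
have k0 : (0 <= \int[leb2]_z f_ n z)%E.
  by apply: integral_ge0 => z _; rewrite lee_fin mulr_ge0// /far.
have kf : (\int[leb2]_z f_ n z)%E \is a fin_num.
  rewrite ge0_fin_numE//; apply: le_lt_trans roo; apply: le_nint => //.
  - by apply: measurable_funM => //; exact: measurable_far.
  - by move=> z; rewrite mulr_ge0// /far.
  - by move=> z; rewrite /far ler_piMr//; case: (_ < _).
by rewrite -[X in (X <= _)%E](fineK kf) lee_fin ltW// (le_lt_trans _ h)// ler_norm.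
Qed.

Lemma ck_tail (rho : P -> R) (M e : R) : measurable_fun setT rho ->
  (forall z, 0 <= rho z <= M) -> (\int[leb2]_z (rho z)%:E < +oo)%E -> 0 < e ->
  exists2 K : R, 0 < K & forall w, (\int[leb2]_z (rho z * far K z * ck w z)%:E <= e%:E)%E.
Proof.
move=> mr rM roo e0.
have M0 : 0 <= M by have /andP[/le_trans h /h] := rM (0, 0).
(* This makes the singular part [16 * d * M] at most [e / 2]; the mass of the tail is then taken
   below [e / 2 * d]. *)
pose d := e / (32 * (M + 1)).
have d0 : 0 < d by rewrite divr_gt0// mulr_gt0// ltr_wpDl.
have ed0 : 0 < e / 2 * d by rewrite mulr_gt0// divr_gt0.
have [|K K0 hK] := tail_integral mr _ roo ed0.
  by move=> z; have /andP[] := rM z.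
exists K => // w.
apply: (le_trans (ck_integral_le (M := M) (d := d) w _ _ hK d0)).
- by apply: measurable_funM => //; exact: measurable_far.
- move=> z; have /andP[r0 rz] := rM z; rewrite /far; case: (_ < _).
    by rewrite mulr1 r0.
  by rewrite mulr0 lexx.
rewrite lee_fin mulfK ?gt_eqF//.
have : 16 * d * M <= e / 2.
  have -> : 16 * d * M = e / 2 * (M / (M + 1)).
    by rewrite /d; field; rewrite gt_eqF// ltr_wpDl.
  rewrite ler_piMr// ?divr_ge0// ?(ltW e0)//.
  by rewrite ler_pdivrMr ?ltr_wpDl// mul1r lerDl.
lra.
Qed.

End singular_kernel.

(** * The Fock space and division by zeros *)

Section reproducing_kernel.
Context {R : realType}.
Local Notation P := (measurableTypeR R * measurableTypeR R)%type.
Implicit Types (p q r a : P) (Phi : P -> R[i]).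

Let p0 : 0 < (pi : R). Proof. exact: pi_gt0. Qed.

Definition gw (c : R) (w z : P) : R := expR (- (c * normc (zeta z - zeta w) ^+ 2)).

Lemma gw_ge0 c w z : 0 <= gw c w z. Proof. exact: expR_ge0. Qed.

Lemma measurable_gw2 c : measurable_fun setT (fun wz : P * P => gw c wz.1 wz.2).
Proof.
apply: measurableT_comp => //; apply: measurable_funN; apply: measurable_funM => //.
apply: measurable_funX; exact: (measurable_normc cmeas_zetaB2).
Qed.

Lemma measurable_gw c w : measurable_fun setT (gw c w).
Proof. exact: (measurableT_comp (measurable_gw2 c) (pair1_measurable w)). Qed.

Lemma nint_gw c w : 0 < c -> (\int[leb2]_z (gw c w z)%:E = (pi / c)%:E)%E.
Proof.
move=> c0.
pose h (x : R) (s : measurableTypeR R) := expR (- (c * ((s : R) - x) ^+ 2)).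
have mh x : measurable_fun setT (h x).
  apply: measurableT_comp => //; apply: measurable_funN; apply: measurable_funM => //.
  by apply: measurable_funX; exact: measurable_funB.
have hE (x : R) : (\int[lebesgue_measure]_s (h x s)%:E = (Num.sqrt (pi / c))%:E)%E.
  exact: integral_expR_sqr.
transitivity (\int[leb2]_z (h w.1 z.1 * h w.2 z.2)%:E)%E.
  apply: eq_integral => z _; rewrite /gw /h -expRD sqr_normc/=; congr (expR _)%:E; ring.
have -> : (\int[leb2]_z (h w.1 z.1 * h w.2 z.2)%:E =
  \int[lebesgue_measure]_s (h w.1 s)%:E * \int[lebesgue_measure]_s (h w.2 s)%:E)%E.
  by apply: nint_tensor => // s; exact: expR_ge0.
by rewrite !hE -EFinM -expr2 sqr_sqrtr// divr_ge0 ?ltW.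
Qed.

(* The Fock space kernel [e^(pi z conj w)] times the Gaussian weights
   [e^(-pi |z|^2 / 2)] and [e^(-pi |w|^2 / 2)]. *)
Definition kr p q : R[i] := cexp (pi%:C * (zeta p * conjc (zeta q)) -
  (pi / 2 * (normc (zeta p) ^+ 2 + normc (zeta q) ^+ 2))%:C).

Lemma normc_kr p q : normc (kr p q) = gw (pi / 2) p q.
Proof.
rewrite /kr normc_cexp /gw; congr expR; rewrite !sqr_normc.
by rewrite ReD ReN !ReM ReD ReN ImD ImN ImM /=; field.
Qed.

Lemma conj_kr p q : conjc (kr p q) = kr q p.
Proof.
rewrite /kr conj_cexp conjcB !conjcM conjcK; congr cexp; congr (_ - _).
  have -> : conjc (pi%:C) = pi%:C :> R[i] by apply: complexP => //=; rewrite oppr0.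
  by ring.
by apply: complexP => /=; [congr (_ * _); exact: addrC|exact: oppr0].
Qed.

Lemma normc_kr_le1 p q : normc (kr p q) <= 1.
Proof.
by rewrite normc_kr /gw -expR0 ler_expR oppr_le0 mulr_ge0 ?sqr_ge0// divr_ge0// ltW.
Qed.

Lemma cmeas_kr2 : cmeas (fun pq : P * P => kr pq.1 pq.2).
Proof.
have m1 : cmeas (fun pq : P * P => zeta pq.1) by exact: (cmeas_comp cmeas_zeta measurable_fst).
have m2 : cmeas (fun pq : P * P => zeta pq.2) by exact: (cmeas_comp cmeas_zeta measurable_snd).
apply: cmeas_cexp; apply: cmeasB.
  apply: cmeasM; first exact: cmeas_cst.
  by apply: cmeasM => //; exact: cmeas_conj.
apply: cmeas_real; apply: measurable_funM => //; apply: measurable_funD;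
  by apply: measurable_funX; exact: measurable_normc.
Qed.

Lemma cmeas_krl p : cmeas (kr p).
Proof. exact: (cmeas_comp cmeas_kr2 (pair1_measurable p)). Qed.

Lemma cmeas_krr p : cmeas (fun q => kr q p).
Proof. exact: (cmeas_comp cmeas_kr2 (pair2_measurable p)). Qed.

Definition wte p : R[i] := cexp (- (pi / 2 * normc (zeta p) ^+ 2)%:C).

Lemma cmeas_wte : cmeas (wte : P -> R[i]).
Proof.
apply: cmeas_cexp; apply: cmeasN; apply: cmeas_real; apply: measurable_funM => //.
by apply: measurable_funX; exact: (measurable_normc cmeas_zeta).
Qed.

Lemma normc_wte_le1 q : normc (wte q) <= 1.
Proof.
rewrite normc_cexp -expR0 ler_expR /= oppr_le0 mulr_ge0 ?sqr_ge0// divr_ge0// ltW//.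
Qed.

Lemma kr_gauss2 p q r : kr p q * kr q r =
  wte p * wte r * gauss2 (zeta p) (conjc (zeta r)) q.
Proof.
rewrite /kr /wte /gauss2 -!cexpD; congr cexp; rewrite mulc_conj.
by rewrite !rmorphM !rmorphD/=; field.
Qed.

Lemma cint_kr_kr p r : cint leb2 (fun q => kr p q * kr q r) = kr p r.
Proof.
transitivity (cint leb2 (fun q => wte p * wte r * gauss2 (zeta p) (conjc (zeta r)) q)).
  by apply: eq_cint => q; exact: kr_gauss2.
rewrite cintZ; last exact: gauss2_integrable.
rewrite cint_gauss2 /kr /wte -!cexpD; congr cexp.
by rewrite !rmorphM !rmorphD/=; ring.
Qed.

Lemma cint_kr_zeta_kr p r : cint leb2 (fun q => kr p q * zeta q * kr q r) = zeta p * kr p r.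
Proof.
have ui : cintegrable leb2 (fun q : P => zeta q * gauss2 (zeta p) (conjc (zeta r)) q).
  set A := zeta p; set C := conjc (zeta r).
  have b0 : 0 <= 1 + pi * (normc A + normc C).
    by rewrite addr_ge0// mulr_ge0 ?(ltW p0)// addr_ge0 ?normc_ge0.
  apply: (cintegrable_le _ (measurable_expq 0 (1 + pi * (normc A + normc C)) pi)).
  - by apply: cmeasM; [exact: cmeas_zeta|exact: cmeas_gauss2].
  - move=> q; rewrite [normc (_ * _)]Normc.normcM.
    apply: (le_trans (ler_pM (normc_ge0 _) (normc_ge0 _) (normr_le_expR _) (normc_gauss2_le _ _ _))).
    by rewrite -expRD ler_expR; lra.
  - exact: expq_fin.
transitivity (cint leb2 (fun q => wte p * wte r * (zeta q * gauss2 (zeta p) (conjc (zeta r)) q))).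
  by apply: eq_cint => q; rewrite mulrAC kr_gauss2; ring.
rewrite cintZ//.
rewrite cint_zeta_gauss2 mulrCA; congr (_ * _); rewrite /kr /wte -!cexpD; congr cexp.
by rewrite !rmorphM !rmorphD/=; ring.
Qed.

(** The subtracted term makes the numerator vanish at [a]: with the weights removed it is
    [e^(pi c zeta q) - e^(pi c zeta a)] for [c] the conjugate of [zeta r], so that
    [cint_division_kernel] applies. *)
Lemma cint_kr_div p a r : zeta p != zeta a ->
  cint leb2 (fun q => kr p q * ((kr q r - wte q / wte a * kr a r) / (zeta q - zeta a))) =
  (kr p r - wte p / wte a * kr a r) / (zeta p - zeta a).
Proof.
move=> pa; set c := conjc (zeta r).
have krE q : kr q r = wte q * wte r * cexp (pi%:C * (c * zeta q)).
  rewrite /kr /wte -!cexpD; congr cexp; rewrite /c mulrDr rmorphD/=; ring.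
have aE : kr a r = wte a * wte r * cexp (pi%:C * (c * zeta a)) by exact: krE.
have w0 : wte a != 0 by exact: cexp_neq0.
pose F q := gauss2 (zeta p) 0 q * ((cexp (pi%:C * (c * zeta q)) - cexp (pi%:C * (c * zeta a))) / (zeta q - zeta a)).
transitivity (cint leb2 (fun q => (wte p * wte r) * F q)).
  apply: eq_cint => q; rewrite krE aE /F.
  have -> : kr p q = wte p * (wte q)^-1 * gauss2 (zeta p) 0 q.
    rewrite /wte -cexpN /kr /gauss2 -!cexpD; congr cexp.
    by rewrite mulc_conj !rmorphM !rmorphD/=; field.
  have wq0 : wte q != 0 by exact: cexp_neq0.
  set g := gauss2 _ _ _; set d := (zeta q - zeta a)^-1.
  set X := cexp (pi%:C * (c * zeta q)); set Y := cexp _.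
  have -> : wte q / wte a * (wte a * wte r * Y) = wte q * wte r * Y by field.
  have -> : wte p / wte q * g * ((wte q * wte r * X - wte q * wte r * Y) * d) =
     (wte q / wte q) * (wte p * wte r * (g * ((X - Y) * d))) by ring.
  by rewrite divff// mul1r.
rewrite cintZ; last exact: cintegrable_division_kernel.
rewrite cint_division_kernel// krE aE.
set X := cexp (pi%:C * (c * zeta p)); set Y := cexp _; set d := (zeta p - zeta a)^-1.
have -> : wte p / wte a * (wte a * wte r * Y) = wte p * wte r * Y by field.
by ring.
Qed.

Definition wt p : R := 1 + normc (zeta p).

Lemma wt_ge1 p : 1 <= wt p. Proof. by rewrite lerDl normc_ge0. Qed.
Lemma wt_gt0 p : 0 < wt p. Proof. by rewrite (lt_le_trans ltr01)// wt_ge1. Qed.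
Lemma wt_ge0 p : 0 <= wt p. Proof. exact: ltW (wt_gt0 p). Qed.

Lemma measurable_wt : measurable_fun setT wt.
Proof. by apply: measurable_funD => //; exact: (measurable_normc cmeas_zeta). Qed.

(** Transfers the weight from [q] to [p] at a cost depending on their distance only, which the
    Gaussian decay of [kr] absorbs. *)
Lemma wt_le p q : wt q <= wt p * (1 + normc (zeta q - zeta p)).
Proof.
have h : normc (zeta q) <= normc (zeta q - zeta p) + normc (zeta p).
  by rewrite -[X in normc X <= _](subrK (zeta p)) ler_normcD.
have := normc_ge0 (zeta q - zeta p); have := normc_ge0 (zeta p).
rewrite /wt; nra.
Qed.

(** As [pi >= 2], the exponent can give up [3 / 4 * x ^+ 2] to dominate the polynomial and still
    keep [1 / 4 * x ^+ 2]. *)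
Lemma sqr_linear_gauss (x : R) : 0 <= x ->
  (1 + x) ^+ 2 * expR (- (pi / 2 * x ^+ 2)) <= 9 * expR (- (1 / 4 * x ^+ 2)).
Proof.
move=> x0.
have h : (1 + x) ^+ 2 <= 9 * expR (3 / 4 * x ^+ 2).
  have := expR_ge1Dx (3 / 4 * x ^+ 2).
  have : (x - 1) ^+ 2 >= 0 by exact: sqr_ge0.
  rewrite !expr2; nra.
apply: (le_trans (ler_wpM2r (expR_ge0 _) h)).
rewrite -[leLHS]mulrA -expRD ler_wpM2l// ler_expR.
have := pi_ge2 R; have := sqr_ge0 x; nra.
Qed.

Lemma kr_wt2_le p q : normc (kr p q) * wt q ^+ 2 <= wt p ^+ 2 * (9 * gw (1 / 4) p q).
Proof.
have h := sqr_linear_gauss (normc_ge0 (zeta q - zeta p)).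
rewrite normc_kr /gw.
have w2 : wt q ^+ 2 <= wt p ^+ 2 * (1 + normc (zeta q - zeta p)) ^+ 2.
  rewrite -exprMn lerXn2r ?nnegrE ?wt_ge0 ?wt_le// mulr_ge0 ?wt_ge0//.
  by rewrite addr_ge0// normc_ge0.
apply: (le_trans (ler_wpM2l (expR_ge0 _) w2)).
by rewrite mulrCA ler_wpM2l ?sqr_ge0// mulrC.
Qed.

Lemma kr_wt_le p q : normc (kr p q) * wt q <= wt p * (9 * gw (1 / 4) p q).
Proof.
have h := sqr_linear_gauss (normc_ge0 (zeta q - zeta p)).
rewrite normc_kr /gw.
apply: (le_trans (ler_wpM2l (expR_ge0 _) (wt_le p q))).
rewrite mulrCA ler_wpM2l ?wt_ge0//; apply: le_trans h; rewrite mulrC ler_wpM2r ?expR_ge0//.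
by have := normc_ge0 (zeta q - zeta p); rewrite expr2; nra.
Qed.

Lemma measurable_krl p : measurable_fun setT (fun q => normc (kr p q)).
Proof. exact: measurable_normc (cmeas_krl p). Qed.

Lemma nint_kr_wt2 p : (\int[leb2]_q (normc (kr p q) * wt q ^+ 2)%:E <=
   (wt p ^+ 2 * (36 * pi))%:E)%E.
Proof.
apply: (@le_trans _ _ (\int[leb2]_q (wt p ^+ 2 * (9 * gw (1 / 4) p q))%:E)%E).
  apply: le_nint.
  - apply: measurable_funM; first exact: measurable_krl.
    by apply: measurable_funX; exact: measurable_wt.
  - by apply: measurable_funM => //; apply: measurable_funM => //; exact: measurable_gw.
  - by move=> q; rewrite mulr_ge0 ?normc_ge0// sqr_ge0.
  - exact: kr_wt2_le.
rewrite nintZ ?sqr_ge0//; last 2 first.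
- by apply: measurable_funM => //; exact: measurable_gw.
- by move=> q; rewrite mulr_ge0// gw_ge0.
rewrite nintZ//; last 2 first.
- exact: measurable_gw.
- by move=> q; exact: gw_ge0.
by rewrite nint_gw ?divr_gt0// -!EFinM lee_fin le_eqVlt; apply/orP; left; apply/eqP; field.
Qed.

(* [inH] is the Fock space, weighted; the reproducing formula stands for
   holomorphy. [inE] is the larger space which multiplication by [zeta] maps to. *)
Definition wL2 Phi := (\int[leb2]_q ((normc (Phi q) / wt q) ^+ 2)%:E < +oo)%E.
Definition sqint Phi := (\int[leb2]_q (normc (Phi q) ^+ 2)%:E < +oo)%E.
Definition reproduced Phi := forall p, Phi p = cint leb2 (fun q => kr p q * Phi q).
Definition inE Phi := [/\ cmeas Phi, wL2 Phi & reproduced Phi].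
Definition inH Phi := [/\ cmeas Phi, sqint Phi & reproduced Phi].

Lemma measurable_wsqr Phi : cmeas Phi -> measurable_fun setT (fun q => (normc (Phi q) / wt q) ^+ 2).
Proof.
move=> mP; apply: measurable_funX; apply: measurable_funM; first exact: measurable_normc.
by apply: measurable_funV; [exact: measurable_wt|exact: wt_ge0].
Qed.

Lemma sqint_wL2 Phi : cmeas Phi -> sqint Phi -> wL2 Phi.
Proof.
move=> mP; apply: le_lt_trans; apply: le_nint.
- exact: measurable_wsqr.
- exact: measurable_sqr_normc.
- by move=> q; rewrite sqr_ge0.
- move=> q; rewrite lerXn2r ?nnegrE ?divr_ge0 ?normc_ge0 ?wt_ge0//.
  by rewrite ler_pdivrMr ?wt_gt0// ler_peMr ?normc_ge0// wt_ge1.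
Qed.

Lemma inH_inE Phi : inH Phi -> inE Phi.
Proof. by move=> [mP sP rP]; split => //; exact: sqint_wL2. Qed.

(** A weighted mean inequality with parameter [wt p] balances the two integrals: the norm of [Phi]
    contributes [wt p * W / 2] and [nint_kr_wt2] contributes [wt p * (36 * pi) / 2]. *)
Lemma kr_integral_le Phi : cmeas Phi -> wL2 Phi -> exists2 C : R, 0 <= C &
  forall p, (\int[leb2]_q (normc (kr p q) * normc (Phi q))%:E <= (C * wt p)%:E)%E.
Proof.
move=> mP wP.
have [W W0 WE] := nint_fin (fun q => sqr_ge0 (normc (Phi q) / wt q)) wP.
exists ((W + 36 * pi) / 2); first by rewrite divr_ge0// addr_ge0// mulr_ge0// ltW.
move=> p.
have mA := measurable_wsqr mP.
have mB : measurable_fun setT (fun q => normc (kr p q) * wt q ^+ 2).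
  by apply: measurable_funM; [exact: measurable_krl|apply: measurable_funX; exact: measurable_wt].
have B0 q : 0 <= normc (kr p q) * wt q ^+ 2 by rewrite mulr_ge0 ?normc_ge0 ?sqr_ge0.
have wp := wt_gt0 p.
have c1 : 0 <= wt p / 2 by rewrite divr_ge0// ltW.
have c2 : 0 <= (2 * wt p)^-1 by rewrite invr_ge0 mulr_ge0// ltW.
have mf : measurable_fun setT (fun q => normc (kr p q) * normc (Phi q)).
  by apply: measurable_funM; [exact: measurable_krl|exact: measurable_normc].
apply: (le_trans (le_nint_lin leb2 mf mA mB _ (fun q => sqr_ge0 _) B0 c1 c2 _)).
- by move=> q; rewrite mulr_ge0 ?normc_ge0.
- move=> q; set x := normc (Phi q) / wt q; set k := normc (kr p q).
  have -> : normc (Phi q) = x * wt q by rewrite /x divfK// gt_eqF// wt_gt0.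
  have k0 : 0 <= k by exact: normc_ge0.
  have h : k ^+ 2 <= k by rewrite expr2 ler_piMr// normc_kr_le1.
  apply: (@le_trans _ _ (wt p / 2 * x ^+ 2 + (2 * wt p)^-1 * (k ^+ 2 * wt q ^+ 2))).
    rewrite -subr_ge0.
    have -> : wt p / 2 * x ^+ 2 + (2 * wt p)^-1 * (k ^+ 2 * wt q ^+ 2) - k * (x * wt q) =
       (2 * wt p)^-1 * (wt p * x - k * wt q) ^+ 2 by field; rewrite gt_eqF.
    by rewrite mulr_ge0 ?sqr_ge0.
  by rewrite lerD2l ler_wpM2l// ler_wpM2r// sqr_ge0.
rewrite WE -EFinM.
apply: (@le_trans _ _ ((wt p / 2 * W)%:E + ((2 * wt p)^-1 * (wt p ^+ 2 * (36 * pi)))%:E)%E).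
  by rewrite leeD2l// EFinM lee_wpmul2l ?lee_fin// nint_kr_wt2.
by rewrite -EFinD lee_fin le_eqVlt; apply/orP; left; apply/eqP; field; rewrite gt_eqF.
Qed.

Lemma kr_integrable Phi p : inE Phi -> cintegrable leb2 (fun q => kr p q * Phi q).
Proof.
move=> [mP wP rP]; have [C C0 hC] := kr_integral_le mP wP.
split; first by apply: cmeasM => //; exact: cmeas_krl.
under eq_integral do rewrite Normc.normcM.
by apply: le_lt_trans (hC p) _; rewrite ltry.
Qed.

Lemma inE_bound Phi : inE Phi -> exists2 C : R, 0 <= C & forall p, normc (Phi p) <= C * wt p.
Proof.
move=> [mP wP rP]; have [C C0 hC] := kr_integral_le mP wP.
exists C => // p; rewrite -lee_fin; apply: le_trans (hC p).
rewrite rP; apply: (le_trans (normc_cint_le (kr_integrable p _))); first by [].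
by under eq_integral do rewrite Normc.normcM.
Qed.

Lemma inH_csq Phi : inH Phi -> csq leb2 Phi.
Proof. by case. Qed.

Lemma sqnE_krr_le r : (sqnE leb2 (fun q => kr q r) <= 2%:E)%E.
Proof.
have <- : (\int[leb2]_q (gw (pi / 2) r q)%:E = 2%:E)%E.
  by rewrite nint_gw ?divr_gt0// invf_div mulrCA divff ?mulr1// gt_eqF.
apply: le_nint.
- by apply: measurable_sqr_normc; exact: cmeas_krr.
- exact: measurable_gw.
- by move=> q; exact: sqr_ge0.
- by move=> q; rewrite -conj_kr normc_conj -normc_kr expr2 ler_piMl ?normc_ge0// normc_kr_le1.
Qed.

Lemma csq_krr r : csq leb2 (fun q => kr q r).
Proof.
split; first exact: cmeas_krr.
by apply: (le_lt_trans (sqnE_krr_le r)); rewrite ltry.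
Qed.

Lemma inH_krr r : inH (fun q => kr q r).
Proof. by have [m s] := csq_krr r; split => // p; rewrite cint_kr_kr. Qed.

Lemma ip_krr (Phi : P -> R[i]) r : inH Phi -> ip leb2 Phi (fun q => kr q r) = Phi r.
Proof.
move=> [mP sP rP]; rewrite [RHS]rP; apply: eq_cint => q.
by rewrite conj_kr mulrC.
Qed.

Lemma inH_bound Phi : inH Phi -> exists2 C : R, 0 <= C & forall p, normc (Phi p) <= C.
Proof.
(* Cauchy-Schwarz against the kernel gives [2 * N] for the square, [N] being the squared norm of
   [Phi]; as [2 * N <= (N + 1) ^+ 2], no square root is needed. *)
move=> HP; have N0 := sqn_ge0 leb2 Phi; exists (sqn leb2 Phi + 1); first by rewrite addr_ge0.
move=> p; have := cauchy_schwarz (inH_csq HP) (csq_krr p); rewrite ip_krr// => h.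
rewrite -(@ler_pXn2r _ 2)// ?nnegrE ?normc_ge0 ?addr_ge0//; apply: (le_trans h).
have k2 : sqn leb2 (fun q => kr q p) <= 2.
  by rewrite -lee_fin -sqnE_fin ?sqnE_krr_le//; exact: csq_krr.
apply: (le_trans (ler_wpM2l N0 k2)); have := sqr_ge0 (sqn leb2 Phi - 1).
by rewrite sqrrB sqrrD; have := sqr_ge0 (sqn leb2 Phi); lra.
Qed.

(** The reproducing formula is inserted for [Phi] and the integrals are exchanged. An integral
    against an arbitrary [Phi] is thereby determined by integrals against kernels, which are
    explicit. *)
Lemma cint_reproduced (kap : P -> R[i]) Phi : inE Phi -> cmeas kap ->
  (\int[leb2]_q (normc (kap q) * wt q)%:E < +oo)%E ->
  cint leb2 (fun q => kap q * Phi q) =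
  cint leb2 (fun r => cint leb2 (fun q => kap q * kr q r) * Phi r).
Proof.
move=> [mP wP rP] mk koo; have [C C0 hC] := kr_integral_le mP wP.
have mkP : cmeas (fun qr : P * P => kr qr.1 qr.2 * Phi qr.2).
  by apply: cmeasM; [exact: cmeas_kr2|exact: (cmeas_comp mP measurable_snd)].
have mF : cmeas (fun qr : P * P => kap qr.1 * (kr qr.1 qr.2 * Phi qr.2)).
  by apply: cmeasM => //; exact: (cmeas_comp mk measurable_fst).
have kPi q : cintegrable leb2 (fun r => kr q r * Phi r).
  split; first by apply: cmeasM => //; exact: cmeas_krl.
  under eq_integral do rewrite Normc.normcM.
  by apply: le_lt_trans (hC q) _; rewrite ltry.
have Foo : (\int[leb2]_q \int[leb2]_r (normc (kap q * (kr q r * Phi r)))%:E < +oo)%E.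
  apply: (@le_lt_trans _ _ (\int[leb2]_q (C * (normc (kap q) * wt q))%:E)%E).
    apply: ge0_le_integral => //.
    - by move=> q _; apply: nint_ge0 => r; exact: normc_ge0.
    - exact: (measurable_nint leb2 (measurable_normc mF) (fun x => normc_ge0 _)).
    - apply/measurable_EFinP; apply: measurable_funM => //; apply: measurable_funM.
        exact: measurable_normc.
      exact: measurable_wt.
    - move=> q _; under eq_integral do rewrite Normc.normcM.
      rewrite nintZ ?normc_ge0//; last 2 first.
      + exact: measurable_normc (kPi q).1.
      + by move=> r; exact: normc_ge0.
      rewrite mulrCA EFinM lee_wpmul2l ?lee_fin ?normc_ge0//.
      by under eq_integral do rewrite Normc.normcM.
  apply: nintZ_fin => //.
  - by apply: measurable_funM; [exact: measurable_normc|exact: measurable_wt].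
  - by move=> q; rewrite mulr_ge0 ?normc_ge0 ?wt_ge0.
transitivity (cint leb2 (fun q => cint leb2 (fun r => kap q * (kr q r * Phi r)))).
  by apply: eq_cint => q; rewrite cintZ -?rP.
rewrite (cint_swap mF Foo); apply: eq_cint => r /=.
rewrite -cintZr; last first.
  apply: (@cintegrable_le _ _ _ _ _ (fun q => normc (kap q) * wt q)) => //.
  - by apply: cmeasM => //; exact: cmeas_krr.
  - by apply: measurable_funM; [exact: measurable_normc|exact: measurable_wt].
  - move=> q; rewrite Normc.normcM ler_wpM2l ?normc_ge0//.
    by rewrite (le_trans (normc_kr_le1 _ _))// wt_ge1.
by apply: eq_cint => q; rewrite mulrA.
Qed.

Lemma nint_kr_wt_fin p : (\int[leb2]_q (normc (kr p q) * wt q ^+ 2)%:E < +oo)%E.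
Proof. by apply: le_lt_trans (nint_kr_wt2 p) _; rewrite ltry. Qed.

(** [cint_reproduced] carries [cint_kr_zeta_kr] over from the kernels to [g]; the factor
    [zeta q - a] is paid for by the weight [wt]. *)
Lemma inE_mulz g (a : R[i]) : inH g -> inE (fun q => (zeta q - a) * g q).
Proof.
move=> Hg; have Eg := inH_inE Hg; case: (Hg) => mg sg rg.
have mz : cmeas (fun q : P => zeta q - a).
  by apply: cmeasB; [exact: cmeas_zeta|exact: cmeas_cst].
split.
- exact: cmeasM.
- rewrite /wL2; apply: (@le_lt_trans _ _ (\int[leb2]_q ((1 + normc a) ^+ 2 * normc (g q) ^+ 2)%:E)%E).
    apply: le_nint.
    + by apply: measurable_wsqr; exact: cmeasM.
    + by apply: measurable_funM => //; exact: measurable_sqr_normc.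
    + by move=> q; exact: sqr_ge0.
    + move=> q; rewrite -exprMn.
      have a0 : 0 <= normc ((zeta q - a) * g q) / wt q by rewrite divr_ge0 ?normc_ge0 ?wt_ge0.
      have b0 : 0 <= (1 + normc a) * normc (g q).
        by rewrite mulr_ge0 ?normc_ge0// addr_ge0// normc_ge0.
      rewrite lerXn2r ?nnegrE// ler_pdivrMr ?wt_gt0// Normc.normcM mulrAC ler_wpM2r ?normc_ge0//.
      rewrite (le_trans (ler_normcB _ _))// /wt.
      have := normc_ge0 (zeta q); have := normc_ge0 a; nra.
  apply: nintZ_fin => //; [exact: measurable_sqr_normc|by move=> q; exact: sqr_ge0|exact: sqr_ge0].
- move=> p.
  have mk : cmeas (fun q => kr p q * zeta q).
    by apply: cmeasM; [exact: cmeas_krl|exact: cmeas_zeta].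
  have koo : (\int[leb2]_q (normc (kr p q * zeta q) * wt q)%:E < +oo)%E.
    apply: le_lt_trans (nint_kr_wt_fin p); apply: le_nint.
    + by apply: measurable_funM; [exact: measurable_normc|exact: measurable_wt].
    + apply: measurable_funM; first exact: measurable_krl.
      by apply: measurable_funX; exact: measurable_wt.
    + by move=> q; rewrite mulr_ge0 ?normc_ge0 ?wt_ge0.
    + move=> q; rewrite Normc.normcM -mulrA ler_wpM2l ?normc_ge0// expr2.
      by rewrite ler_wpM2r ?wt_ge0// lerDr.
  have k1 : cint leb2 (fun q => kr p q * zeta q * g q) = zeta p * g p.
    rewrite (cint_reproduced Eg mk koo) [in RHS]rg -cintZ.
      by apply: eq_cint => r; rewrite cint_kr_zeta_kr mulrA.
    exact: kr_integrable.
  have gi := kr_integrable p Eg.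
  have zi : cintegrable leb2 (fun q => kr p q * zeta q * g q).
    have [C C0 hC] := inH_bound Hg.
    apply: (@cintegrable_le _ _ _ _ _ (fun q => C * (normc (kr p q) * wt q ^+ 2))).
    + exact: cmeasM.
    + apply: measurable_funM => //; apply: measurable_funM; first exact: measurable_krl.
      by apply: measurable_funX; exact: measurable_wt.
    + move=> q; rewrite [normc (_ * g q)]Normc.normcM [normc (kr p q * _)]Normc.normcM mulrC.
      apply: ler_pM; rewrite ?normc_ge0 ?mulr_ge0 ?normc_ge0//.
      apply: ler_wpM2l; first exact: normc_ge0.
      have := normc_ge0 (zeta q); rewrite /wt expr2; nra.
    + apply: nintZ_fin; [| |exact: C0|exact: nint_kr_wt_fin].
      * apply: measurable_funM; first exact: measurable_krl.
        by apply: measurable_funX; exact: measurable_wt.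
      * by move=> q; rewrite mulr_ge0 ?normc_ge0 ?sqr_ge0.
  rewrite mulrBl -k1 [in a * _]rg -cintZ// -cintB//.
  + by apply: eq_cint => q; ring.
  + exact: cintegrableZ.
Qed.

(** [ck_integral_le] with radius 1. Since [Phi] grows at most linearly, [kr_wt_le] bounds the
    density by [9 * C2 * wt p], whence [144 = 16 * 9]. *)
Lemma kr_ck_bound Phi a : inE Phi -> exists2 C : R, 0 <= C & forall p,
  (\int[leb2]_q (normc (kr p q) * normc (Phi q) * ck a q)%:E <= (C * wt p)%:E)%E.
Proof.
move=> EP; case: (EP) => mP wP rP.
have [C1 C10 hC1] := kr_integral_le mP wP.
have [C2 C20 hC2] := inE_bound EP.
exists (144 * C2 + C1); first exact: addr_ge0 (mulr_ge0 (ler0n _ _) C20) C10.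
move=> p.
have := @ck_integral_le _ (fun q => normc (kr p q) * normc (Phi q)) (9 * C2 * wt p) (C1 * wt p) 1 a _ _ (hC1 p) ltr01.
rewrite (_ : 16 * 1 * _ + _ / 1 = (144 * C2 + C1) * wt p); last by field.
apply.
- by apply: measurable_funM; [exact: measurable_krl|exact: measurable_normc].
- move=> q; rewrite mulr_ge0 ?normc_ge0//=.
  apply: (le_trans (ler_wpM2l (normc_ge0 _) (hC2 q))).
  rewrite mulrCA (_ : 9 * C2 * wt p = C2 * (9 * wt p)); last by ring.
  rewrite ler_wpM2l//; apply: (le_trans (kr_wt_le p q)); rewrite mulrCA ler_wpM2l//.
  by rewrite ler_piMr ?wt_ge0// /gw -expR0 ler_expR oppr_le0 mulr_ge0// sqr_ge0.
Qed.

(** Against the kernels, [kap] yields by [cint_kr_div] a multiple of [kr p r] and a multiple of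
    [kr a r]. Integrated against [Phi] these become multiples of [Phi p] and of [Phi a], and the
    latter is 0. *)
Lemma rep_div Phi a p : inE Phi -> Phi a = 0 -> zeta p != zeta a ->
  cint leb2 (fun q => kr p q * (Phi q / (zeta q - zeta a))) = Phi p / (zeta p - zeta a).
Proof.
move=> EP Pa pa; case: (EP) => mP wP rP.
pose kap q := kr p q / (zeta q - zeta a).
have md : cmeas (fun q : P => zeta q - zeta a).
  by apply: cmeasB; [exact: cmeas_zeta|exact: cmeas_cst].
have mk : cmeas kap by apply: cmeas_div => //; exact: cmeas_krl.
have mw : measurable_fun setT (fun q => normc (kr p q) * wt q).
  by apply: measurable_funM; [exact: measurable_krl|exact: measurable_wt].
have krw q : 0 <= normc (kr p q) * wt q <= 9 * wt p.
  rewrite mulr_ge0 ?normc_ge0 ?wt_ge0//=.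
  apply: (le_trans (kr_wt_le p q)); rewrite mulrCA ler_wpM2l//.
  by rewrite ler_piMr ?wt_ge0// /gw -expR0 ler_expR oppr_le0 mulr_ge0// sqr_ge0.
have kwoo : (\int[leb2]_q (normc (kr p q) * wt q)%:E <= (wt p ^+ 2 * (36 * pi))%:E)%E.
  apply: le_trans (nint_kr_wt2 p); apply: le_nint => //.
  - apply: measurable_funM; first exact: measurable_krl.
    by apply: measurable_funX; exact: measurable_wt.
  - by move=> q; have /andP[] := krw q.
  - by move=> q; rewrite ler_wpM2l ?normc_ge0// expr2 ler_peMr ?wt_ge0// wt_ge1.
have koo : (\int[leb2]_q (normc (kap q) * wt q)%:E < +oo)%E.
  have := ck_integral_le a mw krw kwoo ltr01.
  move=> /le_lt_trans/(_ (ltry _)); apply: le_lt_trans.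
  rewrite le_eqVlt; apply/orP; left; apply/eqP; apply: eq_integral => q _.
  by rewrite /kap normc_div /ck mulrAC.
have kapi : cintegrable leb2 kap.
  apply: (@cintegrable_le _ _ _ _ _ (fun q => normc (kap q) * wt q)) => //.
  - by apply: measurable_funM; [exact: measurable_normc|exact: measurable_wt].
  - by move=> q; rewrite ler_peMr ?normc_ge0// wt_ge1.
have kapkr r : cintegrable leb2 (fun q => kap q * kr q r).
  apply: (@cintegrable_le _ _ _ _ _ (fun q => normc (kap q))); last exact: kapi.2.
  - by apply: cmeasM; [exact: mk|exact: cmeas_krr].
  - exact: measurable_normc.
  - by move=> q; rewrite Normc.normcM ler_piMr ?normc_ge0// normc_kr_le1.
have kapw : cintegrable leb2 (fun q => kap q * wte q).
  apply: (@cintegrable_le _ _ _ _ _ (fun q => normc (kap q))); last exact: kapi.2.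
  - by apply: cmeasM; [exact: mk|exact: cmeas_wte].
  - exact: measurable_normc.
  - by move=> q; rewrite Normc.normcM ler_piMr ?normc_ge0// normc_wte_le1.
(* The contribution of the correction subtracted in [cint_kr_div]. Its value is irrelevant, as it
   multiplies [kr a r] only. *)
pose m := cint leb2 (fun q => kap q * wte q) / wte a.
have w0 : wte a != 0 by exact: cexp_neq0.
have kE r : cint leb2 (fun q => kap q * kr q r) =
    (kr p r - wte p / wte a * kr a r) / (zeta p - zeta a) + m * kr a r.
  rewrite -cint_kr_div// /m -mulrA -cintZr// -cintD.
  - apply: eq_cint => q; rewrite /kap.
    by set d := (zeta q - zeta a)^-1; ring.
  - rewrite (_ : (fun q => _) = (fun q => kap q * kr q r - (kr a r / wte a) * (kap q * wte q))).
      exact: cintegrableB (kapkr r) (cintegrableZ _ kapw).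
    by apply/funext => q; rewrite /kap; ring.
  - by under eq_fun do rewrite mulrC; exact: cintegrableZ.
transitivity (cint leb2 (fun q => kap q * Phi q)).
  by apply: eq_cint => q; rewrite /kap; ring.
rewrite (cint_reproduced EP mk koo).
have i1 := kr_integrable p EP; have i2 := kr_integrable a EP.
transitivity (cint leb2 (fun r => (zeta p - zeta a)^-1 * (kr p r * Phi r) +
   (m - wte p / wte a / (zeta p - zeta a)) * (kr a r * Phi r))).
  by apply: eq_cint => r; rewrite kE; set d := (zeta p - zeta a)^-1; ring.
rewrite (cintD (cintegrableZ _ i1) (cintegrableZ _ i2)) (cintZ _ i1) (cintZ _ i2).
by rewrite -!rP Pa mulr0 addr0 mulrC.
Qed.

Lemma inE_div Phi a : inE Phi -> Phi a = 0 ->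
  exists2 Psi, inH Psi & forall q, Phi q = (zeta q - zeta a) * Psi q.
Proof.
move=> EP Pa; case: (EP) => mP wP rP.
(* Defined by the integral, so that the value at [a] is the right one too. Elsewhere it is the
   quotient by [rep_div], and equality almost everywhere makes [Psi] reproduced. *)
pose Psi p := cint leb2 (fun q => kr p q * (Phi q / (zeta q - zeta a))).
have PsiE p : zeta p != zeta a -> Psi p = Phi p / (zeta p - zeta a) by exact: rep_div.
have md : cmeas (fun q : P => zeta q - zeta a).
  by apply: cmeasB; [exact: cmeas_zeta|exact: cmeas_cst].
have mPd : cmeas (fun q => Phi q / (zeta q - zeta a)) by exact: cmeas_div.
have mPsi : cmeas Psi.
  apply: (@cmeas_cint _ _ _ _ _ leb2 (fun pq : P * P => kr pq.1 pq.2 * (Phi pq.2 / (zeta pq.2 - zeta a)))).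
  by apply: cmeasM; [exact: cmeas_kr2|exact: (cmeas_comp mPd measurable_snd)].
exists Psi; last first.
  move=> q; have [qa|qa] := eqVneq (zeta q) (zeta a).
    by rewrite qa subrr mul0r -Pa; congr Phi; exact: zeta_inj.
  by rewrite PsiE// mulrC divfK// subr_eq0.
have rPsi : reproduced Psi.
  move=> p; rewrite {1}/Psi; apply: ae_eq_cint.
  - by apply: cmeasM => //; exact: cmeas_krl.
  - by apply: cmeasM => //; exact: cmeas_krl.
  - by apply: filterS (ae_zeta_neq (zeta a)) => q qa; rewrite PsiE.
split => //.
have [C C0 hC] := kr_ck_bound a EP.
have bd p : normc (Psi p) <= C * wt p.
  rewrite -lee_fin; apply: (le_trans _ (hC p)).
  have E q : normc (kr p q * (Phi q / (zeta q - zeta a))) = normc (kr p q) * normc (Phi q) * ck a q.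
    by rewrite Normc.normcM normc_div mulrA.
  apply: (le_trans (normc_cint_le _)).
    split; first by apply: cmeasM => //; exact: cmeas_krl.
    under eq_integral do rewrite E.
    by apply: le_lt_trans (hC p) _; rewrite ltry.
  by under eq_integral do rewrite E.
(* In the box of radius 1 about [a], [wt q <= wt a * 3] because the distance is less than 2.
   Outside, the distance is at least 1, so that [wt q] is at most [wt a * 2] times it, which
   explains [N]. *)
pose M := (C * (wt a * 3)) ^+ 2.
pose N := (wt a * 2) ^+ 2.
have hN : 0 <= N by exact: sqr_ge0.
have mb : measurable_fun setT (fun q : P => \1_(box a 1) q : R).
  by apply: measurable_indic; exact: measurable_box.
have mws := measurable_wsqr mP.
apply: (@le_nint_lin_fin _ _ _ _ M N _ (\1_(box a 1)) (fun q => (normc (Phi q) / wt q) ^+ 2)) => //.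
  - exact: measurable_sqr_normc.
  - by move=> q; exact: sqr_ge0.
  - by move=> q; exact: sqr_ge0.
  - exact: sqr_ge0.
  - move=> q; rewrite indicE; case: (boolP (q \in box a 1)) => qa.
      have hM : M <= M * true%:R + N * (normc (Phi q) / wt q) ^+ 2.
        by rewrite mulr1 lerDl; exact: mulr_ge0 hN (sqr_ge0 _).
      apply: le_trans hM.
      rewrite /M lerXn2r ?nnegrE ?normc_ge0 ?mulr_ge0 ?wt_ge0//.
      apply: (le_trans (bd q)); rewrite ler_wpM2l//.
      apply: (le_trans (wt_le a q)); rewrite ler_wpM2l ?wt_ge0//.
      move: qa; rewrite mem_box => /andP[q1 q2].
      have := ler_normc_ReIm (zeta q - zeta a).
      have -> : complex.Im (zeta q - zeta a) = - ((q.2 : R) - a.2) by rewrite /=; ring.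
      rewrite normrN (_ : complex.Re (zeta q - zeta a) = (q.1 : R) - a.1)//; lra.
    rewrite mulr0 add0r /N -exprMn.
    have qz : zeta q != zeta a.
      apply/eqP => /zeta_inj qa1; move: qa; rewrite qa1 mem_box !subrr normr0 ltr01//.
    have n0 : 0 < normc (zeta q - zeta a) by rewrite normc_gt0 subr_eq0.
    have a0 : 0 <= wt a * 2 * (normc (Phi q) / wt q).
      by rewrite !mulr_ge0 ?wt_ge0 ?invr_ge0 ?wt_ge0 ?normc_ge0.
    rewrite lerXn2r ?nnegrE ?normc_ge0// PsiE// normc_div.
    rewrite ler_pdivrMr// -mulrA mulrCA -mulrA ler_peMr ?normc_ge0//.
    rewrite mulrC ler_pdivlMr ?wt_gt0// mul1r.
    apply: (le_trans (wt_le a q)).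
    have d1 : 1 <= normc (zeta q - zeta a).
      by have := notin_box_le ltr01 qa; rewrite /ck invr1 invf_le1.
    have := wt_ge0 a; nra.
- rewrite integral_indic//; last exact: measurable_box.
  rewrite setIT (_ : _ (box a 1) = (4 * 1 ^+ 2)%:E) ?ltry//; exact: leb2_box.
Qed.

Lemma inE_D Phi Psi : inE Phi -> inE Psi -> inE (fun q => Phi q + Psi q).
Proof.
move=> EP EQ; case: (EP) => mP wP rP; case: (EQ) => mQ wQ rQ; split.
- exact: cmeasD.
- apply: (@le_nint_lin_fin _ _ _ _ 2 2 _ (fun q => (normc (Phi q) / wt q) ^+ 2)
    (fun q => (normc (Psi q) / wt q) ^+ 2)) => //.
  + by apply: measurable_wsqr; exact: cmeasD.
  + exact: measurable_wsqr.
  + exact: measurable_wsqr.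
  + by move=> q; exact: sqr_ge0.
  + by move=> q; exact: sqr_ge0.
  + by move=> q; exact: sqr_ge0.
  + move=> q; rewrite !expr_div_n !mulrA -mulrDl ler_wpM2r ?invr_ge0 ?sqr_ge0//.
    have h := ler_normcD (Phi q) (Psi q).
    have := sqr_ge0 (normc (Phi q) - normc (Psi q)).
    have : normc (Phi q + Psi q) ^+ 2 <= (normc (Phi q) + normc (Psi q)) ^+ 2.
      by rewrite lerXn2r ?nnegrE ?addr_ge0 ?normc_ge0.
    rewrite sqrrB sqrrD; lra.
- move=> p; rewrite rP rQ -cintD; try exact: kr_integrable.
  by apply: eq_cint => q; rewrite mulrDr.
Qed.

Lemma inE_Z (c : R[i]) Phi : inE Phi -> inE (fun q => c * Phi q).
Proof.
move=> EP; case: (EP) => mP wP rP; split.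
- by apply: cmeasM => //; exact: cmeas_cst.
- rewrite /wL2; under eq_integral do rewrite Normc.normcM -mulrA exprMn.
  by apply: nintZ_fin => //; [exact: measurable_wsqr|move=> q; exact: sqr_ge0|exact: sqr_ge0].
- move=> p; rewrite {1}rP -cintZ; last exact: kr_integrable.
  by apply: eq_cint => q; rewrite mulrCA.
Qed.

Lemma inH_Z (c : R[i]) Phi : inH Phi -> inH (fun q => c * Phi q).
Proof.
move=> HP; have [mE _ rE] := inE_Z c (inH_inE HP); split=> //.
by case: (csqZ c (inH_csq HP)).
Qed.

Lemma inH_D Phi Psi : inH Phi -> inH Psi -> inH (fun q => Phi q + Psi q).
Proof.
move=> HP HQ; have [mE _ rE] := inE_D (inH_inE HP) (inH_inE HQ); split=> //.
by case: (csqD (inH_csq HP) (inH_csq HQ)).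
Qed.

End reproducing_kernel.

(** * The Bargmann transform *)

Section bargmann_transform.
Context {R : realType}.
Local Notation P := (measurableTypeR R * measurableTypeR R)%type.
Local Notation mu := (lebesgue_measure : {measure set (measurableTypeR R) -> \bar R}).
Implicit Types (p q r : P) (f g : measurableTypeR R -> R[i]).

Let p0 : 0 < (pi : R). Proof. exact: pi_gt0. Qed.

Lemma L2norm_sqr (f : R -> R[i]) : (L2norm f `^ 2 = sqnE mu f)%E.
Proof.
rewrite /L2norm poweR_Lnorm//; apply: eq_integral => s _ /=.
by rewrite ger0_norm ?normc_ge0// powR_mulrn ?normc_ge0.
Qed.

Lemma L2_csq (f : R -> R[i]) : L2 f <-> csq mu f.
Proof.
split.
  by move=> [f1 f2 fn]; split=> //; rewrite -L2norm_sqr poweR_lty.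
by move=> [[f1 f2]]; rewrite -L2norm_sqr => fn; split=> //; apply: lty_poweRy fn.
Qed.

Lemma L2norm_lt (f : R -> R[i]) (e : R) : cmeas (f : measurableTypeR R -> R[i]) ->
  (L2norm f < e%:E)%E -> csq mu f /\ sqn mu f < e ^+ 2.
Proof.
move=> mf fe.
have cf : csq mu f.
  by split=> //; rewrite -L2norm_sqr poweR_lty// (lt_trans fe)// ltry.
split=> //; rewrite -lte_fin -sqnE_fin// -L2norm_sqr.
have l0 : (0 <= L2norm f)%E by exact: Lnorm_ge0.
have : L2norm f \is a fin_num by rewrite ge0_fin_numE// (lt_trans fe)// ltry.
move: fe l0; case: (L2norm f) => // l; rewrite lte_fin lee_fin => le l0 _.
by rewrite poweR_EFin lte_fin powR_mulrn// ltrXn2r.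
Qed.

Lemma cmeas_cis d (T : measurableType d) (h : T -> R) : measurable_fun setT h ->
  cmeas (fun x => cis (h x)).
Proof.
move=> mh; apply: cmeas_ReIm.
- by apply: measurableT_comp mh; apply: continuous_measurable_fun; exact: continuous_cos.
- by apply: measurableT_comp mh; apply: continuous_measurable_fun; exact: continuous_sin.
Qed.

Lemma cmeas_tau2 : cmeas (fun ps : P * measurableTypeR R => tau (ps.1 : R * R) (ps.2 : R)).
Proof.
have m1 : measurable_fun setT (fun ps : P * measurableTypeR R => (ps.1.1 : R)).
  exact: (measurableT_comp measurable_fst measurable_fst).
have m2 : measurable_fun setT (fun ps : P * measurableTypeR R => (ps.1.2 : R)).
  exact: (measurableT_comp measurable_snd measurable_fst).
have ms : measurable_fun setT (fun ps : P * measurableTypeR R => (ps.2 : R)).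
  exact: measurable_snd.
apply: cmeasM.
  by apply: cmeas_cis; apply: measurable_funM => //; exact: measurable_funM.
apply: cmeas_real.
apply: (@measurableT_comp _ _ _ _ _ _ (@expR R) _ (fun ps : P * measurableTypeR R => - (pi * ((ps.2 : R) - ps.1.1) ^+ 2))) => //.
apply: measurable_funN; apply: measurable_funM => //.
by apply: measurable_funX; exact: measurable_funB.
Qed.

Lemma cmeas_tau p : cmeas (tau (p : R * R) : measurableTypeR R -> R[i]).
Proof. exact: (cmeas_comp cmeas_tau2 (pair1_measurable p)). Qed.

Lemma normc_tau p s : normc (tau (p : R * R) s) = expR (- (pi * (s - p.1) ^+ 2)).
Proof. by rewrite /tau Normc.normcM normc_cis mul1r normcC ger0_norm// expR_ge0. Qed.

(** The squared norm of each [tau p]. It is also the factor by which [Bf] multiplies inner products,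
    by [ip_Bf]. *)
Definition c0 : R := Num.sqrt (1 / 2).

Lemma c0_gt0 : 0 < c0. Proof. by rewrite sqrtr_gt0 divr_gt0. Qed.

Lemma sqnE_tau p : sqnE mu (tau (p : R * R)) = c0%:E.
Proof.
rewrite /sqnE; under eq_integral => s _ do
  rewrite normc_tau expr2 -expRD -opprD -mulrDl -[pi + pi](mulr_natl pi 2).
rewrite integral_expR_sqr ?mulr_gt0//; congr (Num.sqrt _)%:E.
by rewrite mulrC invfM -mulrA mulVf ?gt_eqF// mulr1 mul1r.
Qed.

Lemma csq_tau p : csq mu (tau (p : R * R)).
Proof. by split; [exact: cmeas_tau|rewrite sqnE_tau ltry]. Qed.

Lemma sqn_tau p : sqn mu (tau (p : R * R)) = c0.
Proof. by rewrite /sqn sqnE_tau. Qed.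

(* As [zeta p = x - i y], [Bf f p] is the Bargmann transform of [f] at [zeta p],
   times the weight [e^(-pi |zeta p|^2 / 2)]. *)
Definition phase p : R[i] := cis (pi * (p.1 : R) * (p.2 : R)).
Definition Bf f p : R[i] := phase p * ip mu f (tau (p : R * R)).

Lemma normc_phase p : normc (phase p) = 1. Proof. exact: normc_cis. Qed.

Lemma phase_neq0 p : phase p != 0.
Proof. by rewrite -normc_eq0 normc_phase oner_eq0. Qed.

(** The product of the two Gaussians is a constant times [gk (2 * pi)] with complex centre [b],
    whose integral is [c0]. The time-frequency shifts thus become the reproducing kernels, up to
    constants. *)
Lemma Bf_tau r p : Bf (tau (r : R * R)) p = c0%:C * phase r * kr p r.
Proof.
pose b := ((r.1 : R) + p.1)%:C / 2 + ((r.2 : R) - p.2)%:C * 'i / 2.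
pose e : R[i] := (2 * pi)%:C * b ^+ 2 - (pi * ((r.1 : R) ^+ 2 + (p.1 : R) ^+ 2))%:C.
have E s : tau (r : R * R) s * conjc (tau (p : R * R) s) = cexp e * gk (2 * pi) b s.
  rewrite /tau conjcM conj_cis conjc_real.
  rewrite !cis_cexp /gaussian -!cexp_real -!cexpD /gk; congr cexp.
  by rewrite /e /b; apply: complexP; case: (r) (p) => [x1 y1] [x y]; rewrite !expr2 /=; field.
have -> : Bf (tau (r : R * R)) p = phase p * (cexp e * c0%:C).
  rewrite /Bf; congr (_ * _).
  transitivity (cint mu (fun s : measurableTypeR R => cexp e * gk (2 * pi) b s)); first by apply: eq_cint => s; exact: E.
  rewrite cintZ; last first.
    by apply: gk_integrable; rewrite mulr_gt0.
  rewrite -/(gint _ _) gint_const ?mulr_gt0//; congr (_ * (Num.sqrt _)%:C).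
  by rewrite mulrC invfM -mulrA mulVf ?gt_eqF// mulr1 mul1r.
have -> : phase p * (cexp e * c0%:C) = c0%:C * (phase p * cexp e) by ring.
rewrite -mulrA; congr (_ * _); rewrite /phase !cis_cexp /kr -!cexpD; congr cexp.
by rewrite !sqr_normc /e /b; apply: complexP; case: (r) (p) => [x1 y1] [x y]; rewrite !expr2 /=; field.
Qed.

Lemma cmeas_Bf f : csq mu f -> cmeas (Bf f).
Proof.
move=> [mf _]; apply: cmeasM.
  apply: cmeas_cis; apply: measurable_funM; last exact: measurable_snd.
  by apply: measurable_funM => //; exact: measurable_fst.
apply: (@cmeas_cint _ _ _ _ _ lebesgue_measure
  (fun ps : P * measurableTypeR R => f ps.2 * conjc (tau (ps.1 : R * R) (ps.2 : R)))).
apply: cmeasM; first exact: (cmeas_comp mf measurable_snd).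
by apply: cmeas_conj; exact: cmeas_tau2.
Qed.

Lemma Bf_D f g p : csq mu f -> csq mu g -> Bf (fun s => f s + g s) p = Bf f p + Bf g p.
Proof. by move=> cf cg; rewrite /Bf ipDl ?mulrDr//; exact: csq_tau. Qed.

Lemma Bf_B f g p : csq mu f -> csq mu g -> Bf (fun s => f s - g s) p = Bf f p - Bf g p.
Proof. by move=> cf cg; rewrite /Bf ipBl ?mulrBr//; exact: csq_tau. Qed.

Lemma Bf_Z (c : R[i]) f p : csq mu f -> Bf (fun s => c * f s) p = c * Bf f p.
Proof. by move=> cf; rewrite /Bf ipZl//; [rewrite mulrCA|exact: csq_tau]. Qed.

Lemma sqr_normc_Bf f p : csq mu f -> normc (Bf f p) ^+ 2 <= sqn mu f * c0.
Proof.
move=> cf; rewrite /Bf Normc.normcM normc_phase mul1r -(sqn_tau p).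
by apply: cauchy_schwarz => //; exact: csq_tau.
Qed.

Lemma inH_Bf_tau r : inH (Bf (tau (r : R * R))).
Proof.
rewrite (_ : Bf _ = fun q => c0%:C * phase r * kr q r); last by apply/funext => q; exact: Bf_tau.
by apply: inH_Z; exact: inH_krr.
Qed.

Lemma ip_Bf_tau (Phi : P -> R[i]) r : inH Phi ->
  ip leb2 Phi (Bf (tau (r : R * R))) = c0%:C * conjc (phase r) * Phi r.
Proof.
move=> HP; rewrite (_ : Bf _ = fun q => c0%:C * phase r * kr q r); last by apply/funext => q; exact: Bf_tau.
rewrite ipZr; [|exact: inH_csq|exact: csq_krr].
by rewrite ip_krr// conjcM conjc_real.
Qed.

End bargmann_transform.

(** * The transform is isometric up to [c0], and Lambda is a uniqueness set *)

Section transform_isometry.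
Context {R : realType}.
Local Notation P := (measurableTypeR R * measurableTypeR R)%type.
Local Notation mu := (lebesgue_measure : {measure set (measurableTypeR R) -> \bar R}).
Implicit Types (p q r : P) (f g : measurableTypeR R -> R[i]).

Let p0 : 0 < (pi : R). Proof. exact: pi_gt0. Qed.

Lemma linear_span_ind (A : set (R -> R[i])) (Q : (R -> R[i]) -> Prop) :
  Q (fun=> 0) -> (forall c v g, A v -> Q g -> Q (fun s => c * v s + g s)) ->
  forall g, linear_span A g -> Q g.
Proof.
move=> Q0 QS g [n [c [v [Av ->]]]]; elim: n c v Av => [|n ih] c v Av.
  by rewrite (_ : (fun s => _) = (fun=> 0))//; apply/funext => s; rewrite big_ord0.
rewrite (_ : (fun s => _) =
  (fun s => c ord0 * v ord0 s + \sum_(i < n) c (lift ord0 i) * v (lift ord0 i) s)); last first.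
  by apply/funext => s; rewrite big_ord_recl.
apply: QS => //; apply: (ih (fun i => c (lift ord0 i)) (fun i => v (lift ord0 i))) => i.
exact: Av.
Qed.

Lemma eq0_of_le (x C : R) : 0 <= x -> (forall e, 0 < e -> x <= C * e) -> x = 0.
Proof.
move=> x0 h; apply/eqP; rewrite eq_le x0 andbT leNgt; apply/negP => xp.
have Cp : 0 < `|C| + 1 by rewrite ltr_wpDl.
have := h (x / (2 * (`|C| + 1))); rewrite divr_gt0 ?mulr_gt0// => /(_ isT).
have : C * (x / (2 * (`|C| + 1))) <= `|C| * (x / (2 * (`|C| + 1))).
  by rewrite ler_wpM2r ?ler_norm// divr_ge0 ?ltW// mulr_gt0.
have -> : `|C| * (x / (2 * (`|C| + 1))) = (`|C| / (`|C| + 1)) * (x / 2).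
  by field; rewrite gt_eqF.
have : `|C| / (`|C| + 1) <= 1 by rewrite ler_pdivrMr// mul1r lerDl.
nra.
Qed.

(** [A + 1] replaces the square root of [A], so that density arguments can be run with squared norms
    only. *)
Lemma sqr_le_mul (x A e : R) : 0 <= x -> 0 <= A -> 0 <= e ->
  x ^+ 2 <= 4 * A * e ^+ 2 -> x <= 2 * (A + 1) * e.
Proof.
move=> x0 A0 e0 h; rewrite -(@ler_pXn2r _ 2)// ?nnegrE//; last by rewrite !mulr_ge0 ?addr_ge0.
apply: (le_trans h); rewrite exprMn ler_wpM2r ?sqr_ge0// expr2; nra.
Qed.

Lemma ler_mul_twice (d a c b e : R) : 0 <= d -> 0 <= c ->
  d <= 2 * a -> c <= 2 * b -> b <= e -> d * c <= 4 * a * e.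
Proof.
move=> d0 c1 da cb be; apply: (@le_trans _ _ ((2 * a) * (2 * e))).
  by apply: ler_pM => //; lra.
by rewrite le_eqVlt; apply/orP; left; apply/eqP; ring.
Qed.

Variable Lam : set (R * R).
Hypothesis complete : complete_system Lam tau.

Local Notation span := (linear_span (tau @` Lam)).

Lemma Bf0 : Bf (fun=> 0 : R[i]) = (fun=> 0) :> (P -> R[i]).
Proof.
apply/funext => p; rewrite /Bf /ip (_ : cint _ _ = 0) ?mulr0//.
by rewrite -[RHS](cint0 mu); apply: eq_cint => s; rewrite mul0r.
Qed.

Lemma inH0 : inH (fun=> 0 : R[i]).
Proof.
have [m s] := @csq0 R _ P leb2; split=> // p.
by rewrite -[LHS](cint0 leb2); apply: eq_cint => q; rewrite mulr0.
Qed.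

Lemma ip_0r d (T : measurableType d) (m : {measure set T -> \bar R}) (h : T -> R[i]) :
  ip m h (fun=> 0) = 0.
Proof.
rewrite -[RHS](cint0 m); apply: eq_cint => s.
by apply: complexP; rewrite /= ?oppr0 !mulr0 ?subr0 ?addr0.
Qed.

(** What holds for the [tau l] by [ip_Bf_tau] and passes to linear combinations. The isometry is
    stated for those [f] with [inH (Bf f)], because that membership is established for all [f] only
    afterwards, by density. *)
Let span_prop (g : R -> R[i]) :=
  [/\ csq mu g, inH (Bf g),
      forall f, csq mu f -> inH (Bf f) -> ip leb2 (Bf f) (Bf g) = c0%:C * ip mu f g &
      forall Phi : P -> R[i], inH Phi -> (forall l : P, Lam (l : R * R) -> Phi l = 0) ->
        ip leb2 Phi (Bf g) = 0].

Lemma span_properties (g : R -> R[i]) : span g -> span_prop g.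
Proof.
apply: (@linear_span_ind _ span_prop) => [|c _ g' [l Ll <-] [cg Hg isog vang]].
  split; first exact: csq0.
  - by rewrite Bf0; exact: inH0.
  - by move=> f _ _; rewrite Bf0 !ip_0r mulr0.
  - by move=> Phi _ _; rewrite Bf0 ip_0r.
have ct := csq_tau (l : P).
have E : Bf (fun s : R => c * tau l s + g' s) = (fun q : P => c * Bf (tau l) q + Bf g' q).
  by apply/funext => q; rewrite Bf_D// ?Bf_Z//; exact: csqZ.
have Ht := inH_Bf_tau (l : P).
split.
- by apply: csqD => //; exact: csqZ.
- by rewrite E; apply: inH_D => //; exact: inH_Z.
- move=> f cf Hf; rewrite E ipDr; [|exact: inH_csq|exact/csqZ/inH_csq|exact: inH_csq].
  rewrite ipZr; [|exact: inH_csq|exact: inH_csq].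
  rewrite ip_Bf_tau// isog// ipDr//; last exact: csqZ.
  rewrite ipZr// mulrDr; congr (_ + _).
  have : conjc (phase (l : P)) * phase (l : P) = 1.
    by rewrite mulrC mulc_conj normc_phase expr1n.
  rewrite /Bf; set i := ip _ _ _ => h.
  transitivity (c0%:C * (conjc c * ((conjc (phase (l : P)) * phase (l : P)) * i))); first by ring.
  by rewrite h mul1r.
- move=> Phi HP vP; rewrite E ipDr; [|exact: inH_csq|exact/csqZ/inH_csq|exact: inH_csq].
  rewrite ipZr; [|exact: inH_csq|exact: inH_csq].
  by rewrite ip_Bf_tau// vang// (vP l Ll) !mulr0 addr0.
Qed.

Lemma span_csq g : span g -> csq mu g. Proof. by case/span_properties. Qed.

Lemma span_dense f (e : R) : csq mu f -> 0 < e ->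
  exists2 g, span g & csq mu (fun s => f s - g s) /\ sqn mu (fun s => f s - g s) < e ^+ 2.
Proof.
move=> cf e0; have [Lf h] := complete (proj2 (L2_csq f) cf).
have [g sg fg] := h e e0; exists g => //.
have mfg : @cmeas R _ (measurableTypeR R) (fun s => f s - g s).
  by apply: cmeasB; [case: cf|case: (span_csq sg)].
exact: (L2norm_lt mfg fg).
Qed.

Lemma c0_le1 : (c0 : R) <= 1.
Proof. by rewrite -sqrtr1 ler_sqrt//; lra. Qed.

Lemma normc_Bf_le f (e : R) p : csq mu f -> 0 <= e -> sqn mu f <= e ^+ 2 -> normc (Bf f p) <= e.
Proof.
move=> cf e0 fe; rewrite -(@ler_pXn2r _ 2)// ?nnegrE ?normc_ge0//.
apply: (le_trans (sqr_normc_Bf p cf)); apply: le_trans fe.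
by rewrite ler_piMr ?sqn_ge0// c0_le1.
Qed.

Lemma sqn_Bf_span g : span g -> sqn leb2 (Bf g) = c0 * sqn mu g.
Proof.
move=> /span_properties[cg Hg iso _].
have := iso g cg Hg; rewrite ip_ff ?ip_ff//; last exact: inH_csq.
by move/(congr1 (@complex.Re R)) => /=; rewrite mul0r subr0.
Qed.

(** Finiteness of this norm has to precede the isometry. Along approximants in the span, on which
    the isometry is known, the transforms converge pointwise and Fatou applies. The factor 2 comes
    from [sqn_le2]. *)
Lemma sqnE_Bf_le f : csq mu f -> (sqnE leb2 (Bf f) <= (2 * sqn mu f)%:E)%E.
Proof.
move=> cf.
suff h (e : R) : 0 < e -> (sqnE leb2 (Bf f) <= (2 * sqn mu f + 2 * e ^+ 2)%:E)%E.
  apply/lee_addgt0Pr => e e0; have := h (Num.sqrt (e / 2)); rewrite sqrtr_gt0 divr_gt0//.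
  rewrite (_ : 2 * Num.sqrt (e / 2) ^+ 2 = e) => [/(_ isT)//|].
  by rewrite sqr_sqrtr; [field|rewrite divr_ge0// (ltW e0)].
move=> e0.
have [g hg] : exists g : nat -> measurableTypeR R -> R[i], forall n,
    [/\ span (g n), csq mu (fun s => f s - g n s) &
        sqn mu (fun s => f s - g n s) < (Num.min e n.+1%:R^-1) ^+ 2].
  have : forall n, exists g : measurableTypeR R -> R[i],
    [/\ span g, csq mu (fun s => f s - g s) & sqn mu (fun s => f s - g s) < (Num.min e n.+1%:R^-1) ^+ 2].
    (* The bound by [e] keeps the norms of all approximants under control; the bound by [n.+1%:R^-1]
       gives the pointwise convergence. *)
    move=> n; have m0 : 0 < Num.min e n.+1%:R^-1 by rewrite lt_min e0 invr_gt0 ltr0n.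
    by have [g sg [cg fg]] := span_dense cf m0; exists g.
  move=> H; have [g Hg] := choice H; exists g; exact: Hg.
apply: (@nint_fatou _ _ _ leb2 (fun n p => normc (Bf (g n) p) ^+ 2)).
- move=> n; apply: measurable_sqr_normc; apply: cmeas_Bf; apply: span_csq.
  by case: (hg n).
- by move=> n p; exact: sqr_ge0.
- move=> p; have c : (fun n => normc (Bf (g n) p)) @ \oo --> normc (Bf f p).
    apply/cvgrPdist_le => t t0; near=> n.
    have [sg cg fg] := hg n.
    have n1 : n.+1%:R^-1 <= t by apply/ltW; near: n; exact: (near_infty_natSinv_lt (PosNum t0)).
    have h := @normc_Bf_le (fun s => f s - g n s) n.+1%:R^-1 p cg.
    have d : normc (Bf f p - Bf (g n) p) <= n.+1%:R^-1.
      rewrite -Bf_B//; last exact: span_csq.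
      apply: h; first by rewrite invr_ge0.
      apply: (le_trans (ltW fg)); rewrite lerXn2r ?nnegrE ?invr_ge0//.
        by rewrite le_min (ltW e0) invr_ge0 ler0n.
      by rewrite ge_min lexx orbT.
    apply: le_trans n1; apply: le_trans d.
    rewrite ler_norml; apply/andP; split.
      by have := ler_sub_normc (Bf (g n) p) (Bf f p); rewrite normcBC; lra.
    exact: ler_sub_normc.
  rewrite expr2; under eq_fun do rewrite expr2.
  exact: cvgM.
- move=> n; have [sg cg fg] := hg n.
  rewrite -/(sqnE leb2 (Bf (g n))) sqnE_fin; last by apply: inH_csq; case: (span_properties sg).
  rewrite lee_fin sqn_Bf_span//.
  have ge := span_csq sg.
  have -> : g n = (fun s => f s + -1 * (f s - g n s)) by apply/funext => s; ring.
  have cn := csqZ (-1) cg.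
  have := sqn_le2 cf cn; rewrite sqnZ// normcN Normc.normc1 expr1n mul1r.
  set X := sqn _ _; have X0 : 0 <= X by exact: sqn_ge0.
  have : c0 * X <= X by rewrite ler_piMl// c0_le1.
  have : (Num.min e n.+1%:R^-1) ^+ 2 <= e ^+ 2.
    rewrite lerXn2r ?nnegrE ?(ltW e0)//; last by rewrite ge_min lexx.
    by rewrite le_min (ltW e0) invr_ge0 ler0n.
  lra.
Unshelve. all: by end_near.
Qed.

Lemma csq_Bf f : csq mu f -> csq leb2 (Bf f).
Proof.
by move=> cf; split; [exact: cmeas_Bf|exact: (le_lt_trans (sqnE_Bf_le cf) (ltry _))].
Qed.

Lemma sqn_Bf_le f : csq mu f -> sqn leb2 (Bf f) <= 2 * sqn mu f.
Proof. by move=> cf; rewrite -lee_fin -sqnE_fin ?sqnE_Bf_le//; exact: csq_Bf. Qed.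

Lemma kr_bounded_integrable (h : P -> R[i]) p (M : R) : cmeas h -> (forall q, normc (h q) <= M) ->
  cintegrable leb2 (fun q => kr p q * h q) /\
  normc (cint leb2 (fun q => kr p q * h q)) <= 2 * M.
Proof.
move=> mh hM.
have M0 : 0 <= M by apply: le_trans (hM (0, 0)); exact: normc_ge0.
have b q : normc (kr p q * h q) <= M * gw (pi / 2) p q.
  by rewrite -normc_kr [normc (_ * h q)]Normc.normcM mulrC ler_wpM2r ?normc_ge0.
have I : (\int[leb2]_q (M * gw (pi / 2) p q)%:E = (2 * M)%:E)%E.
  rewrite nintZ//; [|exact: measurable_gw|by move=> q; exact: gw_ge0].
  rewrite nint_gw ?divr_gt0// -EFinM mulrC; congr (_ * _)%:E.
  by rewrite invf_div mulrCA divff ?gt_eqF// mulr1.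
have mg : measurable_fun setT (fun q => M * gw (pi / 2) p q).
  by apply: measurable_funM => //; exact: measurable_gw.
have i : cintegrable leb2 (fun q => kr p q * h q).
  apply: (@cintegrable_le _ _ _ _ _ (fun q => M * gw (pi / 2) p q)) => //.
  - by apply: cmeasM => //; exact: cmeas_krl.
  - by rewrite I ltry.
split=> //; rewrite -lee_fin; apply: (le_trans (normc_cint_le i)).
rewrite -I; apply: le_nint => //; first by apply: measurable_normc; case: i.
by move=> q; exact: normc_ge0.
Qed.

Lemma normc_Bf_le_sqn f p : csq mu f -> normc (Bf f p) <= sqn mu f + 1.
Proof.
move=> cf; apply: normc_Bf_le => //; first by rewrite addr_ge0// sqn_ge0.
by have := sqn_ge0 mu f; rewrite expr2; nra.
Qed.

(** Both sides of the reproducing formula depend continuously on [f]: replacing [f] by an element of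
    the span at distance less than [e] changes them by at most [e] and [2 * e]. *)
Lemma inH_Bf f : csq mu f -> inH (Bf f).
Proof.
move=> cf; have [mB sB] := csq_Bf cf; split=> // p.
have [iB _] := kr_bounded_integrable p mB (fun q => normc_Bf_le_sqn q cf).
apply/eqP; rewrite -subr_eq0 -normc_eq0; apply/eqP.
apply: (@eq0_of_le _ 3); first exact: normc_ge0.
move=> e e0; have [g sg [cg fg]] := span_dense cf e0.
have ge := span_csq sg; have [_ Hg _ _] := span_properties sg.
have [mBg sBg rBg] := Hg.
have [ig _] := kr_bounded_integrable p mBg (fun q => normc_Bf_le_sqn q ge).
have be q : normc (Bf (fun s => f s - g s) q) <= e.
  by apply: normc_Bf_le => //; exact: ltW.
have [_ id] := kr_bounded_integrable p (cmeas_Bf cg) be.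
have E : cint leb2 (fun q => kr p q * Bf (fun s => f s - g s) q) =
    cint leb2 (fun q => kr p q * Bf f q) - Bf g p.
  transitivity (cint leb2 (fun q => kr p q * Bf f q - kr p q * Bf g q)).
    by apply: eq_cint => q; rewrite Bf_B// mulrBr.
  by rewrite (cintB iB ig); congr (_ - _); exact: esym (rBg p).
have -> : Bf f p - cint leb2 (fun q => kr p q * Bf f q) =
    Bf (fun s => f s - g s) p - cint leb2 (fun q => kr p q * Bf (fun s => f s - g s) q).
  by rewrite E Bf_B//; ring.
apply: (le_trans (ler_normcB _ _)); have := be p; lra.
Qed.

Lemma ip_Bf f g : csq mu f -> csq mu g -> ip leb2 (Bf f) (Bf g) = c0%:C * ip mu f g.
Proof.
move=> cf cg; apply/eqP; rewrite -subr_eq0 -normc_eq0; apply/eqP.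
apply: (@eq0_of_le _ (4 * (sqn mu f + 1))); first exact: normc_ge0.
move=> e e0; have [h sh [ch fh]] := span_dense cg e0.
have he := span_csq sh; have [_ Hh iso _] := span_properties sh.
have Hf := inH_Bf cf; have Hg := inH_Bf cg.
set k := fun s => g s - h s.
have -> : ip leb2 (Bf f) (Bf g) - c0%:C * ip mu f g =
   ip leb2 (Bf f) (Bf k) - c0%:C * ip mu f k.
  rewrite (_ : Bf k = fun q => Bf g q - Bf h q); last by apply/funext => q; exact: Bf_B.
  rewrite (ipBr (inH_csq Hf) (inH_csq Hg) (inH_csq Hh)) (iso f cf Hf) (ipBr cf cg he).
  by ring.
have sk : sqn mu k <= e ^+ 2 by exact: ltW.
have n1 : normc (ip leb2 (Bf f) (Bf k)) <= 2 * (sqn mu f + 1) * e.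
  apply: (sqr_le_mul _ (sqn_ge0 mu f) (ltW e0)); first exact: normc_ge0.
  apply: (le_trans (cauchy_schwarz (csq_Bf cf) (csq_Bf ch))).
  by apply: ler_mul_twice (sqn_Bf_le cf) (sqn_Bf_le ch) sk; exact: sqn_ge0.
have n2 : normc (c0%:C * ip mu f k) <= 2 * (sqn mu f + 1) * e.
  apply: (sqr_le_mul _ (sqn_ge0 mu f) (ltW e0)); first exact: normc_ge0.
  rewrite [normc (_ * _)]Normc.normcM exprMn normcC ger0_norm ?(ltW c0_gt0)//.
  have := cauchy_schwarz cf ch; rewrite -/k; have := ler_wpM2l (sqn_ge0 mu f) sk; have := sqn_ge0 mu f.
  have : c0 ^+ 2 <= 1 :> R by rewrite exprn_ile1 ?c0_le1// (ltW c0_gt0).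
  have := sqr_ge0 (normc (ip mu f k)); set X := _ ^+ 2; have := sqr_ge0 (c0 : R).
  set y := _ ^+ 2; nra.
by apply: (le_trans (ler_normcB _ _)); apply: (le_trans (lerD n1 n2)); lra.
Qed.

(** [Phi] is orthogonal to the transforms of the span, hence by density to that of every [tau p],
    and that inner product is a nonzero multiple of [Phi p]. The conclusion covers all of [inH],
    which includes the quotients produced by [inE_div]. *)
Lemma Bf_unique (Phi : P -> R[i]) : inH Phi ->
  (forall l : P, Lam (l : R * R) -> Phi l = 0) -> forall p, Phi p = 0.
Proof.
move=> HP vP p.
have ct := csq_tau p.
have h0 : ip leb2 Phi (Bf (tau (p : R * R))) = 0.
  apply/eqP; rewrite -normc_eq0; apply/eqP.
  apply: (@eq0_of_le _ (2 * (sqn leb2 Phi + 1))); first exact: normc_ge0.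
  move=> e e0; have [h sh [ch fh]] := span_dense ct e0.
  have [he Hh _ van] := span_properties sh.
  have sP := inH_csq HP.
  have -> : ip leb2 Phi (Bf (tau (p : R * R))) =
      ip leb2 Phi (Bf (fun s => tau (p : R * R) s - h s)).
    rewrite (_ : Bf (fun s => tau (p : R * R) s - h s) = fun q => Bf (tau (p : R * R)) q - Bf h q); last first.
      by apply/funext => q; exact: Bf_B.
    by rewrite ipBr ?van ?subr0//; [exact/inH_csq/inH_Bf|exact: inH_csq].
  apply: (sqr_le_mul _ (sqn_ge0 leb2 Phi) (ltW e0)); first exact: normc_ge0.
  apply: (le_trans (cauchy_schwarz sP (csq_Bf ch))).
  apply: (@ler_mul_twice _ (sqn leb2 Phi) _ _ _ _ _ _ (sqn_Bf_le ch)); rewrite ?sqn_ge0//.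
    by have := sqn_ge0 leb2 Phi; lra.
  exact: ltW.
move: h0; rewrite ip_Bf_tau// => /eqP.
rewrite !mulf_eq0 -!normc_eq0 normc_conj normc_phase oner_eq0 orbF normcC.
by rewrite gtr0_norm ?c0_gt0// gt_eqF ?c0_gt0//= normc_eq0 => /eqP.
Qed.

End transform_isometry.

(** * Cauchy potentials *)

Section cauchy_potential.
Context {R : realType}.
Local Notation P := (measurableTypeR R * measurableTypeR R)%type.
Implicit Types (p q w z : P) (Phi F T : P -> R[i]).

Definition pot Phi F w : R[i] :=
  cint leb2 (fun z => Phi z * conjc (F z) / (zeta z - zeta w)).
Definition npot Phi F w : \bar R :=
  (\int[leb2]_z (normc (Phi z) * normc (F z) * ck w z)%:E)%E.

Lemma cmeas_pot2 Phi F : cmeas Phi -> cmeas F ->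
  cmeas (fun wz : P * P => Phi wz.2 * conjc (F wz.2) / (zeta wz.2 - zeta wz.1)).
Proof.
move=> mP mF; apply: cmeas_div; last exact: cmeas_zetaB2.
apply: cmeasM; first exact: (cmeas_comp mP measurable_snd).
by apply: cmeas_conj; exact: (cmeas_comp mF measurable_snd).
Qed.

Lemma normc_pot_integrand Phi F w z :
  normc (Phi z * conjc (F z) / (zeta z - zeta w)) = normc (Phi z) * normc (F z) * ck w z.
Proof. by rewrite normc_div [normc (_ * _)]Normc.normcM normc_conj. Qed.

Lemma pot_integrable Phi F w : cmeas Phi -> cmeas F -> (npot Phi F w < +oo)%E ->
  cintegrable leb2 (fun z => Phi z * conjc (F z) / (zeta z - zeta w)).
Proof.
move=> mP mF oo; split; last by under eq_integral do rewrite normc_pot_integrand.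
exact: (cmeas_comp (cmeas_pot2 mP mF) (pair1_measurable w)).
Qed.

Lemma normc_pot_le Phi F w : cmeas Phi -> cmeas F -> (npot Phi F w < +oo)%E ->
  ((normc (pot Phi F w))%:E <= npot Phi F w)%E.
Proof.
move=> mP mF oo; apply: (le_trans (normc_cint_le (pot_integrable mP mF oo))).
by under eq_integral do rewrite normc_pot_integrand.
Qed.

Lemma cmeas_pot Phi F : cmeas Phi -> cmeas F -> cmeas (pot Phi F).
Proof. by move=> mP mF; exact: (cmeas_cint leb2 (cmeas_pot2 mP mF)). Qed.

Lemma npot_ge0 Phi F w z : 0 <= normc (Phi z) * normc (F z) * ck w z.
Proof. by rewrite !mulr_ge0 ?normc_ge0 ?ck_ge0. Qed.

Lemma inH_mul Phi F : inH Phi -> inH F -> exists2 M : R, 0 <= M &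
  (forall z, 0 <= normc (Phi z) * normc (F z) <= M) /\
  (\int[leb2]_z (normc (Phi z) * normc (F z))%:E <= M%:E)%E.
Proof.
move=> HP HF; have [C C0 hC] := inH_bound HP; have [D D0 hD] := inH_bound HF.
have cP := inH_csq HP; have cF := inH_csq HF.
pose I := 1 / 2 * sqn leb2 Phi + (2 * 1)^-1 * sqn leb2 F.
have I0 : 0 <= I by rewrite addr_ge0// mulr_ge0 ?sqn_ge0 ?invr_ge0.
exists (C * D + I); first by rewrite addr_ge0// mulr_ge0.
split=> [z|].
  rewrite mulr_ge0 ?normc_ge0//= (@le_trans _ _ (C * D))// ?lerDl//.
  by rewrite ler_pM ?normc_ge0.
apply: (@le_trans _ _ I%:E); last by rewrite lee_fin lerDr mulr_ge0.
apply: le_trans (nint_mul_le ltr01 cP cF); rewrite le_eqVlt; apply/orP; left; apply/eqP.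
by apply: eq_integral => z _; rewrite [normc (_ * _)]Normc.normcM normc_conj.
Qed.

Lemma measurable_normc_mul Phi F : cmeas Phi -> cmeas F ->
  measurable_fun setT (fun z => normc (Phi z) * normc (F z)).
Proof. by move=> mP mF; apply: measurable_funM; exact: measurable_normc. Qed.

Lemma npot_inH Phi F : inH Phi -> inH F ->
  exists2 C : R, 0 <= C & forall w, (npot Phi F w <= C%:E)%E.
Proof.
move=> HP HF; have [M M0 [hM IM]] := inH_mul HP HF.
exists (16 * 1 * M + M / 1); first by rewrite addr_ge0 ?divr_ge0// mulr_ge0.
move=> w; apply: (ck_integral_le w _ hM IM ltr01).
by case: HP HF => [mP _ _] [mF _ _]; exact: measurable_normc_mul.
Qed.

(** [zeta z - a] is split as [(zeta z - zeta w) + (zeta w - a)]: the first part cancels the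
    singularity, the second leaves the bounded potential of [Phi] times a factor of size [wt w]. *)
Lemma npot_mulz (a : R[i]) Phi F : inH Phi -> inH F -> exists2 C : R, 0 <= C &
  forall w, (npot (fun q => ((zeta q - a) * Phi q)%R) F w <= (C * wt w)%:E)%E.
Proof.
move=> HP HF; have [M M0 [hM IM]] := inH_mul HP HF; have [C C0 hC] := npot_inH HP HF.
have [mP _ _] := HP; have [mF _ _] := HF.
have a0 : 0 <= 1 + normc a by rewrite addr_ge0// normc_ge0.
exists (M + (1 + normc a) * C); first by rewrite addr_ge0// mulr_ge0.
move=> w; have wp := wt_ge0 w.
have m1 := measurable_normc_mul mP mF.
have m2 : measurable_fun setT (fun z => normc (Phi z) * normc (F z) * ck w z).
  by apply: measurable_funM => //; exact: measurable_ck.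
have c1 : 0 <= (1 + normc a) * wt w by exact: mulr_ge0.
apply: (@le_trans _ _ (1%:E * \int[leb2]_z (normc (Phi z) * normc (F z))%:E +
    ((1 + normc a) * wt w)%:E * npot Phi F w)%E).
  apply: le_nint_lin => //.
  - apply: measurable_funM; last exact: measurable_ck.
    apply: measurable_normc_mul => //; apply: cmeasM => //.
    by apply: cmeasB; [exact: cmeas_zeta|exact: cmeas_cst].
  - by move=> z; exact: (npot_ge0 (fun q => (zeta q - a) * Phi q)).
  - by move=> z; rewrite mulr_ge0 ?normc_ge0.
  - by move=> z; exact: npot_ge0.
  - move=> z; rewrite [normc (_ * Phi z)]Normc.normcM mul1r.
    have -> : normc (zeta z - a) * normc (Phi z) * normc (F z) * ck w z =
      (normc (Phi z) * normc (F z)) * (normc (zeta z - a) * ck w z) by ring.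
    have -> : normc (Phi z) * normc (F z) + (1 + normc a) * wt w * (normc (Phi z) * normc (F z) * ck w z) =
      (normc (Phi z) * normc (F z)) * (1 + (1 + normc a) * wt w * ck w z) by ring.
    apply: ler_wpM2l; first by rewrite mulr_ge0 ?normc_ge0.
    have h1 : normc (zeta z - zeta w) * ck w z <= 1.
      rewrite /ck; have [->|h] := eqVneq (normc (zeta z - zeta w)) 0; first by rewrite mul0r.
      by rewrite divff.
    have h2 : normc (zeta z - a) <= normc (zeta z - zeta w) + (1 + normc a) * wt w.
      have -> : zeta z - a = (zeta z - zeta w) + (zeta w - a) by ring.
      apply: (le_trans (ler_normcD _ _)); rewrite lerD2l.
      apply: (le_trans (ler_normcB _ _)); rewrite /wt.
      by have := normc_ge0 (zeta w); have := normc_ge0 a; nra.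
    apply: (le_trans (ler_wpM2r (ck_ge0 _ _) h2)); rewrite mulrDl; lra.
rewrite mul1e.
apply: (@le_trans _ _ (M%:E + ((1 + normc a) * wt w)%:E * C%:E)%E).
  by apply: leeD => //; apply: lee_wpmul2l; [rewrite lee_fin mulr_ge0|exact: hC].
rewrite -EFinM -EFinD lee_fin mulrDl.
have : M <= M * wt w by rewrite ler_peMr// wt_ge1.
lra.
Qed.

(** The integral of the antisymmetric difference quotient of [T1] and [T2] against the conjugate of
    [F], written with two potentials; see [wronsk_cint]. *)
Definition wronsk T1 T2 F w : R[i] := T2 w * pot T1 F w - T1 w * pot T2 F w.

Lemma wronsk_eq0 T1 T2 F w : T1 w = 0 -> T2 w = 0 -> wronsk T1 T2 F w = 0.
Proof. by rewrite /wronsk => -> ->; rewrite !mul0r subrr. Qed.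

Lemma cmeas_wronsk T1 T2 F : cmeas T1 -> cmeas T2 -> cmeas F -> cmeas (wronsk T1 T2 F).
Proof. by move=> m1 m2 mF; exact: cmeasB (cmeasM m2 (cmeas_pot m1 mF)) (cmeasM m1 (cmeas_pot m2 mF)). Qed.

Lemma wronsk_cint T1 T2 F w : cmeas T1 -> cmeas T2 -> cmeas F ->
  (npot T1 F w < +oo)%E -> (npot T2 F w < +oo)%E ->
  wronsk T1 T2 F w =
  cint leb2 (fun z => (T1 z * T2 w - T1 w * T2 z) * conjc (F z) / (zeta z - zeta w)).
Proof.
move=> m1 m2 mF f1 f2.
have i1 := pot_integrable m1 mF f1; have i2 := pot_integrable m2 mF f2.
rewrite /wronsk /pot -cintZ// -cintZ// -cintB; [|exact: cintegrableZ|exact: cintegrableZ].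
by apply: eq_cint => z; ring.
Qed.

(** For fixed [z] the numerator is a function of [w] in [inE] that vanishes at [z], so [rep_div]
    reproduces the quotient. Fubini then integrates this over [z]. *)
Lemma reproduced_wronsk T1 T2 F (C : R) : inE T1 -> inE T2 -> cmeas F -> 0 <= C ->
  (forall w, (npot T1 F w <= (C * wt w)%:E)%E) ->
  (forall w, (npot T2 F w <= (C * wt w)%:E)%E) -> reproduced (wronsk T1 T2 F).
Proof.
move=> E1 E2 mF C0 h1 h2 p.
have [m1 _ _] := E1; have [m2 _ _] := E2.
have [C1 C10 b1] := inE_bound E1; have [C2 C20 b2] := inE_bound E2.
have f1 w : (npot T1 F w < +oo)%E by apply: le_lt_trans (h1 w) _; rewrite ltry.
have f2 w : (npot T2 F w < +oo)%E by apply: le_lt_trans (h2 w) _; rewrite ltry.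
pose X (wz : P * P) := kr p wz.1 * ((T1 wz.2 * T2 wz.1 - T1 wz.1 * T2 wz.2) *
   conjc (F wz.2) / (zeta wz.2 - zeta wz.1)).
have mfst : measurable_fun setT (fst : P * P -> P) := measurable_fst.
have msnd : measurable_fun setT (snd : P * P -> P) := measurable_snd.
have mX : cmeas X.
  apply: cmeasM; first exact: (cmeas_comp (cmeas_krl p) mfst).
  apply: cmeas_div; last exact: cmeas_zetaB2.
  apply: cmeasM; last by apply: cmeas_conj; exact: (cmeas_comp mF msnd).
  apply: cmeasB; apply: cmeasM.
  - exact: (cmeas_comp m1 msnd).
  - exact: (cmeas_comp m2 mfst).
  - exact: (cmeas_comp m1 mfst).
  - exact: (cmeas_comp m2 msnd).
have Xle w z : normc (X (w, z)) <= (normc (kr p w) * normc (T2 w)) * (normc (T1 z) * normc (F z) * ck w z) +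
    (normc (kr p w) * normc (T1 w)) * (normc (T2 z) * normc (F z) * ck w z).
  rewrite /X /= [normc (kr p w * _)]Normc.normcM normc_div -/(ck w z).
  rewrite [normc (_ * conjc _)]Normc.normcM normc_conj.
  have := ler_normcB (T1 z * T2 w) (T1 w * T2 z).
  rewrite [normc (T1 z * T2 w)]Normc.normcM [normc (T1 w * T2 z)]Normc.normcM => h.
  have k0 : 0 <= normc (kr p w) * (normc (F z) * ck w z).
    by rewrite !mulr_ge0 ?normc_ge0 ?ck_ge0.
  have := ler_wpM2l k0 h; set a := normc (_ - _); lra.
have mn1 w : measurable_fun setT (fun z => normc (T1 z) * normc (F z) * ck w z).
  by apply: measurable_funM; [exact: measurable_normc_mul|exact: measurable_ck].
have mn2 w : measurable_fun setT (fun z => normc (T2 z) * normc (F z) * ck w z).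
  by apply: measurable_funM; [exact: measurable_normc_mul|exact: measurable_ck].
have Xoo : (\int[leb2]_w \int[leb2]_z (normc (X (w, z)))%:E < +oo)%E.
  apply: (@le_lt_trans _ _ (\int[leb2]_w (((C1 + C2) * C) * (normc (kr p w) * wt w ^+ 2))%:E)%E); last first.
    apply: nintZ_fin; last exact: nint_kr_wt_fin.
    - apply: measurable_funM; first exact: measurable_krl.
      by apply: measurable_funX; exact: measurable_wt.
    - by move=> q; rewrite mulr_ge0 ?normc_ge0 ?sqr_ge0.
    - by rewrite mulr_ge0// addr_ge0.
  apply: ge0_le_integral; first exact: measurableT.
  - by move=> w _; apply: nint_ge0 => z; exact: normc_ge0.
  - exact: (measurable_nint leb2 (measurable_normc mX) (fun _ => normc_ge0 _)).
  - apply/measurable_EFinP; apply: measurable_funM => //.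
    apply: measurable_funM; first exact: measurable_krl.
    by apply: measurable_funX; exact: measurable_wt.
  move=> w _.
  set k2 := normc (kr p w) * normc (T2 w); set k1 := normc (kr p w) * normc (T1 w).
  have k20 : 0 <= k2 by rewrite mulr_ge0 ?normc_ge0.
  have k10 : 0 <= k1 by rewrite mulr_ge0 ?normc_ge0.
  apply: (@le_trans _ _ (k2%:E * npot T1 F w + k1%:E * npot T2 F w)%E).
    apply: (le_nint_lin leb2 _ (mn1 w) (mn2 w) _ _ _ k20 k10).
    - exact: (measurableT_comp (measurable_normc mX) (pair1_measurable w)).
    - by move=> z; exact: normc_ge0.
    - by move=> z; exact: npot_ge0.
    - by move=> z; exact: npot_ge0.
    - by move=> z; exact: Xle.
  apply: (@le_trans _ _ (k2%:E * (C * wt w)%:E + k1%:E * (C * wt w)%:E)%E).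
    by apply: leeD; apply: lee_wpmul2l; rewrite ?lee_fin ?h1 ?h2.
  rewrite -!EFinM -EFinD lee_fin -mulrDl.
  have kb : k2 + k1 <= normc (kr p w) * ((C1 + C2) * wt w).
    rewrite /k2 /k1 -mulrDr ler_wpM2l ?normc_ge0//.
    by have := b1 w; have := b2 w; lra.
  apply: (le_trans (ler_wpM2r _ kb)); first by rewrite mulr_ge0// wt_ge0.
  by rewrite le_eqVlt; apply/orP; left; apply/eqP; ring.
have Xw w : cint leb2 (fun z => X (w, z)) = kr p w * wronsk T1 T2 F w.
  rewrite wronsk_cint// -cintZ//.
  have i1 := pot_integrable m1 mF (f1 w); have i2 := pot_integrable m2 mF (f2 w).
  rewrite (_ : (fun z => _) = (fun z => T2 w * (T1 z * conjc (F z) / (zeta z - zeta w)) -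
     T1 w * (T2 z * conjc (F z) / (zeta z - zeta w)))).
    by apply: cintegrableB; exact: cintegrableZ.
  by apply/funext => z; ring.
have Xz z : zeta z != zeta p -> cint leb2 (fun w => X (w, z)) =
    (T1 z * T2 p - T1 p * T2 z) * conjc (F z) / (zeta z - zeta p).
  move=> zp; pose Th w := T1 z * T2 w + (- T2 z) * T1 w.
  have ETh : inE Th by apply: inE_D; exact: inE_Z.
  have Thz : Th z = 0 by rewrite /Th; ring.
  have [D D0 hD] := kr_ck_bound z ETh.
  have [mTh _ _] := ETh.
  have iTh : cintegrable leb2 (fun w => kr p w * (Th w / (zeta w - zeta z))).
    split.
      apply: cmeasM; first exact: cmeas_krl.
      by apply: cmeas_div => //; apply: cmeasB; [exact: cmeas_zeta|exact: cmeas_cst].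
    apply: (@le_lt_trans _ _ (D * wt p)%:E); last by rewrite ltry.
    apply: le_trans (hD p); rewrite le_eqVlt; apply/orP; left; apply/eqP.
    apply: eq_integral => w _.
    by rewrite [normc (kr p w * _)]Normc.normcM normc_div mulrA.
  transitivity (cint leb2 (fun w => - conjc (F z) * (kr p w * (Th w / (zeta w - zeta z))))).
    apply: eq_cint => w; rewrite /X /Th /= -(opprB (zeta w)) invrN.
    by set d := (zeta w - zeta z)^-1; ring.
  rewrite cintZ// rep_div//; last by rewrite eq_sym.
  rewrite /Th -(opprB (zeta p)) invrN.
  by set d := (zeta p - zeta z)^-1; ring.
rewrite wronsk_cint//.
transitivity (cint leb2 (fun z => cint leb2 (fun w => X (w, z)))).
  apply: ae_eq_cint.
  - apply: cmeas_div; last by apply: cmeasB; [exact: cmeas_zeta|exact: cmeas_cst].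
    apply: cmeasM; last exact: cmeas_conj.
    by apply: cmeasB; apply: cmeasM => //; exact: cmeas_cst.
  - apply: (@cmeas_cint _ _ _ _ _ leb2 (fun zw : P * P => X (zw.2, zw.1))).
    have mswap : measurable_fun setT (fun zw : P * P => (zw.2, zw.1)) by exact: measurable_swap.
    exact: (cmeas_comp mX mswap).
  - by apply: filterS (ae_zeta_neq (zeta p)) => z zp; rewrite Xz.
by rewrite -(cint_swap mX Xoo); apply: eq_cint => w; exact: Xw.
Qed.

(** The bounded potential multiplies [G] and the linearly growing one multiplies the
    square-integrable [Phi], so both products are square integrable after division by [wt]. *)
Lemma inE_wronsk Phi (a : R[i]) T F : inH Phi -> inH T -> inH F ->
  let G := fun q => (zeta q - a) * T q in inE (wronsk Phi G F).
Proof.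
move=> HP HT HF G; have EG : inE G := inE_mulz a HT; have EP := inH_inE HP.
have [mP sP _] := HP; have [mF _ _] := HF; have [mG wG _] := EG.
have [C C0 hC] := npot_inH HP HF; have [D D0 hD] := npot_mulz a HT HF.
have [f1 f2] : (forall w, (npot Phi F w < +oo)%E) /\ (forall w, (npot G F w < +oo)%E).
  by split=> w; [apply: le_lt_trans (hC w) _|apply: le_lt_trans (hD w) _]; rewrite ltry.
split; first exact: cmeas_wronsk.
- apply: (@le_nint_lin_fin _ _ _ _ (2 * C ^+ 2) (2 * D ^+ 2) _
    (fun q => (normc (G q) / wt q) ^+ 2) (fun q => normc (Phi q) ^+ 2)) => //.
    + by apply: measurable_wsqr; exact: cmeas_wronsk.
    + exact: measurable_wsqr.
    + exact: measurable_sqr_normc.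
    + by move=> q; exact: sqr_ge0.
    + by move=> q; exact: sqr_ge0.
    + by move=> q; exact: sqr_ge0.
    + by rewrite mulr_ge0 ?sqr_ge0.
    + by rewrite mulr_ge0 ?sqr_ge0.
    + move=> w; have wp := wt_gt0 w.
      have n1 : normc (pot Phi F w) <= C.
        by rewrite -lee_fin; apply: le_trans (hC w); exact: normc_pot_le.
      have n2 : normc (pot G F w) <= D * wt w.
        by rewrite -lee_fin; apply: le_trans (hD w); exact: normc_pot_le.
      have h : normc (wronsk Phi G F w) / wt w <= C * (normc (G w) / wt w) + D * normc (Phi w).
        rewrite ler_pdivrMr// mulrDl -[C * _ * _]mulrA divfK ?gt_eqF//.
        apply: (le_trans (ler_normcB _ _)).
        rewrite [normc (G w * _)]Normc.normcM [normc (Phi w * _)]Normc.normcM.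
        apply: lerD; first by rewrite mulrC ler_wpM2r ?normc_ge0.
        rewrite mulrAC [leLHS]mulrC ler_wpM2r ?normc_ge0//.
      have x0 : 0 <= normc (wronsk Phi G F w) / wt w by rewrite divr_ge0 ?normc_ge0 ?wt_ge0.
      set y := C * _ in h; set x := D * _ in h.
      have := sqr_ge0 (y - x).
      have -> : 2 * C ^+ 2 * (normc (G w) / wt w) ^+ 2 + 2 * D ^+ 2 * normc (Phi w) ^+ 2 =
         2 * y ^+ 2 + 2 * x ^+ 2 by rewrite /x /y; ring.
      have : (normc (wronsk Phi G F w) / wt w) ^+ 2 <= (y + x) ^+ 2.
        by rewrite lerXn2r ?nnegrE// (le_trans x0).
      rewrite sqrrB sqrrD; lra.
- apply: (@reproduced_wronsk _ _ _ (C + D)) => //; first by rewrite addr_ge0.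
  + move=> w; apply: (le_trans (hC w)); rewrite lee_fin.
    by have := wt_ge1 w; nra.
  + move=> w; apply: (le_trans (hD w)); rewrite lee_fin ler_wpM2r ?wt_ge0//.
    by rewrite lerDr.
Qed.

End cauchy_potential.

(** * Bootstrapping the potential of G *)

Section bootstrap.
Context {R : realType}.
Local Notation P := (measurableTypeR R * measurableTypeR R)%type.
Implicit Types (p q w z : P) (Phi F T : P -> R[i]).

Lemma far01 (K : R) z : 0 <= far K z <= 1.
Proof. by rewrite /far; case: (_ < _); rewrite /= ?lexx ?ler01. Qed.

Lemma measurable_near_part (K : R) : measurable_fun setT (fun z : P => 1 - far K z).
Proof. by apply: measurable_funB => //; exact: measurable_far. Qed.

Lemma npot_far Phi F (K : R) w : cmeas Phi -> cmeas F ->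
  (npot Phi F w = \int[leb2]_z (normc (Phi z) * normc (F z) * (1 - far K z) * ck w z)%:E +
    \int[leb2]_z (normc (Phi z) * normc (F z) * far K z * ck w z)%:E)%E.
Proof.
move=> mP mF; have mm := measurable_normc_mul mP mF.
rewrite -nintD.
- by apply: eq_integral => z _; congr EFin; ring.
- apply: measurable_funM; last exact: measurable_ck.
  by apply: measurable_funM => //; exact: measurable_near_part.
- apply: measurable_funM; last exact: measurable_ck.
  by apply: measurable_funM => //; exact: measurable_far.
- move=> z; have /andP[f0 f1] := far01 K z.
  by rewrite !mulr_ge0 ?normc_ge0 ?ck_ge0// subr_ge0.
- move=> z; have /andP[f0 f1] := far01 K z.
  by rewrite !mulr_ge0 ?normc_ge0 ?ck_ge0.
Qed.

Lemma npot_vanishing Phi F (e : R) : inH Phi -> inH F -> 0 < e ->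
  exists2 K : R, 0 <= K & forall w, K < normc (zeta w) -> (npot Phi F w <= e%:E)%E.
Proof.
move=> HP HF e0; have [M M0 [hM IM]] := inH_mul HP HF.
have [mP _ _] := HP; have [mF _ _] := HF; have mm := measurable_normc_mul mP mF.
have [K K0 hK] := ck_tail mm hM (le_lt_trans IM (ltry _)) (divr_gt0 e0 (ltr0n _ 2)).
(* The part beyond [K] contributes at most [e / 2] uniformly in [w]. Points within [K] are farther
   than [2 * M / e] from [w], so they contribute at most [e / (2 * M)] times the mass [M]. *)
exists (K + 2 * M / e); first by rewrite addr_ge0 ?(ltW K0)// divr_ge0 ?mulr_ge0// ltW.
move=> w Kw; rewrite (npot_far K w mP mF).
rewrite (_ : e = e / 2 + e / 2); last by field.
rewrite EFinD; apply: leeD; last exact: hK.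
have [M_eq0|M_neq0] := eqVneq M 0.
  rewrite (_ : (\int[leb2]_z _)%E = 0%E) ?lee_fin ?divr_ge0 ?(ltW e0)//.
  rewrite -[RHS](@integral0 _ _ _ leb2 setT); apply: eq_integral => z _.
  have /andP[m0 m1] := hM z; rewrite (_ : normc (Phi z) * normc (F z) = 0) ?mul0r//.
  by apply/eqP; rewrite eq_le m0 andbT -M_eq0.
have Mp : 0 < M by rewrite lt_def M_neq0.
have d0 : 0 < 2 * M / e by rewrite divr_gt0// mulr_gt0.
apply: (@le_trans _ _ (\int[leb2]_z ((2 * M / e)^-1 * (normc (Phi z) * normc (F z)))%:E)%E).
  apply: le_nint.
  - apply: measurable_funM; last exact: measurable_ck.
    by apply: measurable_funM => //; exact: measurable_near_part.
  - exact: measurable_funM.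
  - move=> z; have /andP[f0 f1] := far01 K z.
    by rewrite !mulr_ge0 ?normc_ge0 ?ck_ge0// subr_ge0.
  - move=> z; rewrite [leRHS]mulrC -mulrA; apply: ler_wpM2l; first by rewrite mulr_ge0 ?normc_ge0.
    rewrite /far; case: ltP => [_|zK]; first by rewrite subrr mul0r invr_ge0 ltW.
    rewrite subr0 mul1r /ck lef_pV2 ?posrE//.
      have := ler_normcB (zeta z) (zeta z - zeta w).
      rewrite (_ : zeta z - (zeta z - zeta w) = zeta w); last by ring.
      by lra.
    have := ler_normcB (zeta z) (zeta z - zeta w).
    rewrite (_ : zeta z - (zeta z - zeta w) = zeta w); last by ring.
    by lra.
rewrite nintZ//; [|by move=> z; have /andP[] := hM z|by rewrite invr_ge0 ltW].
apply: (@le_trans _ _ ((2 * M / e)^-1%:E * M%:E)%E).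
  by apply: lee_wpmul2l => //; rewrite lee_fin invr_ge0 ltW.
rewrite -EFinM lee_fin le_eqVlt; apply/orP; left; apply/eqP.
by field; rewrite M_neq0 gt_eqF.
Qed.

Variables (Phi F T : P -> R[i]) (a c : R[i]).
Hypotheses (HP : inH Phi) (HF : inH F) (HT : inH T) (c0 : c != 0).
Let G q := (zeta q - a) * T q.
Hypothesis cG : forall w, c * G w = wronsk Phi G F w.

(** Near infinity the potential of [Phi] is at most [normc c / 2]; half of [normc c * normc (G w)]
    survives on the left of [cG]. *)
Let b : R := 2 / normc c.
Let nc0 : 0 < normc c. Proof. by rewrite normc_gt0. Qed.
Let b0 : 0 < b. Proof. by rewrite divr_gt0. Qed.

Let pG w : R := fine (npot G F w).

Let mP : cmeas Phi. Proof. by case: HP. Qed.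
Let mF : cmeas F. Proof. by case: HF. Qed.
Let mG : cmeas G. Proof. by case: (inE_mulz a HT). Qed.

Let pGE w : npot G F w = (pG w)%:E.
Proof.
have [D D0 hD] := npot_mulz a HT HF; rewrite /pG fineK// ge0_fin_numE.
  by apply: le_lt_trans (hD w) _; rewrite ltry.
by apply: nint_ge0 => z; exact: npot_ge0.
Qed.

Let pG_ge0 w : 0 <= pG w.
Proof. by apply: fine_ge0; apply: nint_ge0 => z; exact: npot_ge0. Qed.

Let far_bound : exists2 K : R, 0 <= K & forall w, K < normc (zeta w) ->
  normc (G w) <= b * (normc (Phi w) * pG w).
Proof.
have [K K0 hK] := npot_vanishing HP HF (divr_gt0 nc0 (ltr0n _ 2)).
exists K => // w Kw.
have h : normc c * normc (G w) <= normc (G w) * (normc c / 2) + normc (Phi w) * pG w.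
  rewrite -[leLHS]Normc.normcM cG; apply: (le_trans (ler_normcB _ _)).
  rewrite [normc (G w * _)]Normc.normcM [normc (Phi w * _)]Normc.normcM.
  apply: lerD; apply: ler_wpM2l; rewrite ?normc_ge0// -lee_fin.
    apply: le_trans (hK w Kw); apply: normc_pot_le => //.
    by apply: le_lt_trans (hK w Kw) _; rewrite ltry.
  by rewrite -pGE; apply: normc_pot_le => //; rewrite pGE ltry.
have -> : normc (G w) = b * (normc c / 2 * normc (G w)).
  by rewrite /b; field; rewrite gt_eqF.
by rewrite ler_wpM2l ?(ltW b0)//; lra.
Qed.

(* [pG] is only known to grow linearly: the weight [phi e] makes its supremum
   finite, and by [phi_ck] it passes through the kernel at the cost of [e]. *)
Let phi (e : R) w : R := (1 + e * normc (zeta w))^-1.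

Let phi_den (e : R) w : 0 <= e -> 0 < 1 + e * normc (zeta w).
Proof. by move=> e0; rewrite ltr_pwDl// mulr_ge0// normc_ge0. Qed.

Let phi_ge0 (e : R) w : 0 <= e -> 0 <= phi e w.
Proof. by move=> e0; rewrite invr_ge0 ltW// phi_den. Qed.

Let phi_le1 (e : R) w : 0 <= e -> phi e w <= 1.
Proof. by move=> e0; rewrite invf_le1 ?phi_den// lerDl mulr_ge0// normc_ge0. Qed.

Let phi_ck (e : R) w z : 0 <= e -> phi e w * ck w z <= phi e z * (ck w z + e).
Proof.
move=> e0; have dw := phi_den w e0; have dz := phi_den z e0.
have [wz|wz] := eqVneq (normc (zeta z - zeta w)) 0.
  by rewrite /ck wz invr0 mulr0 add0r mulr_ge0// phi_ge0.
have n0 : 0 < normc (zeta z - zeta w) by rewrite lt_def wz normc_ge0.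
rewrite /phi mulrC ler_pdivrMr// -mulrA ler_pdivlMl//.
have -> : (ck w z + e) * (1 + e * normc (zeta w)) =
  (1 + e * normc (zeta z - zeta w)) * (1 + e * normc (zeta w)) * ck w z.
  by rewrite /ck; field.
(* What remains is [1 + e |zeta z| <= (1 + e |zeta z - zeta w|) (1 + e |zeta w|)], a consequence of
   the triangle inequality. *)
apply: ler_wpM2r; first exact: ck_ge0.
have := ler_normcD (zeta z - zeta w) (zeta w); rewrite subrK => h.
have := ler_wpM2l e0 h; have : 0 <= (e * normc (zeta z - zeta w)) * (e * normc (zeta w)).
  by rewrite !mulr_ge0 ?normc_ge0.
lra.
Qed.

(** A self-improving estimate in which [C] does not depend on [e]. On the near part [G] is
    controlled by [T]. On the far part [far_bound] brings back [pG] under the integral, [phi_ck]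
    moves the weight onto it, and [S] can be taken out. *)
Let weighted_bound : exists2 C : R, 0 <= C & exists2 e0 : R, 0 < e0 &
  forall e, 0 < e -> e <= e0 -> forall S : R, 0 <= S -> (forall w, phi e w * pG w <= S) ->
  forall w, phi e w * pG w <= C + S / 2.
Proof.
have [K1 K10 hK1] := far_bound.
have [M M0 [hM IM]] := inH_mul HP HF.
have [M' M'0 [hM' IM']] := inH_mul HT HF.
have mm := measurable_normc_mul mP mF.
have [mT _ _] := HT.
have mmT := measurable_normc_mul mT mF.
have mmG := measurable_normc_mul mG mF.
(* The far part is at most [b * S] times a tail integral plus [b * S * e * M]. This tail level and
   the choice of [e0] below make each summand at most [S / 4]. *)
have b4 : 0 < (4 * b)^-1 by rewrite invr_gt0 mulr_gt0.
have [K2 K20 hK2] := ck_tail mm hM (le_lt_trans IM (ltry _)) b4.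
pose K := Num.max K1 K2; pose A := (K + normc a) * M'.
have K0 : 0 <= K by rewrite le_max K10.
have Ka : 0 <= K + normc a by rewrite addr_ge0// normc_ge0.
have A0 : 0 <= A by rewrite mulr_ge0.
exists (16 * 1 * A + A / 1); first by rewrite addr_ge0 ?divr_ge0 ?mulr_ge0.
exists (4 * b * (M + 1))^-1; first by rewrite invr_gt0 mulr_gt0 ?ltr_wpDl// mulr_gt0.
move=> e ep ee0 S S0 hS w; have e0 := ltW ep.
have bS0 := mulr_ge0 (ltW b0) S0; have bSe0 := mulr_ge0 bS0 e0.
rewrite -lee_fin EFinM -pGE (npot_far K w mG mF).
rewrite ge0_muleDr; last 2 first.
- apply: nint_ge0 => z; have /andP[f0 f1] := far01 K z.
  by rewrite !mulr_ge0 ?normc_ge0 ?ck_ge0// subr_ge0.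
- by apply: nint_ge0 => z; have /andP[f0 f1] := far01 K z; rewrite !mulr_ge0 ?normc_ge0 ?ck_ge0.
rewrite EFinD; apply: leeD.
  apply: (@le_trans _ _ (1%:E * \int[leb2]_z (normc (G z) * normc (F z) * (1 - far K z) * ck w z)%:E)%E).
    apply: lee_wpmul2r; last by rewrite lee_fin phi_le1.
    apply: nint_ge0 => z; have /andP[f0 f1] := far01 K z.
    by rewrite !mulr_ge0 ?normc_ge0 ?ck_ge0// subr_ge0.
  rewrite mul1e.
  have near z : normc (G z) * normc (F z) * (1 - far K z) <= (K + normc a) * (normc (T z) * normc (F z)).
    rewrite /far; case: ltP => [_|zK].
      by rewrite subrr mulr0 !mulr_ge0 ?normc_ge0.
    rewrite subr0 mulr1 /G Normc.normcM -!mulrA; apply: ler_wpM2r; first by rewrite mulr_ge0 ?normc_ge0.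
    by apply: (le_trans (ler_normcB _ _)); rewrite lerD2r.
  have near0 z : 0 <= normc (G z) * normc (F z) * (1 - far K z).
    by have /andP[f0 f1] := far01 K z; rewrite !mulr_ge0 ?normc_ge0// subr_ge0.
  apply: ck_integral_le => //.
  - by apply: measurable_funM => //; exact: measurable_near_part.
  - move=> z; rewrite near0/=; apply: (le_trans (near z)).
    by apply: ler_wpM2l => //; have /andP[] := hM' z.
  - apply: (@le_trans _ _ (\int[leb2]_z ((K + normc a) * (normc (T z) * normc (F z)))%:E)%E).
      apply: le_nint => //.
      + by apply: measurable_funM => //; exact: measurable_near_part.
      + exact: measurable_funM.
    rewrite nintZ//; last by move=> z; have /andP[] := hM' z.
    by rewrite EFinM; apply: lee_wpmul2l; rewrite ?lee_fin.
have mfar1 : measurable_fun setT (fun z => normc (G z) * normc (F z) * far K z * ck w z).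
  apply: measurable_funM; last exact: measurable_ck.
  by apply: measurable_funM => //; exact: measurable_far.
have mfar2 : measurable_fun setT (fun z => normc (Phi z) * normc (F z) * far K2 z * ck w z).
  apply: measurable_funM; last exact: measurable_ck.
  by apply: measurable_funM => //; exact: measurable_far.
rewrite -nintZ ?phi_ge0//; last first.
  by move=> z; have /andP[f0 f1] := far01 K z; rewrite !mulr_ge0 ?normc_ge0 ?ck_ge0.
have far2_ge0 z : 0 <= normc (Phi z) * normc (F z) * far K2 z * ck w z.
  by have /andP[f0 f1] := far01 K2 z; rewrite !mulr_ge0 ?normc_ge0 ?ck_ge0.
apply: (@le_trans _ _ ((b * S)%:E * \int[leb2]_z (normc (Phi z) * normc (F z) * far K2 z * ck w z)%:E +
   (b * S * e)%:E * \int[leb2]_z (normc (Phi z) * normc (F z))%:E)%E).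
  apply: le_nint_lin => //.
  - exact: measurable_funM.
  - by move=> z; have /andP[f0 f1] := far01 K z; rewrite !mulr_ge0 ?phi_ge0 ?normc_ge0 ?ck_ge0.
  - by move=> z; have /andP[] := hM z.
  - move=> z; rewrite {1}/far; case: ltP => [Kz|_]; last first.
      rewrite mulr0 mul0r mulr0; apply: (addr_ge0 (mulr_ge0 bS0 (far2_ge0 z))).
      exact: (mulr_ge0 (mulr_ge0 bS0 e0) (mulr_ge0 (normc_ge0 _) (normc_ge0 _))).
    move: Kz; rewrite gt_max => /andP[z1 z2].
    rewrite /far z2 !mulr1.
    have g1 := hK1 z z1; have ph := phi_ck w z e0; have s1 := hS z.
    have r0 : 0 <= normc (Phi z) * normc (F z) by rewrite mulr_ge0 ?normc_ge0.
    have ck0 : 0 <= ck w z + e by rewrite addr_ge0// ck_ge0.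
    have A1 : 0 <= b * (normc (Phi z) * pG z) * normc (F z).
      exact: (mulr_ge0 (mulr_ge0 (ltW b0) (mulr_ge0 (normc_ge0 _) (pG_ge0 z))) (normc_ge0 _)).
    have A2 : 0 <= b * (normc (Phi z) * normc (F z)) * (ck w z + e).
      exact: (mulr_ge0 (mulr_ge0 (ltW b0) r0) ck0).
    apply: (@le_trans _ _ ((b * (normc (Phi z) * pG z) * normc (F z)) * (phi e w * ck w z))).
      rewrite [leLHS]mulrCA; apply: ler_wpM2r; first by rewrite mulr_ge0 ?phi_ge0 ?ck_ge0.
      by apply: ler_wpM2r => //; exact: normc_ge0.
    apply: (@le_trans _ _ ((b * (normc (Phi z) * pG z) * normc (F z)) * (phi e z * (ck w z + e)))).
      exact: ler_wpM2l A1 _ _ ph.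
    rewrite (_ : _ * _ = (b * (normc (Phi z) * normc (F z)) * (ck w z + e)) * (phi e z * pG z)); last by ring.
    apply: (@le_trans _ _ ((b * (normc (Phi z) * normc (F z)) * (ck w z + e)) * S)).
      exact: ler_wpM2l A2 _ _ s1.
    by rewrite le_eqVlt; apply/orP; left; apply/eqP; ring.
apply: (@le_trans _ _ ((b * S)%:E * ((4 * b)^-1)%:E + (b * S * e)%:E * M%:E)%E).
  by apply: leeD; apply: lee_wpmul2l; rewrite ?lee_fin ?hK2.
rewrite -!EFinM -EFinD lee_fin.
have -> : b * S / (4 * b) = S / 4 by field; rewrite gt_eqF.
have : b * S * e * M <= S / 4.
  apply: (@le_trans _ _ (b * S * (4 * b * (M + 1))^-1 * M)).
    by apply: ler_wpM2r => //; exact: ler_wpM2l bS0 _ _ ee0.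
  have -> : b * S / (4 * b * (M + 1)) * M = S / 4 * (M / (M + 1)).
    by field; rewrite !gt_eqF// ltr_wpDl.
  apply: ler_piMr; first by rewrite divr_ge0.
  by rewrite ler_pdivrMr ?ltr_wpDl// mul1r lerDl.
lra.
Qed.

(** For each [e] the supremum of [phi e w * pG w] is finite, as [pG] grows at most linearly. Taken
    as [S] in [weighted_bound] it satisfies [S <= C + S / 2], hence is at most [2 * C] whatever
    [e]. *)
Let pG_bounded : exists2 C : R, 0 <= C & forall w, pG w <= C.
Proof.
have [C C0 [e0 e0p h]] := weighted_bound.
have [D D0 hD] := npot_mulz a HT HF.
have pGD w : pG w <= D * wt w by rewrite -lee_fin -pGE; exact: hD.
have key e : 0 < e -> e <= e0 -> forall w, phi e w * pG w <= 2 * C.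
  move=> ep ee0; have e_ge0 := ltW ep.
  pose E := [set phi e w * pG w | w in setT].
  have E0 : E !=set0 by exists (phi e (0, 0) * pG (0, 0)), (0, 0).
  have ub : ubound E (D * (1 + e^-1)).
    move=> _ [w _ <-].
    apply: (@le_trans _ _ (phi e w * (D * wt w))); first by rewrite ler_wpM2l ?phi_ge0.
    rewrite mulrCA; apply: ler_wpM2l => //.
    rewrite /phi mulrC ler_pdivrMr ?phi_den// /wt.
    rewrite mulrDl mul1r mulrDr mulr1 mulrA mulVf ?gt_eqF// mul1r.
    have : 0 <= e^-1 by rewrite invr_ge0.
    have : 0 <= e * normc (zeta w) by rewrite mulr_ge0// normc_ge0.
    lra.
  have hs : has_sup E by split=> //; exists (D * (1 + e^-1)).
  have sub w : phi e w * pG w <= sup E.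
    by apply: ub_le_sup; [exact: hs.2|exists w].
  have S0 : 0 <= sup E by apply: le_trans (sub (0, 0)); rewrite mulr_ge0 ?phi_ge0.
  have : sup E <= C + sup E / 2.
    apply: ge_sup => // _ [w _ <-]; exact: (h e ep ee0 _ S0 sub w).
  move=> hsup w; apply: (le_trans (sub w)); lra.
exists (4 * C); first by rewrite mulr_ge0.
(* With [e] adapted to [w] the weight [phi e w] is at least one half, which costs the factor from
   [2 * C] to [4 * C]. *)
move=> w; pose e := Num.min e0 (wt w)^-1.
have ep : 0 < e by rewrite lt_min e0p invr_gt0 wt_gt0.
have ee0 : e <= e0 by rewrite ge_min lexx.
have ew : e <= (wt w)^-1 by rewrite ge_min lexx orbT.
have := key e ep ee0 w; rewrite /phi mulrC ler_pdivrMr ?phi_den ?(ltW ep)// => /le_trans; apply.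
rewrite (_ : 4 * C = 2 * C * 2); last by ring.
apply: ler_wpM2l; first by rewrite mulr_ge0.
rewrite (_ : 2 = 1 + 1 :> R)// lerD2l.
apply: (@le_trans _ _ ((wt w)^-1 * wt w)); last by rewrite mulVf// gt_eqF// wt_gt0.
by apply: ler_pM => //; [exact: ltW|exact: normc_ge0|rewrite /wt lerDr].
Qed.

Lemma bootstrap_inH : inH G.
Proof.
have [_ _ rG] : inE G := inE_mulz a HT.
split=> //.
have [K K0 hK] := far_bound; have [C C0 hC] := pG_bounded.
have [mT sT _] := HT; have [_ sP _] := HP.
have Ka : 0 <= K + normc a by rewrite addr_ge0// normc_ge0.
apply: (@le_nint_lin_fin _ _ _ _ ((K + normc a) ^+ 2) ((b * C) ^+ 2) _
    (fun z => normc (T z) ^+ 2) (fun z => normc (Phi z) ^+ 2)) => //.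
  - exact: measurable_sqr_normc.
  - exact: measurable_sqr_normc.
  - exact: measurable_sqr_normc.
  - by move=> z; exact: sqr_ge0.
  - by move=> z; exact: sqr_ge0.
  - by move=> z; exact: sqr_ge0.
  - exact: sqr_ge0.
  - exact: sqr_ge0.
  - move=> z; rewrite -!exprMn.
    have [zK|zK] := leP (normc (zeta z)) K.
      apply: (@le_trans _ _ (((K + normc a) * normc (T z)) ^+ 2)); last by rewrite lerDl sqr_ge0.
      have k0 : 0 <= (K + normc a) * normc (T z) by rewrite mulr_ge0// normc_ge0.
      rewrite lerXn2r ?nnegrE ?normc_ge0// /G Normc.normcM; apply: ler_wpM2r; first exact: normc_ge0.
      by apply: (le_trans (ler_normcB _ _)); rewrite lerD2r.
    apply: (@le_trans _ _ ((b * C * normc (Phi z)) ^+ 2)); last by rewrite lerDr sqr_ge0.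
    have k0 : 0 <= b * C * normc (Phi z) := mulr_ge0 (mulr_ge0 (ltW b0) C0) (normc_ge0 _).
    rewrite lerXn2r ?nnegrE ?normc_ge0//; apply: (le_trans (hK z zK)).
    rewrite -mulrA ler_wpM2l ?(ltW b0)// mulrC ler_wpM2r ?normc_ge0//.
Qed.

End bootstrap.

(** * Mixed systems *)

Section mixed_systems.
Context {R : realType}.
Local Notation P := (measurableTypeR R * measurableTypeR R)%type.
Implicit Types (p q w z l : P) (Phi F K : P -> R[i]).

Variables (Ls L1 L2 : set P) (H : P -> P -> R[i]) (l0 : P).
Hypothesis uniq : forall Phi, inH Phi -> (forall l, Ls l -> Phi l = 0) -> forall p, Phi p = 0.
Hypothesis Ls_cases : forall l, Ls l -> L1 l \/ L2 l.
Hypothesis HH : forall l, Ls l -> inH (H l).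
Hypothesis H_offdiag : forall l l', Ls l -> Ls l' -> l' <> l -> H l l' = 0.
Hypothesis H_diag : forall l, Ls l -> H l l != 0.
Hypothesis Ls0 : Ls l0.

(** [H l] plays the transform of the biorthogonal element of index [l]; these are the conditions
    that membership in the orthogonal complement imposes on a transform. *)
Definition admissible Phi := [/\ inH Phi, forall l, L2 l -> Phi l = 0 &
  forall l, L1 l -> ip leb2 (H l) Phi = 0].

Let G q := (zeta q - zeta l0) * H l0 q.

Let EG : inE G. Proof. exact: inE_mulz (HH Ls0). Qed.

Let G_Ls l : Ls l -> G l = 0.
Proof.
move=> Ll; have [->|ll] := pselect (l = l0); first by rewrite /G subrr mul0r.
by rewrite /G (H_offdiag Ls0 Ll ll) mulr0.
Qed.

(** Otherwise [H l0] would vanish off [l0], hence almost everywhere, and the reproducing formula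
    would give [H l0 l0 = 0]. *)
Let G_neq0 : exists w, G w != 0.
Proof.
apply: contrapT => h; have G0 w : G w = 0.
  by apply/eqP; apply: contrapT => /negP ?; apply: h; exists w.
have [mH _ rH] := HH Ls0; have /eqP := H_diag Ls0; apply.
rewrite rH -(cint0 leb2); apply: ae_eq_cint.
- by apply: cmeasM => //; exact: cmeas_krl.
- exact: cmeas_cst.
- apply: filterS (ae_zeta_neq (zeta l0)) => z z0.
  have /eqP := G0 z; rewrite /G mulf_eq0 subr_eq0 (negbTE z0)/= => /eqP ->.
  by rewrite mulr0.
Qed.

(** Dividing out the extra zero leaves a function of [inH] that still vanishes on [Ls], to which
    [uniq] applies. *)
Lemma inE_unique K w : inE K -> (forall l, Ls l -> K l = 0) -> K w = 0 -> ~ Ls w ->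
  forall p, K p = 0.
Proof.
move=> EK KL Kw Lw p; have [Psi HPsi KE] := inE_div EK Kw.
rewrite KE (uniq HPsi) ?mulr0// => l Ll.
have := KL l Ll; rewrite KE => /eqP; rewrite mulf_eq0 => /orP[|/eqP//].
by rewrite subr_eq0 => /eqP /zeta_inj lw; exfalso; apply: Lw; rewrite -lw.
Qed.

Let G_zeros w : G w = 0 -> Ls w.
Proof.
move=> Gw; apply: contrapT => Lw; have [w0 /eqP] := G_neq0; apply.
exact: inE_unique EG G_Ls Gw Lw w0.
Qed.

Let G_div l : Ls l -> exists c : R[i], forall q, zeta q != zeta l ->
  G q / (zeta q - zeta l) = c * H l q.
Proof.
move=> Ll; have [Psi HPsi GE] := inE_div EG (G_Ls Ll).
(* [Psi] and this multiple of [H l] agree at [l] and both vanish on the rest of [Ls]; uniqueness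
   makes them equal. *)
exists (Psi l / H l l) => q ql.
rewrite GE mulrAC divff ?subr_eq0// mul1r; apply/eqP; rewrite -subr_eq0; apply/eqP.
have HK : inH (fun q => Psi q + - (Psi l / H l l) * H l q).
  exact: inH_D HPsi (inH_Z _ (HH Ll)).
have := uniq HK _ q; rewrite mulNr; apply => l' Ll'.
have [->|ll] := pselect (l' = l).
  by rewrite mulNr divfK ?subrr// H_diag.
rewrite (H_offdiag Ll Ll' ll) mulr0 addr0.
have := G_Ls Ll'; rewrite GE => /eqP; rewrite mulf_eq0 => /orP[|/eqP//].
by rewrite subr_eq0 => /eqP /zeta_inj.
Qed.

Let pot_G l F : Ls l -> L1 l -> admissible F -> pot G F l = 0.
Proof.
move=> Ll L1l [HF _ F1]; have [c hc] := G_div Ll.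
have [mG _ _] := EG; have [mF _ _] := HF; have [mH _ _] := HH Ll.
transitivity (cint leb2 (fun z => c * (H l z * conjc (F z)))).
  apply: ae_eq_cint.
  - apply: cmeas_div; last by apply: cmeasB; [exact: cmeas_zeta|exact: cmeas_cst].
    by apply: cmeasM => //; exact: cmeas_conj.
  - apply: cmeasM; first exact: cmeas_cst.
    by apply: cmeasM => //; exact: cmeas_conj.
  - by apply: filterS (ae_zeta_neq (zeta l)) => z zl; rewrite mulrAC hc// mulrA.
rewrite cintZ; last by apply: cintegrable_mul; apply: inH_csq => //; exact: HH.
by rewrite -/(ip leb2 (H l) F) F1// mulr0.
Qed.

Let wronsk_Ls Phi F l : admissible Phi -> admissible F -> Ls l -> wronsk Phi G F l = 0.
Proof.
move=> [_ P2 _] aF Ll; rewrite /wronsk G_Ls// mul0r sub0r.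
have [L1l|L2l] := Ls_cases Ll; first by rewrite pot_G// mulr0 oppr0.
by rewrite P2// mul0r oppr0.
Qed.

Let wronsk_G Phi F w : admissible Phi -> admissible F -> wronsk Phi G F w = 0.
Proof.
move=> aP aF; have [HP _ _] := aP; have [HF _ _] := aF.
have EW : inE (wronsk Phi G F) := inE_wronsk (zeta l0) HP (HH Ls0) HF.
have [w0 Gw0] := G_neq0.
pose c := wronsk Phi G F w0 / G w0.
have cG v : c * G v = wronsk Phi G F v.
  apply/eqP; rewrite eq_sym -subr_eq0; apply/eqP.
  have EK : inE (fun q => wronsk Phi G F q + - c * G q).
    exact: inE_D EW (inE_Z _ EG).
  have K1 l : Ls l -> wronsk Phi G F l + - c * G l = 0.
    by move=> Ll; rewrite wronsk_Ls// G_Ls// mulr0 addr0.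
  have K2 : wronsk Phi G F w0 + - c * G w0 = 0 by rewrite /c mulNr divfK// subrr.
  have K3 : ~ Ls w0 by move=> /G_Ls/eqP; exact/negP.
  by rewrite -mulNr; exact: (inE_unique EK K1 K2 K3 v).
have [c0|c0] := eqVneq c 0; first by rewrite -cG c0 mul0r.
have HG : inH G := bootstrap_inH HP HF (HH Ls0) c0 cG.
by move: Gw0; rewrite (uniq HG G_Ls) eqxx.
Qed.

(** By [wronsk_G] the potential of each admissible function is that function times the same factor
    [pot G F w / G w], so the two products in the Wronskian coincide where [G w] is nonzero. *)
Lemma admissible_wronsk Phi1 Phi2 F w : admissible Phi1 -> admissible Phi2 -> admissible F ->
  ~ Ls w -> wronsk Phi1 Phi2 F w = 0.
Proof.
move=> a1 a2 aF Lw; have Gw : G w != 0 by apply/eqP => /G_zeros.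
have e1 : G w * pot Phi1 F w = Phi1 w * pot G F w.
  by apply/eqP; rewrite -subr_eq0; apply/eqP; exact: wronsk_G.
have e2 : G w * pot Phi2 F w = Phi2 w * pot G F w.
  by apply/eqP; rewrite -subr_eq0; apply/eqP; exact: wronsk_G.
apply: (mulfI Gw); rewrite mulr0 /wronsk mulrBr mulrCA e1 [G w * _]mulrCA e2.
by ring.
Qed.

End mixed_systems.

(** * From vanishing Wronskians to a determinant of inner products *)

Section wronskian_pairing.
Context {R : realType}.
Local Notation P := (measurableTypeR R * measurableTypeR R)%type.
Implicit Types (p q w z l : P).

Definition clamp (N x : R) : R := Num.max (- N) (Num.min N x).

Lemma clamp_lip (N x y : R) : `|clamp N x - clamp N y| <= `|x - y|.
Proof.
have hp := ler_norm (x - y); have := ler_norm (- (x - y)); rewrite normrN => hn.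
rewrite ler_norml /clamp !maxEle !minEle; apply/andP.
case: (lerP N x) => h1; case: (lerP N y) => h2.
- by case: (lerP (- N) N) => h3; split; lra.
- by case: (lerP (- N) N) => h3; case: (lerP (- N) y) => h4; split; lra.
- by case: (lerP (- N) N) => h3; case: (lerP (- N) x) => h4; split; lra.
- by case: (lerP (- N) x) => h3; case: (lerP (- N) y) => h4; split; lra.
Qed.

Lemma clamp_id (N x : R) : `|x| <= N -> clamp N x = x.
Proof. by rewrite ler_norml => /andP[h1 h2]; rewrite /clamp (min_idPr h2) (max_idPr h1). Qed.

Lemma clamp_le (N x : R) : 0 <= N -> `|clamp N x| <= N.
Proof.
move=> N0; rewrite ler_norml /clamp le_max lexx/= ge_max; apply/andP; split; first lra.
by rewrite ge_min lexx.
Qed.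

Lemma measurable_clamp (N : R) : measurable_fun setT (clamp N : measurableTypeR R -> measurableTypeR R).
Proof. by apply: measurable_maxr => //; exact: measurable_minr. Qed.

(** A bounded substitute for [zeta]. It is 1-Lipschitz in [zeta], so [zclamp N z - zclamp N w] over
    [zeta z - zeta w] has modulus at most 1, uniformly in [N]. *)
Definition zclamp (N : R) q : R[i] := clamp N q.1 -i* clamp N q.2.

Lemma cmeas_zclamp (N : R) : cmeas (zclamp N).
Proof.
apply: cmeas_ReIm.
- exact: (measurableT_comp (measurable_clamp N) measurable_fst).
- by apply: measurable_funN; exact: (measurableT_comp (measurable_clamp N) measurable_snd).
Qed.

Lemma zclamp_lip (N : R) z w : normc (zclamp N z - zclamp N w) <= normc (zeta z - zeta w).
Proof.
rewrite -(@ler_pXn2r _ 2)// ?nnegrE ?normc_ge0// !sqr_normc /=.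
rewrite -!opprD !sqrrN; apply: lerD.
  by rewrite -[leLHS]real_normK ?num_real// -[leRHS]real_normK ?num_real// lerXn2r ?nnegrE// clamp_lip.
by rewrite -[leLHS]real_normK ?num_real// -[leRHS]real_normK ?num_real// lerXn2r ?nnegrE// clamp_lip.
Qed.

Lemma zclamp_le (N : R) z : 0 <= N -> normc (zclamp N z) <= N + N.
Proof.
move=> N0; apply: (le_trans (ler_normc_ReIm _)) => /=.
by rewrite normrN lerD// clamp_le.
Qed.

Lemma zclamp_near (N : R) z : normc (zeta z) <= N -> zclamp N z = zeta z.
Proof.
move=> h; apply: complexP => /=.
  by rewrite clamp_id// (le_trans _ h)//; exact: (ler_Re_normc (zeta z)).
congr (- _); rewrite clamp_id// (le_trans _ h)//.
by rewrite -normrN; exact: (ler_Im_normc (zeta z)).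
Qed.

Variables Phi1 Phi2 F1 F2 : P -> R[i].
Hypotheses (HP1 : inH Phi1) (HP2 : inH Phi2) (HF1 : inH F1) (HF2 : inH F2).

(** A single bounded and integrable density that dominates every product of one [Phi] with one
    [F]. *)
Let s z : R := (normc (Phi1 z) + normc (Phi2 z)) * (normc (F1 z) + normc (F2 z)).

Let s_ge0 z : 0 <= s z. Proof. by rewrite mulr_ge0 ?addr_ge0 ?normc_ge0. Qed.

Let cm1 : cmeas Phi1. Proof. by case: HP1. Qed.
Let cm2 : cmeas Phi2. Proof. by case: HP2. Qed.
Let cf1 : cmeas F1. Proof. by case: HF1. Qed.
Let cf2 : cmeas F2. Proof. by case: HF2. Qed.

Let measurable_s : measurable_fun setT s.
Proof. by apply: measurable_funM; apply: measurable_funD; exact: measurable_normc. Qed.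

Let s_bound : exists2 S : R, 0 <= S &
  (forall z, 0 <= s z <= S) /\ (\int[leb2]_z (s z)%:E <= S%:E)%E.
Proof.
have [A A0 [hA IA]] := inH_mul HP1 HF1; have [B B0 [hB IB]] := inH_mul HP1 HF2.
have [C C0 [hC IC]] := inH_mul HP2 HF1; have [D D0 [hD ID]] := inH_mul HP2 HF2.
have sE z : s z = (normc (Phi1 z) * normc (F1 z) + normc (Phi1 z) * normc (F2 z)) +
    (normc (Phi2 z) * normc (F1 z) + normc (Phi2 z) * normc (F2 z)) by rewrite /s; ring.
exists ((A + B) + (C + D)); first by rewrite !addr_ge0.
split=> [z|].
  rewrite s_ge0/= sE; have /andP[_ a] := hA z; have /andP[_ b] := hB z.
  have /andP[_ c] := hC z; have /andP[_ d] := hD z; lra.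
under eq_integral do rewrite sE.
have nn (f g : P -> R[i]) z : 0 <= normc (f z) * normc (g z) by rewrite mulr_ge0 ?normc_ge0.
have mn (f g : P -> R[i]) : cmeas f -> cmeas g -> measurable_fun setT (fun z => normc (f z) * normc (g z)).
  exact: measurable_normc_mul.
rewrite nintD.
- rewrite nintD; [|exact: mn|exact: mn|exact: nn|exact: nn].
  rewrite nintD; [|exact: mn|exact: mn|exact: nn|exact: nn].
  by rewrite !EFinD; apply: leeD; exact: leeD.
- by apply: measurable_funD; exact: mn.
- by apply: measurable_funD; exact: mn.
- by move=> z; rewrite addr_ge0 ?nn.
- by move=> z; rewrite addr_ge0 ?nn.
Qed.

(* [X] is symmetric up to exchanging [F1] and [F2], so in the integral of
   [(zeta z - zeta w) * X (z, w)] the first term vanishes by [W2] and the second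
   by [W1]; [zclamp] makes the two terms integrable. *)
Let X (zw : P * P) : R[i] := (Phi1 zw.1 * Phi2 zw.2 - Phi1 zw.2 * Phi2 zw.1) /
  (zeta zw.1 - zeta zw.2) * conjc (F1 zw.1) * conjc (F2 zw.2).

Let mfst : measurable_fun setT (fst : P * P -> P). Proof. exact: measurable_fst. Qed.
Let msnd : measurable_fun setT (snd : P * P -> P). Proof. exact: measurable_snd. Qed.

Let cX : cmeas X.
Proof.
apply: cmeasM; last by apply: cmeas_conj; exact: (cmeas_comp cf2 msnd).
apply: cmeasM; last by apply: cmeas_conj; exact: (cmeas_comp cf1 mfst).
apply: cmeas_div.
  by apply: cmeasB; apply: cmeasM;
   [exact: (cmeas_comp cm1 mfst)|exact: (cmeas_comp cm2 msnd)|
    exact: (cmeas_comp cm1 msnd)|exact: (cmeas_comp cm2 mfst)].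
by apply: cmeasB; [exact: (cmeas_comp cmeas_zeta mfst)|exact: (cmeas_comp cmeas_zeta msnd)].
Qed.

Let num_le z w : normc ((Phi1 z * Phi2 w - Phi1 w * Phi2 z) * conjc (F1 z) * conjc (F2 w)) <=
  2 * (s z * s w).
Proof.
rewrite [normc (_ * conjc (F2 w))]Normc.normcM [normc (_ * conjc (F1 z))]Normc.normcM !normc_conj.
have := ler_normcB (Phi1 z * Phi2 w) (Phi1 w * Phi2 z).
rewrite [normc (Phi1 z * _)]Normc.normcM [normc (Phi1 w * _)]Normc.normcM.
set D := normc (_ - _); rewrite /s.
have := normc_ge0 (Phi1 z); have := normc_ge0 (Phi2 z); have := normc_ge0 (Phi1 w).
have := normc_ge0 (Phi2 w); have := normc_ge0 (F1 z); have := normc_ge0 (F2 z).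
have := normc_ge0 (F1 w); have := normc_ge0 (F2 w).
move: (normc (Phi1 z)) (normc (Phi2 z)) (normc (Phi1 w)) (normc (Phi2 w)) => a b c d.
move: (normc (F1 z)) (normc (F2 z)) (normc (F1 w)) (normc (F2 w)) D => f g h k D.
move=> k0 h0 g0 f0 d0 c0 b0 a0 hD.
apply: (@le_trans _ _ ((a * d + c * b) * (f * k))).
  by rewrite -mulrA ler_wpM2r// mulr_ge0.
rewrite (_ : 2 * _ = (2 * ((a + b) * (c + d))) * ((f + g) * (h + k))); last by ring.
apply: ler_pM; rewrite ?mulr_ge0 ?addr_ge0 ?mulr_ge0//.
- by have := mulr_ge0 a0 c0; have := mulr_ge0 b0 d0; have := mulr_ge0 a0 d0; have := mulr_ge0 b0 c0; lra.
- by apply: ler_pM => //; rewrite ?lerDl ?lerDr.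
Qed.

Let X_le z w : normc (X (z, w)) <= 2 * (s z * (s w * ck z w)).
Proof.
rewrite (_ : X (z, w) = (Phi1 z * Phi2 w - Phi1 w * Phi2 z) * conjc (F1 z) * conjc (F2 w) /
   (zeta z - zeta w)); last by rewrite /X /=; ring.
rewrite normc_div -/(ck w z) ckC (_ : 2 * (s z * _) = 2 * (s z * s w) * ck z w); last by ring.
by apply: ler_wpM2r; [exact: ck_ge0|exact: num_le].
Qed.

Let X_integrable : cintegrable (leb2 \x leb2)%E X.
Proof.
split=> //; have mX := measurable_normc cX.
have [S S0 [hS IS]] := s_bound.
rewrite nint_prod//; last by move=> zw; exact: normc_ge0.
apply: (@le_lt_trans _ _ (\int[leb2]_z ((2 * (16 * 1 * S + S / 1)) * s z)%:E)%E); last first.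
  rewrite nintZ//; last by rewrite mulr_ge0// addr_ge0 ?divr_ge0// mulr_ge0.
  apply: (@le_lt_trans _ _ ((2 * (16 * 1 * S + S / 1))%:E * S%:E)%E); last by rewrite -EFinM ltry.
  by apply: lee_wpmul2l => //; rewrite lee_fin mulr_ge0// addr_ge0 ?divr_ge0// mulr_ge0.
apply: ge0_le_integral; first exact: measurableT.
- by move=> z _; apply: nint_ge0 => w; exact: normc_ge0.
- exact: (measurable_nint leb2 mX (fun _ => normc_ge0 _)).
- by apply/measurable_EFinP; exact: measurable_funM.
move=> z _.
have mck : measurable_fun setT (fun w => s w * ck z w).
  by apply: measurable_funM => //; exact: measurable_ck.
apply: (@le_trans _ _ (\int[leb2]_w ((2 * s z) * (s w * ck z w))%:E)%E).
  apply: le_nint.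
  - exact: (measurableT_comp mX (pair1_measurable z)).
  - exact: measurable_funM.
  - by move=> w; exact: normc_ge0.
  - by move=> w; rewrite -mulrA; exact: X_le.
rewrite nintZ//; [|by move=> w; rewrite mulr_ge0 ?ck_ge0|by rewrite mulr_ge0].
rewrite (_ : 2 * _ * s z = (2 * s z) * (16 * 1 * S + S / 1)); last by ring.
rewrite [X in (_ <= X)%E]EFinM; apply: lee_wpmul2l; first by rewrite lee_fin mulr_ge0.
exact: ck_integral_le.
Qed.

Hypothesis W1 : {ae leb2, forall w, wronsk Phi1 Phi2 F1 w = 0}.
Hypothesis W2 : {ae leb2, forall w, wronsk Phi1 Phi2 F2 w = 0}.

Let npot_fin (f g : P -> R[i]) w : inH f -> inH g -> (npot f g w < +oo)%E.
Proof. by move=> Hf Hg; have [C _ /(_ w) h] := npot_inH Hf Hg; apply: le_lt_trans h _; rewrite ltry. Qed.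

Let cint_X_snd z : cint leb2 (fun w => X (z, w)) = conjc (F1 z) * wronsk Phi1 Phi2 F2 z.
Proof.
rewrite wronsk_cint ?npot_fin// -cintZ.
  apply: eq_cint => w; rewrite /X /= -(opprB (zeta w)) invrN; set d := (zeta w - zeta z)^-1; ring.
rewrite (_ : (fun w => _) = (fun w => Phi2 z * (Phi1 w * conjc (F2 w) / (zeta w - zeta z)) -
     Phi1 z * (Phi2 w * conjc (F2 w) / (zeta w - zeta z)))).
  by apply: cintegrableB; apply: cintegrableZ; apply: pot_integrable; rewrite ?npot_fin.
by apply/funext => w; ring.
Qed.

Let cint_X_fst w : cint leb2 (fun z => X (z, w)) = conjc (F2 w) * wronsk Phi1 Phi2 F1 w.
Proof.
rewrite wronsk_cint ?npot_fin// -cintZ.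
  by apply: eq_cint => z; rewrite /X /=; ring.
rewrite (_ : (fun z => _) = (fun z => Phi2 w * (Phi1 z * conjc (F1 z) / (zeta z - zeta w)) -
     Phi1 w * (Phi2 z * conjc (F1 z) / (zeta z - zeta w)))).
  by apply: cintegrableB; apply: cintegrableZ; apply: pot_integrable; rewrite ?npot_fin.
by apply/funext => z; ring.
Qed.

Let bounded_mul (psi : P * P -> R[i]) (M : R) : cmeas psi -> (forall zw, normc (psi zw) <= M) ->
  cintegrable (leb2 \x leb2)%E (fun zw => psi zw * X zw).
Proof.
move=> cpsi hM; have M0 : 0 <= M := le_trans (normc_ge0 _) (hM ((0, 0), (0, 0))).
have mX := measurable_normc cX.
apply: (@cintegrable_le _ _ _ _ _ (fun zw => M * normc (X zw))).
- exact: cmeasM.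
- exact: measurable_funM.
- by move=> zw; rewrite Normc.normcM ler_wpM2r ?normc_ge0.
- apply: nintZ_fin => //; [by move=> zw; exact: normc_ge0|by case: X_integrable].
Qed.

Let fst_part (psi : P -> R[i]) (M : R) : cmeas psi -> (forall z, normc (psi z) <= M) ->
  cint (leb2 \x leb2)%E (fun zw => psi zw.1 * X zw) = 0.
Proof.
move=> cpsi hM; have i := @bounded_mul (fun zw => psi zw.1) M (cmeas_comp cpsi mfst) (fun zw => hM zw.1).
rewrite cint_prod// -[RHS](cint0 leb2); apply: ae_eq_cint.
- by case: i => mi _; exact: (cmeas_cint leb2 mi).
- exact: cmeas_cst.
- apply: filterS W2 => z Wz /=.
  rewrite cintZ; first by rewrite cint_X_snd Wz !mulr0.
  split; first exact: (cmeas_comp cX (pair1_measurable z)).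
  have [S S0 [hS IS]] := s_bound.
  have mck : measurable_fun setT (fun w => s w * ck z w).
    by apply: measurable_funM => //; exact: measurable_ck.
  apply: (@le_lt_trans _ _ (\int[leb2]_w ((2 * s z) * (s w * ck z w))%:E)%E).
    apply: le_nint.
    - exact: (measurableT_comp (measurable_normc cX) (pair1_measurable z)).
    - exact: measurable_funM.
    - by move=> w; exact: normc_ge0.
    - by move=> w; rewrite -mulrA; exact: X_le.
  apply: nintZ_fin => //; [by move=> w; rewrite mulr_ge0 ?ck_ge0|by rewrite mulr_ge0|].
  exact: le_lt_trans (ck_integral_le z measurable_s hS IS ltr01) (ltry _).
Qed.

Let snd_part (psi : P -> R[i]) (M : R) : cmeas psi -> (forall z, normc (psi z) <= M) ->
  cint (leb2 \x leb2)%E (fun zw => psi zw.2 * X zw) = 0.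
Proof.
move=> cpsi hM; have i := @bounded_mul (fun zw => psi zw.2) M (cmeas_comp cpsi msnd) (fun zw => hM zw.2).
have [mi ioo] := i.
have mn := measurable_normc mi.
rewrite cint_prod//.
have fin : (\int[leb2]_z \int[leb2]_w (normc (psi w * X (z, w)))%:E < +oo)%E.
  by move: ioo; rewrite (nint_prod leb2 leb2 mn (fun _ => normc_ge0 _)).
rewrite (cint_swap mi fin) -[RHS](cint0 leb2); apply: ae_eq_cint.
- have mswap : measurable_fun setT (fun zw : P * P => (zw.2, zw.1)) by exact: measurable_swap.
  exact: (cmeas_cint leb2 (cmeas_comp mi mswap)).
- exact: cmeas_cst.
- apply: filterS W1 => w Ww /=.
  rewrite cintZ; first by rewrite cint_X_fst Ww !mulr0.
  split; first exact: (cmeas_comp cX (pair2_measurable w)).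
  have [S S0 [hS IS]] := s_bound.
  have mck : measurable_fun setT (fun z => s z * ck w z).
    by apply: measurable_funM => //; exact: measurable_ck.
  apply: (@le_lt_trans _ _ (\int[leb2]_z ((2 * s w) * (s z * ck w z))%:E)%E).
    apply: le_nint.
    - exact: (measurableT_comp (measurable_normc cX) (pair2_measurable w)).
    - exact: measurable_funM.
    - by move=> z; exact: normc_ge0.
    - move=> z; rewrite (_ : 2 * s w * _ = 2 * (s z * (s w * ck z w))); first exact: X_le.
      by rewrite ckC; ring.
  apply: nintZ_fin => //; [by move=> z; rewrite mulr_ge0 ?ck_ge0|by rewrite mulr_ge0|].
  exact: le_lt_trans (ck_integral_le w measurable_s hS IS ltr01) (ltry _).
Qed.

(** This is [(zeta z - zeta w) * X (z, w)], also on the diagonal, where both vanish. In this form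
    the variables separate and the integral is a two by two determinant of inner products. *)
Let Y (zw : P * P) : R[i] := (Phi1 zw.1 * conjc (F1 zw.1)) * (Phi2 zw.2 * conjc (F2 zw.2)) -
  (Phi2 zw.1 * conjc (F1 zw.1)) * (Phi1 zw.2 * conjc (F2 zw.2)).

Let Y_num z w : Y (z, w) = (Phi1 z * Phi2 w - Phi1 w * Phi2 z) * conjc (F1 z) * conjc (F2 w).
Proof. by rewrite /Y /=; ring. Qed.

Let tens (f g h k : P -> R[i]) : inH f -> inH g -> inH h -> inH k ->
  cintegrable (leb2 \x leb2)%E (fun zw => (f zw.1 * conjc (g zw.1)) * (h zw.2 * conjc (k zw.2))).
Proof.
move=> Hf Hg Hh Hk.
have i1 := cintegrable_mul (inH_csq Hf) (inH_csq Hg).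
have i2 := cintegrable_mul (inH_csq Hh) (inH_csq Hk).
exact: (cintegrable_tensor i1 i2).
Qed.

Let cint_Y : cint (leb2 \x leb2)%E Y =
  ip leb2 Phi1 F1 * ip leb2 Phi2 F2 - ip leb2 Phi2 F1 * ip leb2 Phi1 F2.
Proof.
rewrite /Y cintB; [|exact: tens|exact: tens].
by congr (_ - _); apply: cint_tensor; apply: cintegrable_mul; exact: inH_csq.
Qed.

(** The error is [(1 - kap) * Y (z, w)] with [normc kap <= 1], and [kap = 1] off the diagonal unless
    one of the points lies beyond [N]. The constant 4 combines 2 for [1 - kap] with 2 from
    [num_le]. *)
Let cutoff_le (N : R) z w : normc (Y (z, w) - (zclamp N z * X (z, w) - zclamp N w * X (z, w))) <=
  4 * ((s z * far N z) * s w) + 4 * (s z * (s w * far N w)).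
Proof.
have /andP[fz0 fz1] := far01 N z; have /andP[fw0 fw1] := far01 N w.
have rhs0 : 0 <= 4 * ((s z * far N z) * s w) + 4 * (s z * (s w * far N w)).
  by apply: addr_ge0; apply: mulr_ge0 => //; apply: mulr_ge0 => //; exact: mulr_ge0.
have [zw|zw] := eqVneq (zeta z) (zeta w).
  have -> : z = w by exact: zeta_inj.
  rewrite (_ : _ - _ = 0) ?(Normc.normc0 R) ?(zeta_inj zw)//; last by rewrite Y_num; ring.
  by move: rhs0; rewrite (zeta_inj zw).
have d0 : zeta z - zeta w != 0 by rewrite subr_eq0.
have n0 : 0 < normc (zeta z - zeta w) by rewrite normc_gt0.
pose kap := (zclamp N z - zclamp N w) / (zeta z - zeta w).
have kap1 : normc kap <= 1.
  by rewrite normc_div ler_pdivrMr// mul1r zclamp_lip.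
have -> : Y (z, w) - (zclamp N z * X (z, w) - zclamp N w * X (z, w)) = (1 - kap) * Y (z, w).
  by rewrite Y_num /X /kap /=; set d := (zeta z - zeta w)^-1; ring.
rewrite [normc (_ * _)]Normc.normcM Y_num.
have hY := num_le z w; set y := normc (_ * conjc (F2 w)) in hY *.
have y0 : 0 <= y by exact: normc_ge0.
have k2 : normc (1 - kap) <= 2.
  by apply: (le_trans (ler_normcB _ _)); rewrite Normc.normc1; lra.
have ssge : 0 <= s z * s w by exact: mulr_ge0.
have ss4 : 0 <= 4 * (s z * s w) by exact: mulr_ge0.
have two : normc (1 - kap) * y <= 4 * (s z * s w).
  by apply: (le_trans (ler_pM (normc_ge0 _) y0 k2 hY)); lra.
have e1 : 4 * ((s z * far N z) * s w) + 4 * (s z * (s w * far N w)) =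
   4 * (s z * s w) * (far N z + far N w) by ring.
rewrite e1.
have [zN|zN] := ltP N (normc (zeta z)).
  apply: (le_trans two); apply: ler_peMr => //.
  by rewrite {1}/far zN lerDl.
have [wN|wN] := ltP N (normc (zeta w)).
  apply: (le_trans two); apply: ler_peMr => //.
  by rewrite {2}/far wN lerDr.
have -> : kap = 1 by rewrite /kap !zclamp_near// divff.
by rewrite subrr (Normc.normc0 R) mul0r; exact: mulr_ge0 ss4 (addr_ge0 fz0 fw0).
Qed.

Lemma wronskian_pairing : ip leb2 Phi1 F1 * ip leb2 Phi2 F2 = ip leb2 Phi2 F1 * ip leb2 Phi1 F2.
Proof.
apply/eqP; rewrite -subr_eq0 -cint_Y -normc_eq0; apply/eqP.
have [S S0 [hS IS]] := s_bound.
(* Each of the two terms of [cutoff_le] integrates to at most [4 * (e * S)]. *)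
apply: (@eq0_of_le _ _ (8 * S)); first exact: normc_ge0.
move=> e e0; have [N N0 hN] := tail_integral measurable_s s_ge0 (le_lt_trans IS (ltry _)) e0.
have NN z : normc (zclamp N z) <= N + N by apply: zclamp_le; exact: ltW.
have cz := cmeas_zclamp N.
have iA := @bounded_mul (fun zw => zclamp N zw.1) _ (cmeas_comp cz mfst) (fun zw => NN zw.1).
have iB := @bounded_mul (fun zw => zclamp N zw.2) _ (cmeas_comp cz msnd) (fun zw => NN zw.2).
have iY : cintegrable (leb2 \x leb2)%E Y by apply: cintegrableB; exact: tens.
have iAB := cintegrableB iA iB; have iD := cintegrableB iY iAB.
have -> : cint (leb2 \x leb2)%E Y =
    cint (leb2 \x leb2)%E (fun zw => Y zw - (zclamp N zw.1 * X zw - zclamp N zw.2 * X zw)).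
  by rewrite (cintB iY iAB) (cintB iA iB) (fst_part cz NN) (snd_part cz NN) !subr0.
have mf := measurable_far N.
have msf : measurable_fun setT (fun z => s z * far N z) by exact: measurable_funM.
have sf0 z : 0 <= s z * far N z by have /andP[? ?] := far01 N z; rewrite mulr_ge0.
rewrite -lee_fin; apply: (le_trans (normc_cint_le iD)).
have m1 : measurable_fun setT (fun zw : P * P => (s zw.1 * far N zw.1) * s zw.2).
  by apply: measurable_funM; [exact: (measurableT_comp msf mfst)|exact: (measurableT_comp measurable_s msnd)].
have m2 : measurable_fun setT (fun zw : P * P => s zw.1 * (s zw.2 * far N zw.2)).
  by apply: measurable_funM; [exact: (measurableT_comp measurable_s mfst)|exact: (measurableT_comp msf msnd)].
apply: (@le_trans _ _ (4%:E * \int[(leb2 \x leb2)%E]_zw ((s zw.1 * far N zw.1) * s zw.2)%:E +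
   4%:E * \int[(leb2 \x leb2)%E]_zw (s zw.1 * (s zw.2 * far N zw.2))%:E)%E).
  apply: (le_nint_lin _ _ m1 m2 _ _ _ (ler0n _ 4) (ler0n _ 4)).
  - by case: iD => mD _; exact: measurable_normc.
  - by move=> zw; exact: normc_ge0.
  - by move=> zw; exact: mulr_ge0.
  - by move=> zw; exact: mulr_ge0.
  - by move=> [z w]; exact: cutoff_le.
rewrite (nint_tensor leb2 leb2 msf measurable_s sf0 s_ge0).
rewrite (nint_tensor leb2 leb2 measurable_s msf s_ge0 sf0).
have h1 : (\int[leb2]_z (s z * far N z)%:E * \int[leb2]_z (s z)%:E <= (e * S)%:E)%E.
  by rewrite EFinM; apply: lee_pmul => //; apply: nint_ge0.
have h2 : (\int[leb2]_z (s z)%:E * \int[leb2]_z (s z * far N z)%:E <= (e * S)%:E)%E.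
  by rewrite muleC.
apply: (@le_trans _ _ (4%:E * (e * S)%:E + 4%:E * (e * S)%:E)%E).
  by apply: leeD; apply: lee_wpmul2l.
by rewrite -!EFinM -EFinD lee_fin le_eqVlt; apply/orP; left; apply/eqP; ring.
Qed.

End wronskian_pairing.

(** * Sets of isolated points are null *)

Lemma dist_lt_double (R : realFieldType) (x y r d e : R) : r \in `](x - d), (x + d)[ ->
  `|y - r| < d -> d < e / 2 -> `|x - y| < e.
Proof.
rewrite in_itv/= ltr_norml => /andP[h1 h2] /andP[h3 h4] de.
by rewrite ltr_norml; apply/andP; split; lra.
Qed.

(** Each point of [Lam] is the only one of [Lam] in some square with rational centre and radius
    [n.+1%:R^-1]. There are countably many such squares, so [Lam] is a countable union of sets with
    at most one point. *)
Lemma isolated_null (R : realType) (Lam : set (R * R)) : isolated Lam = Lam ->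
  {ae leb2, forall q : measurableTypeR R * measurableTypeR R, ~ Lam (q : R * R)}.
Proof.
move=> iso.
pose near (c : nat * rat * rat) (q : R * R) :=
  `|q.1 - ratr c.1.2| < c.1.1.+1%:R^-1 /\ `|q.2 - ratr c.2| < c.1.1.+1%:R^-1.
have /choice[code hcode] : forall q, exists c, Lam q ->
    near c q /\ forall q', Lam q' -> near c q' -> q' = q.
  move=> q; have [Lq|nLq] := pselect (Lam q); last by exists (0%N, 0, 0).
  have : isolated Lam q by rewrite iso.
  move=> [_ [U /nbhs_ballP[e /= e0 eU] UL]].
  have [n ne] := ltr_add_invr (divr_gt0 e0 (ltr0n R 2)); rewrite add0r in ne.
  have n0 : 0 < n.+1%:R^-1 :> R by rewrite invr_gt0 ltr0n.
  have [r hr] : exists r : rat, ratr r \in `](q.1 - n.+1%:R^-1), (q.1 + n.+1%:R^-1)[.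
    by apply: rat_in_itvoo; rewrite ltrD2l (lt_trans _ n0)// oppr_lt0.
  have [t ht] : exists r : rat, ratr r \in `](q.2 - n.+1%:R^-1), (q.2 + n.+1%:R^-1)[.
    by apply: rat_in_itvoo; rewrite ltrD2l (lt_trans _ n0)// oppr_lt0.
  exists (n, r, t) => _; split.
    by rewrite /near /= !(distrC q.1) !(distrC q.2) !ltr_distl; rewrite !in_itv in hr ht.
  move=> q' Lq' [/= h1 h2].
  have : (U `&` Lam) q'.
    by split=> //; apply: eU; split; [exact: dist_lt_double hr h1 ne|exact: dist_lt_double ht h2 ne].
  by rewrite UL.
pose N (k : nat) : set (measurableTypeR R * measurableTypeR R) :=
  [set q | Lam q /\ pickle (code q) = k].
have Nnull k : leb2.-negligible (N k).
  have [[q [Lq qk]]|none] := pselect (exists q, N k q).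
    apply: negligibleS (ae_zeta_neq (zeta q)) => q' [Lq' qk'] /=.
    suff -> : q' = q by rewrite eqxx.
    have cc : code q' = code q by apply: (pcan_inj pickleK); rewrite qk qk'.
    have [_ u] := hcode q Lq; apply: u => //; rewrite -cc.
    by have [] := hcode q' Lq'.
  rewrite (_ : N k = set0); first exact: negligible_set0.
  by apply/seteqP; split=> // q Nq; apply: none; exists q.
apply: (negligibleS _ (negligible_bigcup Nnull)).
move=> q /= /contrapT Lq; exists (pickle (code q)) => //.
Qed.

(** * The orthogonal complement of the mixed system *)

Section main.
Context {R : realType}.
Local Notation P := (measurableTypeR R * measurableTypeR R)%type.
Local Notation mu := (lebesgue_measure : {measure set (measurableTypeR R) -> \bar R}).
Variables (Lam : set (R * R)) (h : R * R -> R -> R[i]).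
Hypothesis Lam_null : {ae leb2, forall q : P, ~ Lam (q : R * R)}.
Hypothesis complete : complete_system Lam tau.
Hypothesis biorth : biorthogonal Lam tau h.
Variables Lam1 Lam2 : set (R * R).
Hypothesis LamU : Lam1 `|` Lam2 = Lam.

Let V : set (R -> R[i]) := orthogonal_complement (tau @` Lam2 `|` h @` Lam1).

Let Lam1_sub l : Lam1 l -> Lam l. Proof. by move=> ?; rewrite -LamU; left. Qed.

Let csq_h l : Lam l -> csq mu (h l).
Proof. by move=> Ll; apply/L2_csq; exact: biorth.1. Qed.

Let ip_h_tau (l l' : R * R) : Lam l -> Lam l' -> ip mu (h l) (tau l') = (l' == l)%:R.
Proof.
move=> Ll Ll'; have e : ip mu (tau l') (h l) = (l' == l)%:R := biorth.2 l' l Ll' Ll.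
rewrite -(conj_ip (csq_tau (l' : P)) (csq_h Ll)) e.
by case: (_ == _); rewrite ?conjc1 ?conjc0.
Qed.

Let V_csq f : V f -> csq mu f. Proof. by case=> /L2_csq. Qed.

Let V_tau f l : V f -> Lam2 l -> ip mu f (tau l) = 0.
Proof. by move=> [_ Vf] Ll; apply: Vf; left; exists l. Qed.

Let V_h f l : V f -> Lam1 l -> ip mu f (h l) = 0.
Proof. by move=> [_ Vf] Ll; apply: Vf; right; exists l. Qed.

Let V_combination f g (c : R[i]) : V f -> V g -> V (fun s => f s - c * g s).
Proof.
move=> Vf Vg; have cf := V_csq Vf; have cg := V_csq Vg; have ccg := csqZ c cg.
split; first by apply/L2_csq; exact: csqB.
have key k : csq mu k -> ip mu f k = 0 -> ip mu g k = 0 -> ip mu (fun s => f s - c * g s) k = 0.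
  by move=> ck fk gk; rewrite ipBl// ipZl// fk gk mulr0 subrr.
move=> k [[l Ll <-]|[l Ll <-]]; apply: key.
- exact: (csq_tau (l : P)).
- exact: V_tau.
- exact: V_tau.
- exact/csq_h/Lam1_sub.
- exact: V_h.
- exact: V_h.
Qed.

Let V_admissible f : V f ->
  admissible (Lam1 : set P) (Lam2 : set P) (fun l : P => Bf (h l)) (Bf f).
Proof.
move=> Vf; have cf := V_csq Vf; split; first exact: (inH_Bf complete).
- by move=> l Ll; rewrite /Bf V_tau// mulr0.
- move=> l Ll; have ch := csq_h (Lam1_sub Ll).
  by rewrite (ip_Bf complete)// -conj_ip// V_h// conjc0 mulr0.
Qed.

Let V_wronsk f1 f2 g : V f1 -> V f2 -> V g ->
  {ae leb2, forall w : P, wronsk (Bf f1) (Bf f2) (Bf g) w = 0}.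
Proof.
move=> V1 V2 Vg.
(* The construction of G needs a point of [Lam]. If there is none, uniqueness is vacuously
   applicable and every transform vanishes. *)
have [[l0 Ll0]|none] := pselect (exists l, Lam l); last first.
  have B0 f w : V f -> Bf f w = 0.
    move=> Vf; have Hf := inH_Bf complete (V_csq Vf).
    by apply: (Bf_unique complete Hf) => l Ll; exfalso; apply: none; exists l.
  by apply: aeW => w; apply: wronsk_eq0; exact: B0.
apply: filterS Lam_null => w Lw.
apply: (@admissible_wronsk _ (Lam : set P) (Lam1 : set P) (Lam2 : set P) (fun l : P => Bf (h l)) l0).
- exact: (Bf_unique complete).
- by move=> l; rewrite -LamU.
- by move=> l Ll; exact: (inH_Bf complete (csq_h Ll)).
- by move=> l l' Ll Ll' /eqP ll; rewrite /Bf ip_h_tau// (negbTE ll) mulr0.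
- by move=> l Ll; rewrite /Bf ip_h_tau// eqxx mulr1 phase_neq0.
- by [].
- exact: V_admissible.
- exact: V_admissible.
- exact: V_admissible.
- exact: Lw.
Qed.

(** [wronskian_pairing] with [F1 = Phi1] and [F2 = Phi2], carried back by the isometry. It is the
    case of equality in Cauchy-Schwarz. *)
Let V_pairing f g : V f -> V g -> ip mu f f * ip mu g g = ip mu g f * ip mu f g.
Proof.
move=> Vf Vg; have cf := V_csq Vf; have cg := V_csq Vg.
have := wronskian_pairing (inH_Bf complete cf) (inH_Bf complete cg) (inH_Bf complete cf)
  (inH_Bf complete cg) (V_wronsk Vf Vg Vf) (V_wronsk Vf Vg Vg).
rewrite !(ip_Bf complete)//.
have c0n : (c0%:C : R[i]) != 0 by rewrite -normc_eq0 normcC gtr0_norm ?gt_eqF ?c0_gt0.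
rewrite !mulrA ![c0%:C * _ * c0%:C]mulrAC -!mulrA => /(mulfI c0n)/(mulfI c0n).
by [].
Qed.

Lemma orthogonal_complement_le1 : at_most_one_dimensional V.
Proof.
have [[e Ve e0]|none] := pselect (exists2 e, V e & sqn mu e != 0); last first.
  exists (fun=> 0).
    split; first by apply/L2_csq; exact: csq0.
    move=> g _; rewrite -/(ip mu (fun=> 0) g) -[RHS](cint0 mu); apply: eq_cint => s.
    by rewrite mul0r.
  move=> f Vf; exists 0.
  have f0 : sqn mu f = 0.
    by apply/eqP; apply: contrapT => /negP ?; apply: none; exists f.
  by apply: filterS (sqn_eq0 (V_csq Vf) f0) => s ->; rewrite mulr0.
exists e => // f Vf; have ce := V_csq Ve; have cf := V_csq Vf.
have ee0 : ip mu e e != 0 by rewrite ip_ff// -normc_eq0 normcC normr_eq0.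
pose c := ip mu f e / ip mu e e; exists c.
have Vk := V_combination c Vf Ve; have ck := V_csq Vk.
set k := (fun s => _) in Vk ck.
(* [k] is the component of [f] orthogonal to [e]. [V_pairing] then forces the squared norms of [e]
   and [k] to have product 0, so [k] is null. *)
have ke : ip mu k e = 0.
  by rewrite /k ipBl ?ipZl//; [rewrite /c divfK// subrr|exact: csqZ].
have := V_pairing Ve Vk; rewrite ke mul0r => /eqP; rewrite mulf_eq0 (negbTE ee0)/=.
rewrite ip_ff// => /eqP /(congr1 (@complex.Re R)) /= k0.
by apply: filterS (sqn_eq0 ck k0) => s /eqP; rewrite /k subr_eq0 => /eqP.
Qed.

End main.

Theorem theorem1p2 (R : realType) (Lam : set (R * R)) (h : R * R -> R -> complex R) :
  isolated Lam = Lam ->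
  complete_system Lam tau ->
  minimal_system Lam tau ->
  biorthogonal Lam tau h ->
  forall Lam1 Lam2 : set (R * R),
    Lam1 `|` Lam2 = Lam -> Lam1 `&` Lam2 = set0 ->
    at_most_one_dimensional
      (orthogonal_complement (tau @` Lam2 `|` h @` Lam1)).
Proof.
move=> iso complete _ biorth Lam1 Lam2 LamU _.
exact: (orthogonal_complement_le1 (isolated_null iso) complete biorth LamU).
Qed.
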